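(* Let $p\in[2,2\ln d]$, $\frac1p+\frac1q=1$, and $\epsilon>0$. Suppose assumptions (A1)–(A6) of the context hold for this $p$, and let the mirror descent linearized augmented Lagrangian algorithm described in the context be run with the following parameters, where $\rho>0$ is a fixed constant and $\rho_k=\rho/K$ for $k=0,\ldots,K-1$: $$\bar\sigma^2=\tfrac{\epsilon^2}{16}+4S_p(\sigma^2+M_f^2)+2M_f^2,\qquad \mu^2=\max\Big\{\tfrac{10(8L_v^2+3)}{27\beta^2},\ \tfrac{8(2L_v^2+1)}{3\beta^2},\ \tfrac{40(M_f^2+M_h^2+m^2\rho^2\bar M_c^2M_c^2)}{\beta^2\epsilon^2}\Big\},$$ $$\eta^2=\min\Big\{\tfrac1{4L_\mu^2},\ \tfrac1{96L_f^2},\ \tfrac{S_p\epsilon^2}{23040L_f^2\bar\sigma^2}\Big\},\qquad \alpha=96L_f^2\eta^2,\qquad n_0=\Big\lceil\tfrac{5(p-1)\bar\sigma^2}{4\epsilon^2}\Big\rceil,\qquad n=\lceil(p-1)S_p\rceil,$$ $$\nu^2=\min\Big\{\tfrac{\epsilon^2}{4(4L_f^2+3\eta^{-2})\mathbb E_u[\|u\|_2^6]},\ \tfrac{\beta^2\mu^2\eta^2\epsilon^2}{20(2L_v^2+1)\mathbb E_u[\|u\|_2^6]}\Big\},\qquad K=\Big\lceil\max\Big\{\tfrac{108\Delta_0}{\eta\epsilon^2},\ \tfrac{5\|c(x^0)\|_2^2}{\epsilon^2},\ \tfrac1{L_f^2\eta^2}\Big\}\Big\rceil,$$ with $L_\mu$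 and $\Delta_0$ as defined in the context. If $\|c(x^0)\|_2^2\le 1/\mu$, then the output $x^R$ of the algorithm is an $\epsilon$-KKT point, and the oracle complexity (total number of evaluations of stochastic function values $F(\cdot;\xi)$) is of order $\mathcal O(pS_p\epsilon^{-3})$.
   Context: Problem. Let $d\ge3$ and $m\ge1$. Consider $\min_{x\in X}\Phi(x):=f(x)+h(x)$ subject to $c(x)=0$, where $f(x)=\mathbb E_\xi[F(x;\xi)]$, $X\subset\mathbb R^d$ is convex, $f:\mathbb R^d\to\mathbb R$ and $c=(c_1,\ldots,c_m):\mathbb R^d\to\mathbb R^m$ are continuously differentiable, $\xi\sim\mathbb P$ is a random variable independent of $x$, $F(\cdot;\xi)$ is continuously differentiable for almost every $\xi$, and $h:\mathbb R^d\to\mathbb R\cup\{\infty\}$ is convex. Write $\nabla c(x)^\top\lambda=\sum_i\lambda_i\nabla c_i(x)$. For a norm exponent $p\ge2$, $q$ is defined by $\frac1p+\frac1q=1$. $\mathcal N_X(x)$ is the normal cone of $X$ at $x$ and $\mathrm{dist}_p(a,B)=\inf_{b\in B}\|a-b\|_p$. Let $\mathbb P_u$ be the sampling distribution of a random vector $u\in\mathbb R^d$; for $\nu>0$ let $X_\nu=\{x+t\nu u: x\in X,\ t\in[0,1],\ u\text{ in the range of }\mathbb P_u\}$ and let $\mathcal O_\nu$ be an open set containing $X_\nu$. Assumptions. (A1) $X$ is nonempty, closed, convex and $\|x\|_q\le D_X$ for all $x\in X$ ($D_X>0$). $\|\nabla f(x)-\nabla f(y)\|_2\le L_f\|x-y\|_2$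 and $|f(x)-f(y)|\le M_f\|x-y\|_2$ for all $x,y\in\mathcal O_\nu$ ($L_f,M_f>0$). $h$ is proper, lower semicontinuous and convex over $X$, and for all $x\in X$, $\partial h(x)\neq\emptyset$ and $\sup_{g\in\partial h(x)}\|g\|_2\le M_h$ ($M_h>0$). For $i=1,\ldots,m$ and $x,y\in X$: $|c_i(x)|\le\bar M_c$, $\|\nabla c_i(x)\|_2\le M_c$, $\|\nabla c_i(x)-\nabla c_i(y)\|_2\le L_c\|x-y\|_2$ ($\bar M_c,M_c,L_c>0$). $\Phi$ has a finite lower bound $\Phi_{\inf}$ over $X$. (A2) For all $x\in\mathcal O_\nu$: $\mathbb E_\xi[\nabla F(x;\xi)]=\nabla f(x)$ and $\mathbb E_\xi[\|\nabla F(x;\xi)-\nabla f(x)\|_2^2]\le\sigma^2$ ($\sigma>0$). (A3) $(\mathbb E_\xi[\|\nabla F(x;\xi)-\nabla F(y;\xi)\|_2^2])^{1/2}\le L_f\|x-y\|_2$ for all $x,y\in\mathcal O_\nu$. (A4) There is a constant $S_p\ge1$ with $\mathbb E_u[\|\langle g,u\rangle u\|_p^2]\le S_p\|g\|_2^2$ for all $g\in\mathbb R^d$; moreover $\mathbb E_u[uu^\top]=I_d$ and $\mathbb E_u[\|u\|_2^6]<\infty$. (A5) The distance-generating function $v:\mathbb R^d\to\mathbb R$ satisfies $\langle x-y,\nabla v(x)-\nabla v(y)\rangle\ge\|x-y\|_q^2$ for all $x,y\in\mathbb R^d$ and $\|\nabla v(x)-\nabla v(y)\|_p\le L_v\|x-y\|_q$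 for all $x,y\in X$. (A6) There is a constant $\beta>0$ such that the iterates $x^0,\ldots,x^K$ of the algorithm satisfy $\beta\|c(x^k)\|_p\le\mathrm{dist}_p(\nabla c(x^k)^\top c(x^k),-\mathcal N_X(x^k))$ for $k=0,\ldots,K$. Algorithm. Let $G_\nu(x;u,\xi)=\frac{F(x+\nu u;\xi)-F(x;\xi)}{\nu}u$ and $V(x,y)=v(y)-v(x)-\langle\nabla v(x),y-x\rangle$. Inputs: $x^0\in X$, $\lambda^0=0\in\mathbb R^m$, $\mu,\eta,\nu>0$, $\alpha\in(0,1]$, $\rho_k\in(0,\mu)$, positive integers $K,n_0,n$. All random directions $u_j^k\sim\mathbb P_u$ and samples $\xi_j^k\sim\mathbb P$ are mutually independent. For $k=0,\ldots,K-1$: $s^0=\frac1{n_0}\sum_{j=1}^{n_0}G_\nu(x^0;u_j^0,\xi_j^0)$, and for $k\ge1$, $s^k=\frac1n\sum_{j=1}^n[G_\nu(x^k;u_j^k,\xi_j^k)+(1-\alpha)(s^{k-1}-G_\nu(x^{k-1};u_j^k,\xi_j^k))]$; $x^{k+1}=\arg\min_{x\in X}\langle s^k+\nabla c(x^k)^\top(\lambda^k+\mu c(x^k)),x\rangle+h(x)+\frac1\eta V(x^k,x)$; $\lambda^{k+1}=\lambda^k+\rho_kc(x^k)$. Output $x^R$, with $R$ uniform on $\{0,\ldots,K-1\}$. Constants. $\mathcal L(x,\lambda;\mu)=f(x)+h(x)+\lambda^\top c(x)+\frac\mu2\|c(x)\|_2^2$; $L_\mu=L_f+m(\mu M_c^2+\mu\bar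 M_cL_c+\rho\bar M_cL_c)$; $\Delta_0=\mathcal L(x^0,\lambda^0;\mu)-\Phi_{\inf}+2m\rho\bar M_c^2$. $\epsilon$-KKT point. With $\mathcal G_X(x,g,\eta)=\frac1\eta(x-x^+)$, $x^+=\arg\min_{y\in X}\langle g,y\rangle+h(y)+\frac1\eta V(x,y)$, a (random) point $x\in X$ is an $\epsilon$-KKT point if there is a (random) $\lambda\in\mathbb R^m$ with $\mathbb E[\|\mathcal G_X(x,\nabla f(x)+\nabla c(x)^\top\lambda,\eta)\|_q^2]\le\epsilon^2$ and $\mathbb E[\|c(x)\|_p^2]\le\epsilon^2$, where $\eta$ is the algorithm's step parameter and the expectation is over all randomness of the algorithm. Convention. $\mathcal O(\cdot)$ is for $\epsilon\in(0,1]$ and hides a constant independent of $\epsilon,p,S_p$, depending only on $L_f,M_f,M_h,M_c,\bar M_c,L_c,L_v,m,\sigma,\beta,\rho$ and $f(x^0)+h(x^0)-\Phi_{\inf}$. *)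

(* Defs.v *)
From HB Require Import structures.
From mathcomp Require Import all_boot all_order all_algebra finmap.
From mathcomp Require Import all_classical all_reals all_analysis.
Export numFieldNormedType.Exports.

Set Implicit Arguments.
Unset Strict Implicit.
Unset Printing Implicit Defensive.

Import Order.TTheory GRing.Theory Num.Theory.

Local Open Scope classical_set_scope.
Local Open Scope ring_scope.

(* Vectors of R^d are row vectors. The norm carried by 'rV[R]_d in the library
   is the sup norm; it is used below only for the topology and for
   differentiability, the norms of the problem being [pnorm]. *)

Section euclidean.
Context {R : realType}.

Definition dotv d (x y : 'rV[R]_d) : R := \sum_i x 0 i * y 0 i.

Definition pnorm (p : R) d (x : 'rV[R]_d) : R :=
  (\sum_i `|x 0 i| `^ p) `^ p^-1.

Definition gradient d (f : 'rV[R]_d -> R) (x : 'rV[R]_d) : 'rV[R]_d :=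
  \row_i 'D_(delta_mx 0 i) f x.

Definition continuously_differentiable d (f : 'rV[R]_d -> R) : Prop :=
  (forall x, differentiable f x) /\ continuous (gradient f).

(* sum_i lam_i * (gradient of c_i at x) *)
Definition jacT d m (c : 'rV[R]_d -> 'rV[R]_m) (x : 'rV[R]_d)
    (lam : 'rV[R]_m) : 'rV[R]_d :=
  \sum_i lam 0 i *: gradient (fun y => c y 0 i) x.

Definition normal_cone d (X : set 'rV[R]_d) (x : 'rV[R]_d) : set 'rV[R]_d :=
  [set g | X x /\ forall y, X y -> dotv g (y - x) <= 0].

Definition distp (p : R) d (a : 'rV[R]_d) (B : set 'rV[R]_d) : R :=
  inf [set pnorm p (a - b) | b in B].

Local Open Scope ereal_scope.

Definition convex_efun d (h : 'rV[R]_d -> \bar R) : Prop :=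
  forall (x y : 'rV[R]_d) (t : R), (0 <= t <= 1)%R ->
    h (t *: x + (1 - t) *: y)%R <= t%:E * h x + (1 - t)%:E * h y.

Definition proper_on d (X : set 'rV[R]_d) (h : 'rV[R]_d -> \bar R) : Prop :=
  (exists2 x, X x & h x < +oo) /\ (forall x, X x -> -oo < h x).

Definition subdifferential d (h : 'rV[R]_d -> \bar R) (x : 'rV[R]_d) :
    set 'rV[R]_d :=
  [set g | forall y, h x + (dotv g (y - x))%:E <= h y].

Definition argmin_on d (X : set 'rV[R]_d) (phi : 'rV[R]_d -> \bar R) :
    set 'rV[R]_d :=
  [set y | X y /\ forall z, X z -> phi y <= phi z].

End euclidean.

Section mirror.
Context {R : realType} {d : nat}.
Variables (X : set 'rV[R]_d) (h : 'rV[R]_d -> \bar R) (v : 'rV[R]_d -> R).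
Variable eta : R.

Definition bregman (x y : 'rV[R]_d) : R :=
  v y - v x - dotv (gradient v x) (y - x).

(* [get] returns an arbitrary point when there is no minimizer; under the
   assumptions below the minimizer exists (X is compact, h is lower
   semicontinuous) and is unique (v is strongly convex). *)
Definition mirror_step (g x : 'rV[R]_d) : 'rV[R]_d :=
  get (argmin_on X
    (fun y => (dotv g y)%:E + h y + (eta^-1 * bregman x y)%:E)%E).

Definition gradient_mapping (g x : 'rV[R]_d) : 'rV[R]_d :=
  eta^-1 *: (x - mirror_step g x).

End mirror.

Notation borelRV R d := (g_sigma_algebraType (@open 'rV[R]_d)).

Section probability_notions.
Context {R : realType}.

Definition msupport d (Pu : probability (borelRV R d) R) : set 'rV[R]_d :=
  [set u | forall U : set 'rV[R]_d, open U -> U u -> (0 < Pu U)%E].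

Definition mutually_independent d (T : measurableType d)
    (P : probability T R) (I : choiceType) (D : set I)
    (G : I -> set (set T)) : Prop :=
  forall (J : {fset I}) (E : I -> set T),
    [set` J] `<=` D -> (forall i, i \in J -> G i (E i)) ->
    P (\big[setI/setT]_(i <- J) E i) = (\prod_(i <- J) P (E i))%E.

Definition sixth_moment d (Pu : probability (borelRV R d) R) : \bar R :=
  ('E_Pu[fun u : 'rV[R]_d => (pnorm 2 u ^+ 6)%R])%E.

End probability_notions.

Section problem.
Context {R : realType} {d m : nat}.
Implicit Types (X Onu : set 'rV[R]_d) (f v : 'rV[R]_d -> R).
Implicit Types (h : 'rV[R]_d -> \bar R) (c : 'rV[R]_d -> 'rV[R]_m).

Definition enlarged_set X (Pu : probability (borelRV R d) R) (nu : R) :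
    set 'rV[R]_d :=
  [set y | exists x t u,
    [/\ X x, 0 <= t <= 1, msupport Pu u & y = x + (t * nu) *: u]].

Record standing_assumptions dX (Xi : measurableType dX)
    (Pxi : probability Xi R) (F : 'rV[R]_d -> Xi -> R) f h c : Prop := {
  standing_F_meas : forall x, measurable_fun setT (F x) ;
  standing_F_mean : forall x, ('E_Pxi[F x] = (f x)%:E)%E ;
  standing_F_C1 :
    {ae Pxi, forall z, continuously_differentiable (fun x => F x z)} ;
  standing_f_C1 : continuously_differentiable f ;
  standing_c_C1 : forall i, continuously_differentiable (fun x => c x 0 i) ;
  standing_h_gtNy : forall x, (-oo < h x)%E ;
  standing_h_convex : convex_efun h }.

Record assumption1 (q : R) X Onu f h c
    (D_X L_f M_f M_h Mbar_c M_c L_c Phi_inf : R) : Prop := {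
  A1_X_nonempty : X !=set0 ;
  A1_X_closed : closed X ;
  A1_X_convex : convex_set X ;
  A1_X_bounded : forall x, X x -> pnorm q x <= D_X ;
  A1_f_smooth : forall x y, Onu x -> Onu y ->
    pnorm 2 (gradient f x - gradient f y) <= L_f * pnorm 2 (x - y) ;
  A1_f_lipschitz : forall x y, Onu x -> Onu y ->
    `|f x - f y| <= M_f * pnorm 2 (x - y) ;
  A1_h_proper : proper_on X h ;
  (* lower semicontinuity relative to X *)
  A1_h_lsc : lower_semicontinuous (h : subspace X -> \bar R) ;
  A1_h_subdiff_nonempty : forall x, X x -> subdifferential h x !=set0 ;
  A1_h_subdiff_bounded : forall x g, X x -> subdifferential h x g ->
    pnorm 2 g <= M_h ;
  A1_c_bounded : forall i x, X x -> `|c x 0 i| <= Mbar_c ;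
  A1_grad_c_bounded : forall i x, X x ->
    pnorm 2 (gradient (fun y => c y 0 i) x) <= M_c ;
  A1_c_smooth : forall i x y, X x -> X y ->
    pnorm 2 (gradient (fun z => c z 0 i) x - gradient (fun z => c z 0 i) y)
      <= L_c * pnorm 2 (x - y) ;
  A1_lower_bound : forall x, X x -> (Phi_inf%:E <= (f x)%:E + h x)%E }.

Section stochastic_gradients.
Context {dX} {Xi : measurableType dX} (Pxi : probability Xi R).
Variable F : 'rV[R]_d -> Xi -> R.

Definition stochastic_gradient (x : 'rV[R]_d) (z : Xi) : 'rV[R]_d :=
  gradient (fun y => F y z) x.

(* The equality of the mean with a finite value contains integrability. *)
Record assumption2 Onu f (sigma : R) : Prop := {
  A2_unbiased : forall x i, Onu x ->
    ('E_Pxi[fun z => stochastic_gradient x z 0%R i]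
      = (gradient f x 0%R i)%:E)%E ;
  A2_variance : forall x, Onu x ->
    ('E_Pxi[fun z =>
        (pnorm 2 (stochastic_gradient x z - gradient f x) ^+ 2)%R]
      <= (sigma ^+ 2)%:E)%E }.

Definition assumption3 Onu (L_f : R) : Prop := forall x y, Onu x -> Onu y ->
  ('E_Pxi[fun z => (pnorm 2 (stochastic_gradient x z
                             - stochastic_gradient y z) ^+ 2)%R] `^ 2^-1
    <= (L_f * pnorm 2 (x - y))%:E)%E.

End stochastic_gradients.

Record assumption4 (p : R) (Pu : probability (borelRV R d) R) (S_p : R) :
    Prop := {
  A4_Sp_ge1 : 1 <= S_p ;
  A4_Sp : forall g : 'rV[R]_d,
    ('E_Pu[fun u : 'rV[R]_d => (pnorm p (dotv g u *: u) ^+ 2)%R]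
      <= (S_p * pnorm 2 g ^+ 2)%:E)%E ;
  A4_covariance : forall i j : 'I_d,
    ('E_Pu[fun u : 'rV[R]_d => (u 0 i * u 0 j)%R] = (i == j)%:R%:E)%E ;
  A4_sixth_moment : (sixth_moment Pu < +oo)%E }.

Record assumption5 (p q : R) X v (L_v : R) : Prop := {
  A5_v_diff : forall x, differentiable v x ;
  A5_v_strong : forall x y,
    pnorm q (x - y) ^+ 2 <= dotv (x - y) (gradient v x - gradient v y) ;
  A5_v_smooth : forall x y, X x -> X y ->
    pnorm p (gradient v x - gradient v y) <= L_v * pnorm q (x - y) }.

Definition assumption6 dW (W : measurableType dW) (P : probability W R)
    (p : R) X c (beta : R) (K : nat) (x : nat -> W -> 'rV[R]_d) : Prop :=
  {ae P, forall w, forall k, (k <= K)%N ->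
    beta * pnorm p (c (x k w)) <=
    distp p (jacT c (x k w) (c (x k w)))
            [set - g | g in normal_cone X (x k w)]}.

Definition aug_lagrangian f h c (mu : R) (x : 'rV[R]_d) (lam : 'rV[R]_m) :
    \bar R :=
  ((f x)%:E + h x + (dotv lam (c x) + mu / 2 * pnorm 2 (c x) ^+ 2)%:E)%E.

Definition L_const (L_f M_c Mbar_c L_c rho mu : R) : R :=
  L_f + m%:R * (mu * M_c ^+ 2 + mu * Mbar_c * L_c + rho * Mbar_c * L_c).

Definition Delta0_const f h c (Mbar_c Phi_inf rho mu : R) (x0 : 'rV[R]_d) : R :=
  fine (aug_lagrangian f h c mu x0 0) - Phi_inf
  + 2 * m%:R * rho * Mbar_c ^+ 2.

Definition eps_KKT dW (W : measurableType dW) (P : probability W R)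
    X f h c v (p q eta eps : R) (x : W -> 'rV[R]_d) : Prop :=
  (forall w, X (x w)) /\
  exists lam : {RV P >-> borelRV R m},
    ('E_P[fun w => (pnorm q (gradient_mapping X h v eta
            (gradient f (x w) + jacT c (x w) (lam w)) (x w)) ^+ 2)%R]
       <= (eps ^+ 2)%:E)%E /\
    ('E_P[fun w => (pnorm p (c (x w)) ^+ 2)%R] <= (eps ^+ 2)%:E)%E.

End problem.

Arguments L_const {R} m.

Section algorithm.
Context {R : realType} {d m : nat} {dX} {Xi : measurableType dX}
  {dW} {W : measurableType dW} (P : probability W R).
Variables (Pu : probability (borelRV R d) R) (Pxi : probability Xi R).
Variables (K n0 n : nat).

Section sampling.
Variables (u : nat -> nat -> {RV P >-> borelRV R d})
          (xi : nat -> nat -> {RV P >-> Xi}) (idx : W -> 'I_K).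

Definition batch_size (k : nat) : nat := if k is 0 then n0 else n.

(* One index for each random object of a run: the directions u_j^k, the
   samples xi_j^k, and the output index. *)
Definition source : Type := ((nat * nat) + (nat * nat) + unit)%type.

Definition source_used : set source := [set s |
  match s with
  | inl (inl (k, j)) | inl (inr (k, j)) => (k < K)%N && (j < batch_size k)%N
  | inr _ => true
  end].

Definition source_events (s : source) : set (set W) :=
  match s with
  | inl (inl (k, j)) => [set u k j @^-1` B | B in measurable]
  | inl (inr (k, j)) => [set xi k j @^-1` B | B in measurable]
  | inr _ => [set idx @^-1` B | B in setT]
  end.

Record sampling : Prop := {
  sampling_u : forall k j, source_used (inl (inl (k, j))) ->
    forall B, measurable B -> distribution P (u k j) B = Pu B ;
  sampling_xi : forall k j, source_used (inl (inr (k, j))) ->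
    forall B, measurable B -> distribution P (xi k j) B = Pxi B ;
  sampling_idx_meas : forall r, measurable (idx @^-1` [set r]) ;
  sampling_idx : forall r, P (idx @^-1` [set r]) = (K%:R^-1)%:E ;
  sampling_indep : mutually_independent P source_used source_events }.

End sampling.

Variables (X : set 'rV[R]_d) (F : 'rV[R]_d -> Xi -> R)
  (h : 'rV[R]_d -> \bar R) (c : 'rV[R]_d -> 'rV[R]_m) (v : 'rV[R]_d -> R).
Variables (mu eta nu alpha : R) (rho_ : nat -> R).

Definition zo_estimator (x : 'rV[R]_d) (u : 'rV[R]_d) (z : Xi) : 'rV[R]_d :=
  ((F (x + nu *: u) z - F x z) / nu) *: u.

Definition zo_queries (x : 'rV[R]_d) (u : 'rV[R]_d) (z : Xi) :
    seq ('rV[R]_d * Xi) :=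
  [:: (x + nu *: u, z); (x, z)].

Variables (u : nat -> nat -> W -> 'rV[R]_d) (xi : nat -> nat -> W -> Xi).

Record mdlalm_run (x0 : 'rV[R]_d) (x s : nat -> W -> 'rV[R]_d)
    (lam : nat -> W -> 'rV[R]_m) : Prop := {
  run_x0 : forall w, x 0 w = x0 ;
  run_lam0 : forall w, lam 0 w = 0 ;
  run_s0 : forall w, s 0 w =
    n0%:R^-1 *: \sum_(j < n0) zo_estimator (x 0 w) (u 0 j w) (xi 0 j w) ;
  run_s : forall k w, (k.+1 < K)%N -> s k.+1 w =
    n%:R^-1 *: \sum_(j < n)
      (zo_estimator (x k.+1 w) (u k.+1 j w) (xi k.+1 j w)
       + (1 - alpha) *:
         (s k w - zo_estimator (x k w) (u k.+1 j w) (xi k.+1 j w))) ;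
  run_x : forall k w, (k < K)%N -> x k.+1 w =
    mirror_step X h v eta
      (s k w + jacT c (x k w) (lam k w + mu *: c (x k w))) (x k w) ;
  run_lam : forall k w, (k < K)%N ->
    lam k.+1 w = lam k w + rho_ k *: c (x k w) }.

(* The pairs (y, z) at which s^k evaluates F, in order and with repetitions. *)
Definition step_queries (x : nat -> W -> 'rV[R]_d) (w : W) (k : nat) :
    seq ('rV[R]_d * Xi) :=
  if k is k'.+1 then
    flatten [seq zo_queries (x k w) (u k j w) (xi k j w)
                 ++ zo_queries (x k' w) (u k j w) (xi k j w) | j <- iota 0 n]
  else flatten [seq zo_queries (x 0 w) (u 0 j w) (xi 0 j w) | j <- iota 0 n0].

Definition oracle_complexity (x : nat -> W -> 'rV[R]_d) (w : W) : nat :=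
  size (flatten [seq step_queries x w k | k <- iota 0 K]).

End algorithm.

(* Main.v *)
(* Let e_k = s^k - grad f(x^k) and d_k = x^(k+1) - x^k. On X the augmented
   Lagrangian is L_mu-smooth and L_mu * eta <= 1/2, so summing the descent
   inequality of the mirror steps gives, on every path,
     sum_k |d_k|_q^2 / (2 eta^2) <= Delta_0 / eta + sum_k |e_k|_p^2.
   The momentum estimator satisfies a converse bound. For p >= 2 the squared
   p-norm is smooth with constant of order p - 1, so adding the centered
   contribution of one sample at a time costs only p - 1 times its second moment,
   with no cross terms in expectation; hence the mean-square fluctuation E_k of
   s^k around its conditional mean obeys
     E_(k+1) <= (1 - alpha)^2 E_k + alpha V + (alpha / 6) E|d_k|_q^2 / eta^2,
   where V is of order eps^2, while the smoothing bias is at most L_f^2 nu^2 E|u|^6.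
   Averaging both inequalities bounds the averages of E|d_k|_q^2 / eta^2 and
   E|e_k|_p^2 by constants times eps^2. The gradient mapping at x^k with
   multiplier lambda^k + mu c(x^k) is controlled by d_k and e_k because mirror
   steps are Lipschitz in the gradient. For the constraint, the optimality
   condition of the mirror step, split along the tangent cone to absorb the
   nonsmooth term h, places a point of -N_X(x^(k+1)) within distance
   O(1) + O(|e_k|_p + |d_k|_q / eta) of mu times the gradient of |c|_2^2 / 2, so
   assumption (A6) bounds mu beta |c(x^(k+1))|_p by the same quantity. *)

(* The two averaged inequalities feed each other, and the proof closes because the loop gain is
   below one: momentum passes at most a sixth of the mean squared step into the fluctuation, adding
   the bias costs a factor 5/4, the descent inequality a factor 2, in all 5/12. No conditional
   expectation is formed. A history is [W] itself with the sigma-algebra generated by earlier draws;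
   independence makes the joint law of history and fresh sample a product, and Tonelli integrates
   the fresh sample with the past frozen. This needs measurable iterates, although a mirror step is
   only a chosen minimizer: its Lipschitz dependence on a dual variable gives uniqueness and
   measurability together. The gradient of F is Lipschitz in mean square only, so the remainder of a
   finite difference is controlled by integrating a squared derivative along the segment, not by a
   mean value theorem on each sample. Since F is smooth for almost every sample only, the analysis
   runs on a copy of F set to zero on the bad samples; its run coincides almost surely with the
   given one. *)
Require Import Defs.
From HB Require Import structures.
From mathcomp Require Import all_boot all_order all_algebra finmap.
From mathcomp Require Import all_classical all_reals all_analysis measurable_realfun.
From mathcomp Require Import ring lra.
Import Order.TTheory GRing.Theory Num.Theory.
Import numFieldNormedType.Exports.

Set Implicit Arguments.
Unset Strict Implicit.
Unset Printing Implicit Defensive.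

Local Open Scope classical_set_scope.
Local Open Scope ring_scope.

(** * Norms *)

(* Sealed copy of [pnorm]: comparing two transparent p-norms by conversion
   would unfold real powers down to the exponential series. *)
HB.lock Definition lpnorm {R : realType} (p : R) {d : nat} (x : 'rV[R]_d) : R :=
  pnorm p x.

Lemma pnormE {R : realType} {d} (p : R) (x : 'rV[R]_d) : pnorm p x = lpnorm p x.
Proof. by rewrite lpnorm.unlock. Qed.

Section pnorm_theory.
Context {R : realType} {d : nat}.
Implicit Types (x y z : 'rV[R]_d) (p q r a : R).

Lemma lpnormE p x : lpnorm p x = (\sum_i `|x 0 i| `^ p) `^ p^-1.
Proof. by rewrite lpnorm.unlock. Qed.

Lemma sum_powR_ge0 p x : 0 <= \sum_i `|x 0 i| `^ p.
Proof. by apply: sumr_ge0 => i _; exact: powR_ge0. Qed.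

Lemma lpnorm_ge0 p x : 0 <= lpnorm p x.
Proof. by rewrite lpnormE; exact: powR_ge0. Qed.

Lemma powR_lpnorm p x : p != 0 -> lpnorm p x `^ p = \sum_i `|x 0 i| `^ p.
Proof. by move=> p0; rewrite !lpnormE -powRrM mulVf// powRr1// sum_powR_ge0. Qed.

Lemma lpnormZ p a x : p != 0 -> lpnorm p (a *: x) = `|a| * lpnorm p x.
Proof.
move=> p0; rewrite !lpnormE.
under eq_bigr do rewrite mxE normrM powRM//.
rewrite -mulr_sumr powRM ?powR_ge0 ?sum_powR_ge0//.
by rewrite -powRrM mulfV// powRr1.
Qed.

Lemma lpnormN p x : p != 0 -> lpnorm p (- x) = lpnorm p x.
Proof. by move=> p0; rewrite -scaleN1r lpnormZ// normrN1 mul1r. Qed.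

Lemma lpnorm0 p : p != 0 -> lpnorm p (0 : 'rV[R]_d) = 0.
Proof. by move=> p0; rewrite -(scale0r (0 : 'rV[R]_d)) lpnormZ// normr0 mul0r. Qed.

Lemma lpnorm_distC p x y : p != 0 -> lpnorm p (x - y) = lpnorm p (y - x).
Proof. by move=> p0; rewrite -opprB lpnormN. Qed.

Lemma le_coord_lpnorm p x i : 0 < p -> `|x 0 i| <= lpnorm p x.
Proof.
move=> p0; rewrite lpnormE -[leLHS](@powRr1 _ `|x 0 i|)// -(mulfV (lt0r_neq0 p0)) powRrM.
apply: ge0_ler_powR; rewrite ?invr_ge0 ?(ltW p0)// ?nnegrE ?powR_ge0 ?sum_powR_ge0//.
by rewrite (bigD1 i)//= lerDl; apply: sumr_ge0 => j _; exact: powR_ge0.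
Qed.

Lemma lpnorm_eq0 p x : 0 < p -> lpnorm p x = 0 -> x = 0.
Proof.
move=> p0 x0; apply/rowP => i; rewrite mxE; apply/eqP.
by rewrite -normr_le0 -x0 le_coord_lpnorm.
Qed.

Lemma dotvC x y : dotv x y = dotv y x.
Proof. by apply: eq_bigr => i _; rewrite mulrC. Qed.

Lemma dotvDl x y z : dotv (x + y) z = dotv x z + dotv y z.
Proof. by rewrite -big_split; apply: eq_bigr => i _; rewrite mxE mulrDl. Qed.

Lemma dotvNl x y : dotv (- x) y = - dotv x y.
Proof. by rewrite -sumrN; apply: eq_bigr => i _; rewrite mxE mulNr. Qed.

Lemma dotvBl x y z : dotv (x - y) z = dotv x z - dotv y z.
Proof. by rewrite dotvDl dotvNl. Qed.

Lemma dotvZl a x y : dotv (a *: x) y = a * dotv x y.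
Proof. by rewrite mulr_sumr; apply: eq_bigr => i _; rewrite mxE mulrA. Qed.

Lemma dotvDr x y z : dotv x (y + z) = dotv x y + dotv x z.
Proof. by rewrite !(dotvC x) dotvDl. Qed.

Lemma dotvNr x y : dotv x (- y) = - dotv x y.
Proof. by rewrite !(dotvC x) dotvNl. Qed.

Lemma dotvBr x y z : dotv x (y - z) = dotv x y - dotv x z.
Proof. by rewrite !(dotvC x) dotvBl. Qed.

Lemma dotvZr a x y : dotv x (a *: y) = a * dotv x y.
Proof. by rewrite !(dotvC x) dotvZl. Qed.

Lemma dotv0l x : dotv 0 x = 0.
Proof. by rewrite -(scale0r x) dotvZl mul0r. Qed.

Lemma dotv0r x : dotv x 0 = 0.
Proof. by rewrite dotvC dotv0l. Qed.

Lemma lpnorm2_sqr x : lpnorm 2 x ^+ 2 = dotv x x.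
Proof.
rewrite -powR_mulrn ?lpnorm_ge0// powR_lpnorm//.
by apply: eq_bigr => i _; rewrite powR_mulrn// real_normK ?num_real// expr2.
Qed.

Lemma sum_powR_normalized p x : p != 0 -> lpnorm p x != 0 ->
  \sum_i (`|x 0 i| / lpnorm p x) `^ p = 1.
Proof.
move=> p0 x0; rewrite (eq_bigr (fun i => `|x 0 i| `^ p * (lpnorm p x)^-1 `^ p)).
  rewrite -mulr_suml -powR_lpnorm// -powRM ?invr_ge0 ?lpnorm_ge0//.
  by rewrite divff// powR1.
by move=> i _; rewrite powRM// invr_ge0 lpnorm_ge0.
Qed.

(** Young's inequality in each coordinate, after scaling both vectors to norm one. *)
Lemma hoelder_dotv p q x y : 0 < p -> 0 < q -> p^-1 + q^-1 = 1 ->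
  `|dotv x y| <= lpnorm p x * lpnorm q y.
Proof.
move=> p0 q0 pq.
have [x0|x0] := eqVneq (lpnorm p x) 0.
  by rewrite (lpnorm_eq0 p0 x0) dotv0l normr0 mulr_ge0 ?lpnorm_ge0.
have [y0|y0] := eqVneq (lpnorm q y) 0.
  by rewrite (lpnorm_eq0 q0 y0) dotv0r normr0 mulr_ge0 ?lpnorm_ge0.
have xp : 0 < lpnorm p x by rewrite lt_def x0 lpnorm_ge0.
have yp : 0 < lpnorm q y by rewrite lt_def y0 lpnorm_ge0.
apply: (le_trans (ler_norm_sum _ _ _)).
rewrite -[leRHS]mulr1 -ler_pdivrMl ?mulr_gt0//.
rewrite mulr_sumr.
have -> : 1 = p^-1 * \sum_i (`|x 0 i| / lpnorm p x) `^ p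
            + q^-1 * \sum_i (`|y 0 i| / lpnorm q y) `^ q :> R.
  by rewrite !sum_powR_normalized ?gt_eqF// !mulr1 pq.
rewrite !mulr_sumr -big_split/=; apply: ler_sum => i _.
have := @conjugate_powR _ (`|x 0 i| / lpnorm p x) (`|y 0 i| / lpnorm q y) p q.
rewrite !divr_ge0 ?lpnorm_ge0// => /(_ isT isT p0 q0 pq).
rewrite ![_^-1 * _ `^ _]mulrC; apply: le_trans.
by rewrite normrM invfM mulrACA ![_^-1 * `|_|]mulrC.
Qed.

Lemma cauchy_schwarz_dotv x y : `|dotv x y| <= lpnorm 2 x * lpnorm 2 y.
Proof. by apply: hoelder_dotv => //; lra. Qed.

(** After dividing by the p-norm every coordinate is at most 1 in absolute value, so a larger
    exponent gives smaller powers. *)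
Lemma le_lpnorm p r x : 0 < p -> p <= r -> lpnorm r x <= lpnorm p x.
Proof.
move=> p0 pr; have r0 := lt_le_trans p0 pr.
have [x0|x0] := eqVneq (lpnorm p x) 0.
  by rewrite (lpnorm_eq0 p0 x0) !lpnorm0 ?gt_eqF.
have xp : 0 < lpnorm p x by rewrite lt_def x0 lpnorm_ge0.
rewrite -[leRHS]powRr1 ?lpnorm_ge0// -(mulfV (lt0r_neq0 r0)) powRrM.
rewrite [leLHS]lpnormE.
apply: ge0_ler_powR; rewrite ?invr_ge0 ?(ltW r0)// ?nnegrE ?powR_ge0 ?sum_powR_ge0//.
rewrite -[leRHS]mul1r -ler_pdivrMr ?powR_gt0// mulr_suml.
have -> : 1 = \sum_i (`|x 0 i| / lpnorm p x) `^ p :> R.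
  by rewrite sum_powR_normalized ?gt_eqF.
apply: ler_sum => i _.
have -> : (lpnorm p x `^ r)^-1 = (lpnorm p x)^-1 `^ r.
  by rewrite -powRN -powR_inv1 ?lpnorm_ge0// -powRrM mulN1r.
rewrite -powRM ?invr_ge0 ?lpnorm_ge0//.
have [->|xi0] := eqVneq (x 0 i) 0.
  by rewrite normr0 mul0r !powR0 ?gt_eqF.
apply: ger_powR => //.
by rewrite divr_gt0 ?normr_gt0//= ler_pdivrMr// mul1r le_coord_lpnorm.
Qed.

Lemma ler_lpnormD p x y : 1 < p -> lpnorm p (x + y) <= lpnorm p x + lpnorm p y.
Proof.
move=> p1; have p0 : 0 < p by lra.
have [s0|s0] := eqVneq (lpnorm p (x + y)) 0.
  by rewrite s0 addr_ge0 ?lpnorm_ge0.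
have sp : 0 < lpnorm p (x + y) by rewrite lt_def s0 lpnorm_ge0.
pose q := p / (p - 1).
have q0 : 0 < q by rewrite divr_gt0// subr_gt0.
have pq : p^-1 + q^-1 = 1 by rewrite /q; field; rewrite !gt_eqF ?subr_gt0.
(* The dual test vector: pairing it with the absolute values of [x + y] gives the p-th power of the
   norm, while its q-norm is that norm to the power [p - 1], so Hoelder applied to each summand and
   one division finish. *)
pose w := \row_i (`|(x + y) 0 i| `^ (p - 1)) : 'rV[R]_d.
have wq : lpnorm q w = lpnorm p (x + y) `^ (p - 1).
  rewrite !lpnormE -powRrM; under eq_bigr => i _.
    rewrite mxE ger0_norm ?powR_ge0// -powRrM.
    have -> : (p - 1) * q = p by rewrite /q; field; rewrite gt_eqF ?subr_gt0.
    over.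
  by congr (_ `^ _); rewrite /q; field; rewrite !gt_eqF ?subr_gt0.
pose a (v : 'rV[R]_d) := \row_i `|v 0 i| : 'rV[R]_d.
have pa v : lpnorm p (a v) = lpnorm p v.
  by rewrite !lpnormE; under eq_bigr do rewrite mxE normr_id.
have H v : dotv (a v) w <= lpnorm p v * lpnorm p (x + y) `^ (p - 1).
  by rewrite -wq -(pa v); apply: le_trans (hoelder_dotv _ _ p0 q0 pq); exact: ler_norm.
rewrite -(@ler_pM2r _ (lpnorm p (x + y) `^ (p - 1))) ?powR_gt0//.
rewrite mulr_powRB1 ?lpnorm_ge0// mulrDl.
apply: le_trans (lerD (H x) (H y)).
rewrite powR_lpnorm ?gt_eqF// -dotvDl; apply: ler_sum => i _.
rewrite -mulr_powRB1// !mxE ler_wpM2r ?powR_ge0//; exact: ler_normD.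
Qed.

Lemma ler_lpnormB p x y : 1 < p -> lpnorm p (x - y) <= lpnorm p x + lpnorm p y.
Proof.
by move=> p1; rewrite -(@lpnormN p y) ?gt_eqF ?ler_lpnormD//; lra.
Qed.

Lemma ler_lpnorm_sum p (I : Type) (s : seq I) (F : I -> 'rV[R]_d) : 1 < p ->
  lpnorm p (\sum_(i <- s) F i) <= \sum_(i <- s) lpnorm p (F i).
Proof.
move=> p1; elim/big_ind2 : _ => //.
- by rewrite lpnorm0// gt_eqF//; lra.
- by move=> a b e f ab ef; apply: le_trans (ler_lpnormD _ _ p1) _; rewrite lerD.
Qed.

End pnorm_theory.

(** * Smoothness of the squared p-norm *)

Section one_variable.
Context {R : realType}.
Implicit Types (f g : R -> R) (t L df dg : R).

Lemma is_derive_affine (a b t : R) : is_derive t 1 (fun s => a + s * b) b.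
Proof.
have -> : (fun s => a + s * b) = cst a \+ b \*: id.
  by apply/funext => s /=; rewrite mulrC.
by apply: is_derive_eq; rewrite add0r /GRing.scale/= mulr1.
Qed.

Lemma is_deriveM_fun f g df dg t : is_derive t 1 f df -> is_derive t 1 g dg ->
  is_derive t 1 (fun s => f s * g s) (f t * dg + g t * df).
Proof. by move=> ff gg; exact: is_deriveM. Qed.

Lemma is_derive_sum_fun n (f : 'I_n -> R -> R) (df : 'I_n -> R) t :
  (forall i, is_derive t 1 (f i) (df i)) ->
  is_derive t 1 (fun s => \sum_i f i s) (\sum_i df i).
Proof.
move=> fdf; have -> : (fun s => \sum_i f i s) = \sum_i f i.
  by apply/funext => s; rewrite fct_sumE.
exact: is_derive_sum.
Qed.

Lemma taylor_upper (f df : R -> R) L :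
  (forall t, 0 <= t <= 1 -> is_derive t 1 f (df t)) ->
  (forall t, 0 <= t <= 1 -> df t - df 0 <= L * t) ->
  f 1 <= f 0 + df 0 + L / 2.
Proof.
move=> fdf dfL.
(* Subtracting the claimed quadratic upper bound leaves a function with nonpositive derivative on
   [0, 1]. *)
pose g s := f s + (0 + s * - df 0) + (- (L / 2) * (s * s)).
have gdg t : 0 <= t <= 1 -> is_derive t 1 g (df t - df 0 - L * t).
  move=> t01; have ft := fdf t t01; rewrite /g.
  apply: (@is_derive_eq _ _ _ _ _ _ _ (df t + - df 0 + - (L / 2) * (t + t))); last first.
    by field.
  apply: is_deriveD; first by apply: is_deriveD => //; exact: is_derive_affine.
  have := @is_deriveM_fun id id 1 1 t (is_derive_id _ _) (is_derive_id _ _).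
  by rewrite !mulr1 => /(@is_deriveZ _ _ _ _ (- (L / 2))).
have [|||c /andP[c0 c1]] := @MVT_segment R g (fun t => df t - df 0 - L * t) 0 1.
- exact: ler01.
- by move=> t; rewrite in_itv/= => /andP[t0 t1]; apply: gdg; rewrite !ltW.
- apply: derivable_within_continuous => t; rewrite in_itv/= => t01.
  by have [] := gdg t t01.
- rewrite !bnd_simp in c0 c1.
  have := dfL c; rewrite c0 c1 => /(_ isT) Hc.
  rewrite /g subr0 mulr1; move: Hc; set fc := df c; lra.
Qed.
End one_variable.

Section abs_power.
Context {R : realType}.
Implicit Types (p e s t : R).

(** Trades the nonsmooth absolute value for a smooth square, so that the chain rule applies away
    from 0. *)
Lemma powR_norm_sqr e s : `|s| `^ e = (s * s) `^ (e / 2).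
Proof.
rewrite (mulrC e) powRrM; congr (_ `^ e).
by rewrite -expr2 -real_normK ?num_real// powR12_sqrt ?sqr_ge0// sqrtr_sqr normr_id.
Qed.

Lemma is_derive_powR_norm_neq0 e s : s != 0 ->
  is_derive s 1 (fun t => `|t| `^ e) (e * (s * `|s| `^ (e - 2))).
Proof.
move=> s0.
have -> : (fun t => `|t| `^ e) = (powR (R:=R))^~ (e / 2) \o (fun t => t * t).
  by apply/funext => t; rewrite /= powR_norm_sqr.
have ss : 0 < s * s by rewrite -expr2 exprn_even_gt0.
apply: (@is_derive_eq _ _ _ _ _ _ _ ((e / 2 * (s * s) `^ (e / 2 - 1)) * (s + s))).
  apply: is_derive1_comp; first exact: is_derive1_powR.
  by have := @is_deriveM_fun R id id 1 1 s (is_derive_id _ _) (is_derive_id _ _); rewrite !mulr1.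
rewrite powR_norm_sqr; have -> : (e - 2) / 2 = e / 2 - 1 by field.
by field.
Qed.

Lemma continuous_powR_norm0 e : 0 < e -> {for 0, continuous (fun t : R => `|t| `^ e)}.
Proof.
move=> e0.
suff H : `|t| `^ e @[t --> (0 : R)] --> `|0 : R| `^ e by exact: H.
rewrite normr0 powR0 ?gt_eqF//; apply/cvgrPdist_lt => eps eps0.
exists (eps `^ e^-1); first by rewrite /= powR_gt0.
move=> t /=; rewrite sub0r normrN => te.
rewrite sub0r normrN ger0_norm ?powR_ge0//.
rewrite -[ltRHS]powRr1 ?(ltW eps0)// -(mulVf (lt0r_neq0 e0)) powRrM.
by rewrite gt0_ltr_powR ?nnegrE ?powR_ge0.
Qed.

Lemma is_derive_powR_norm p s : 2 < p ->
  is_derive s 1 (fun t => `|t| `^ p) (p * (s * `|s| `^ (p - 2))).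
Proof.
move=> p2; have [->|] := eqVneq s 0; last exact: is_derive_powR_norm_neq0.
rewrite mul0r mulr0; apply/is_derive1_caratheodory.
(* At 0 the difference quotient is this function itself, continuous there because [p > 2]. *)
exists (fun t => t * `|t| `^ (p - 2)); split.
- move=> t; rewrite normr0 powR0 ?gt_eqF ?subr0//; last lra.
  rewrite mulrAC -expr2 -real_normK ?num_real// -powR_mulrn//.
  have [->|t0] := eqVneq t 0.
    by rewrite normr0 !powR0 ?mul0r// gt_eqF//; lra.
  by rewrite -powRD ?t0 ?implybT// ?normr_eq0 ?t0 ?implybT//; congr (_ `^ _); lra.
- apply: continuousM; first exact: cvg_id.
  by apply: continuous_powR_norm0; rewrite subr_gt0.
- by rewrite mul0r.
Qed.

Lemma is_derive_powR_norm2 p s : 2 < p ->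
  is_derive s 1 (fun t => t * `|t| `^ (p - 2)) ((p - 1) * `|s| `^ (p - 2)).
Proof.
move=> p2; have p20 : 0 < p - 2 by rewrite subr_gt0.
have [->|s0] := eqVneq s 0.
  rewrite normr0 powR0 ?gt_eqF// mulr0; apply/is_derive1_caratheodory.
  exists (fun t => `|t| `^ (p - 2)); split.
  - by move=> t; rewrite mul0r !subr0 mulrC.
  - exact: continuous_powR_norm0.
  - by rewrite normr0 powR0 ?gt_eqF.
apply: is_derive_eq.
  apply: (@is_deriveM_fun R id (fun t => `|t| `^ (p - 2)) 1 _ s (is_derive_id _ _)).
  exact: is_derive_powR_norm_neq0.
have -> : `|s| `^ (p - 2) = s * s * `|s| `^ (p - 2 - 2).
  rewrite -expr2 -real_normK ?num_real// -powR_mulrn// -powRD ?normr_eq0 ?s0 ?implybT//.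
  by congr (_ `^ _); lra.
by ring.
Qed.
End abs_power.

Section uniform_smoothness.
Context {R : realType} {d : nat} (p : R).
Implicit Types a z x : 'rV[R]_d.

Lemma powR2_lpnorm x : 0 < p -> (\sum_i `|x 0 i| `^ p) `^ (2 / p) = lpnorm p x ^+ 2.
Proof.
by move=> p0; rewrite mulrC powRrM -lpnormE powR_mulrn ?lpnorm_ge0.
Qed.

(* Hoelder with exponents p / (p - 2) and p / 2. *)
Lemma sum_weighted_sqr_le x z : 2 < p ->
  \sum_i `|x 0 i| `^ (p - 2) * z 0 i ^+ 2 <=
  (\sum_i `|x 0 i| `^ p) `^ (1 - 2 / p) * lpnorm p z ^+ 2.
Proof.
move=> p2; have p0 : 0 < p by lra.
pose x' := \row_i (`|x 0 i| `^ (p - 2)) : 'rV[R]_d.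
pose z' := \row_i (z 0 i ^+ 2) : 'rV[R]_d.
have -> : \sum_i `|x 0 i| `^ (p - 2) * z 0 i ^+ 2 = dotv x' z'.
  by apply: eq_bigr => i _; rewrite !mxE.
have := @hoelder_dotv R d (p / (p - 2)) (p / 2) x' z'.
rewrite !divr_gt0 ?subr_gt0// => /(_ isT isT) H.
apply: le_trans (ler_norm _) _.
apply: le_trans (H _) _; first by field; rewrite !gt_eqF ?subr_gt0.
apply: ler_pM; rewrite ?lpnorm_ge0//.
  rewrite lpnormE (_ : (p / (p - 2))^-1 = 1 - 2 / p); last first.
    by field; rewrite !gt_eqF ?subr_gt0.
  rewrite (eq_bigr (fun i => `|x 0 i| `^ p))// => i _.
  rewrite mxE ger0_norm ?powR_ge0// -powRrM; congr (_ `^ _).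
  by field; rewrite gt_eqF ?subr_gt0.
rewrite lpnormE -(powR2_lpnorm z p0) invf_div.
rewrite (eq_bigr (fun i => `|z 0 i| `^ p))// => i _.
rewrite mxE normrX -powR_mulrn// -powRrM; congr (_ `^ _).
by field.
Qed.

(* Second-order Taylor expansion of [t |-> lpnorm p (a + t *: z) ^+ 2], whose second
   derivative is at most [2 * (p - 1) * lpnorm p z ^+ 2]; the case where the line meets
   the origin is direct. *)
Lemma lpnorm_smooth a : 2 <= p -> exists l : 'rV[R]_d, forall z,
  lpnorm p (a + z) ^+ 2 <= lpnorm p a ^+ 2 + dotv l z + (p - 1) * lpnorm p z ^+ 2.
Proof.
rewrite le_eqVlt => /predU1P[<-|p2].
  exists (2 *: a) => z; rewrite !lpnorm2_sqr dotvDl !dotvDr dotvZl (dotvC z a); lra.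
have p0 : 0 < p by lra.
have [a0|a0] := eqVneq (lpnorm p a) 0.
  exists 0 => z; rewrite (lpnorm_eq0 p0 a0) add0r dotv0l lpnorm0 ?gt_eqF// expr0n/= !add0r.
  by rewrite ler_peMl ?sqr_ge0//; lra.
pose H (x : 'rV[R]_d) := \sum_i `|x 0 i| `^ p.
pose w := \row_i (a 0 i * `|a 0 i| `^ (p - 2)) : 'rV[R]_d.
pose l := (2 * H a `^ (2 / p - 1)) *: w.
exists l => z.
have Hge0 x : 0 <= H x by exact: sum_powR_ge0.
have Ha0 : H a != 0.
  by apply: contra_neq a0 => Ha0; rewrite lpnormE -/(H a) Ha0 powR0// invr_neq0// gt_eqF.
have dotw : dotv w a = H a.
  apply: eq_bigr => i _; rewrite mxE mulrAC -expr2 -real_normK ?num_real//.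
  rewrite -powR_mulrn//; have [->|t0] := eqVneq (a 0 i) 0.
    by rewrite normr0 !powR0 ?mul0r// gt_eqF//; lra.
  by rewrite -powRD ?normr_eq0 ?t0 ?implybT//; congr (_ `^ _); lra.
have Hpos : 0 < H a by rewrite lt_def Ha0 Hge0.
(* For [z = s *: a] the claim is [(1 + s)^2 <= 1 + 2 s + (p - 1) s^2]. Otherwise the line never
   meets the origin, so the outer power [2 / p] is applied to positive numbers only and can be
   differentiated twice. *)
have [[s az]|az] := pselect (exists s, z = s *: a).
  rewrite az -{1}(scale1r a) -scalerDl !lpnormZ ?gt_eqF// dotvZr dotvZl dotw.
  rewrite -mulrA -{2}(powRr1 (Hge0 a)) -powRD ?Ha0 ?implybT// subrK powR2_lpnorm//.
  rewrite !exprMn !real_normK ?num_real//.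
  have := sqr_ge0 s; have := sqr_ge0 (lpnorm p a); set n := _ ^+ 2; set m := s ^+ 2.
  move=> n0 m0; have mn := mulr_ge0 m0 n0.
  rewrite (_ : (1 + s) ^+ 2 = 1 + 2 * s + m) ?/m; last by ring.
  have : 0 <= (p - 2) * (m * n) by rewrite mulr_ge0// subr_ge0 ltW.
  rewrite -/m; lra.
have Hz t : 0 < H (a + t *: z).
  rewrite lt_def Hge0 andbT; apply/eqP => H0; apply: az.
  have /eqP : a + t *: z = 0.
    by apply: (lpnorm_eq0 p0); rewrite lpnormE -/(H _) H0 powR0// invr_neq0// gt_eqF.
  have [->|t0] := eqVneq t 0.
    by rewrite scale0r addr0 => /eqP az0; move: a0; rewrite az0 lpnorm0 ?eqxx// gt_eqF.
  rewrite addr_eq0 => /eqP az0; exists (- t^-1).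
  by rewrite az0 scalerN scaleNr opprK scalerA mulVf// scale1r.
pose c t i := a 0 i + t * z 0 i.
have cE t i : (a + t *: z) 0 i = c t i by rewrite !mxE.
pose h t := H (a + t *: z).
have hE t : h t = \sum_i `|c t i| `^ p by apply: eq_bigr => i _; rewrite cE.
pose h1 t := \sum_i (p * z 0 i * (c t i * `|c t i| `^ (p - 2))).
pose h2 t := \sum_i (p * z 0 i * ((p - 1) * `|c t i| `^ (p - 2) * z 0 i)).
have dc (t : R) i : is_derive t 1 (c^~ i) (z 0 i) by exact: is_derive_affine.
have dh (t : R) : is_derive t 1 h (h1 t).
  have -> : h = (fun s => \sum_i `|c s i| `^ p) by apply/funext => s; exact: hE.
  apply: is_derive_sum_fun => i.
  have := @is_derive1_comp R (fun s => `|s| `^ p) (c^~ i) t _ _ (is_derive_powR_norm _ p2) (dc t i).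
  by move=> /is_derive_eq; apply; ring.
have dh1 (t : R) : is_derive t 1 h1 (h2 t).
  apply: is_derive_sum_fun => i.
  have := @is_derive1_comp R (fun s => s * `|s| `^ (p - 2)) (c^~ i) t _ _
    (is_derive_powR_norm2 _ p2) (dc t i).
  by move=> /(@is_deriveZ _ _ _ _ (p * z 0 i)).
pose f t := h t `^ (2 / p).
pose f1 t := 2 / p * h t `^ (2 / p - 1) * h1 t.
pose f2 t := 2 / p * h t `^ (2 / p - 1) * h2 t
  + h1 t * (2 / p * ((2 / p - 1) * h t `^ (2 / p - 1 - 1) * h1 t)).
have df (t : R) : is_derive t 1 f (f1 t).
  exact: (is_derive1_comp (is_derive1_powR _ (Hz t)) (dh t)).
have df1 (t : R) : is_derive t 1 f1 (f2 t).
  apply: is_deriveM_fun => //.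
  have /(@is_deriveZ _ _ _ _ (2 / p)) := is_derive1_comp (is_derive1_powR (2 / p - 1) (Hz t)) (dh t).
  by [].
have f2_le t : f2 t <= 2 * (p - 1) * lpnorm p z ^+ 2.
  have p2' : 2 / p <= 1 by rewrite ler_pdivrMr// mul1r ltW.
  (* The discarded term is a nonnegative multiple of [h1 t ^+ 2] times [2 / p - 1 <= 0]; what
     remains is bounded by the weighted Hoelder inequality, and the powers of [h t] cancel
     exactly. *)
  apply: (@le_trans _ _ (2 / p * h t `^ (2 / p - 1) * h2 t)).
    rewrite /f2 gerDl.
    rewrite [X in X <= 0](_ : _ = (2 / p - 1) * (2 / p * h t `^ (2 / p - 1 - 1) * h1 t ^+ 2)); last by ring.
    apply: mulr_le0_ge0; first by rewrite subr_le0.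
    by rewrite mulr_ge0 ?sqr_ge0 ?mulr_ge0 ?powR_ge0 ?invr_ge0 ?(ltW p0).
  have -> : h2 t = p * (p - 1) * \sum_i `|(a + t *: z) 0 i| `^ (p - 2) * z 0 i ^+ 2.
    by rewrite mulr_sumr; apply: eq_bigr => i _; rewrite cE; ring.
  have := sum_weighted_sqr_le (a + t *: z) z p2; rewrite -/(H _) -/(h t).
  set S := \sum_i _ => HS.
  have ht0 : h t != 0 by apply: lt0r_neq0; exact: Hz.
  have pp : 0 <= 2 * (p - 1) by lra.
  have -> : 2 / p * h t `^ (2 / p - 1) * (p * (p - 1) * S) =
      2 * (p - 1) * (h t `^ (2 / p - 1) * S) by field; rewrite gt_eqF.
  apply: ler_wpM2l => //.
  apply: le_trans (ler_wpM2l (powR_ge0 _ _) HS) _.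
  rewrite mulrA -powRD ?ht0 ?implybT// (_ : _ + _ = 0); last by ring.
  by rewrite powRr0 mul1r.
have := @taylor_upper R f f1 (2 * (p - 1) * lpnorm p z ^+ 2) (fun t _ => df t).
have -> : f 1 = lpnorm p (a + z) ^+ 2 by rewrite /f /h scale1r powR2_lpnorm.
have -> : f 0 = lpnorm p a ^+ 2 by rewrite /f /h scale0r addr0 powR2_lpnorm.
have <- : f1 0 = dotv l z.
  have h10 : h1 0 = p * dotv w z.
    rewrite mulr_sumr; apply: eq_bigr => i _; rewrite !mxE /c mul0r addr0.
    by rewrite -mulrA [z 0 i * _]mulrC.
  rewrite /f1 h10 /h scale0r addr0 dotvZl; field.
  by rewrite gt_eqF.
rewrite (_ : _ * _ / 2 = (p - 1) * lpnorm p z ^+ 2); last by field.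
apply => t /andP[t0 t1].
have [|s _ ->] := @MVT_segment R f1 f2 0 t t0 (fun s _ => df1 s).
  by apply: derivable_within_continuous => s _; have [] := df1 s.
by rewrite subr0; apply: ler_wpM2r.
Qed.
End uniform_smoothness.

(** * Measurability, independence and integration *)

Section integration.
Context {dT} {T : measurableType dT} {R : realType}.
Variable mu : {measure set T -> \bar R}.
Local Open Scope ereal_scope.
Import HBNNSimple.

(* The integral of a nonnegative function is a supremum over simple functions,
   so no measurability is needed here. *)
Lemma ge0_le_integral_off (N : set T) (f g : T -> \bar R) :
  measurable N -> mu N = 0 -> (forall x, 0 <= f x) -> (forall x, 0 <= g x) ->
  (forall x, ~ N x -> f x <= g x) -> \int[mu]_x f x <= \int[mu]_x g x.
Proof.
move=> mN N0 f0 g0 fg; rewrite [leLHS]ge0_integralTE// [leRHS]ge0_integralTE//.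
apply: ge_ereal_sup => _ [h hf <-].
have mC : measurable (~` N) by exact: measurableC.
apply: le_trans (ereal_sup_ubound _); last first.
  (* A simple function below [f], cut to zero on [N], lies below [g] everywhere and keeps its
     integral. *)
  exists (proj_nnsfun h mC) => //= x.
  rewrite mindicE; case: (pselect (N x)) => Nx.
    by rewrite memNset ?mulr0//= => /(_ Nx).
  by rewrite mem_set ?mulr1//; apply: le_trans (hf x) (fg _ Nx).
rewrite -!integralT_nnsfun; rewrite le_eqVlt; apply/orP; left; apply/eqP.
apply: ge0_ae_eq_integral => //.
- by apply/measurable_EFinP.
- by apply/measurable_EFinP.
- by move=> x _; rewrite lee_fin.
- by move=> x _; rewrite lee_fin.
exists N; split => // x /= /not_implyP[_ h1]; apply: contrapT => Nx; apply: h1.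
by rewrite mindicE mem_set ?mulr1.
Qed.

Lemma ge0_eq_integral_off (N : set T) (f g : T -> \bar R) :
  measurable N -> mu N = 0 -> (forall x, 0 <= f x) -> (forall x, 0 <= g x) ->
  (forall x, ~ N x -> f x = g x) -> \int[mu]_x f x = \int[mu]_x g x.
Proof.
move=> mN N0 f0 g0 fg; apply/eqP; rewrite eq_le; apply/andP; split.
  by apply: (ge0_le_integral_off mN) => // x /fg ->.
by apply: (ge0_le_integral_off mN) => // x /fg ->.
Qed.

Lemma eq_integral_off (N : set T) (f g : T -> \bar R) :
  measurable N -> mu N = 0 ->
  (forall x, ~ N x -> f x = g x) -> \int[mu]_x f x = \int[mu]_x g x.
Proof.
move=> mN N0 fg; rewrite [LHS]integralE [RHS]integralE.
by congr (_ - _); apply: (ge0_eq_integral_off mN) => // x /fg fgx;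
  rewrite ?funeposE ?funenegE fgx.
Qed.

End integration.

(** The law of the pair agrees with a product measure on rectangles, hence everywhere, and Tonelli
    applies. With [H] the identity from [W] to [W] carrying a coarser sigma-algebra, this does the
    work of conditioning on that sigma-algebra. *)
Lemma indep_integral {d d1 d2} {W : measurableType d} {T1 : measurableType d1}
    {T2 : measurableType d2} {R : realType} (P : probability W R)
    (m2 : probability T2 R) (H : W -> T1) (Z : W -> T2) (phi : T1 * T2 -> \bar R) :
  measurable_fun setT H -> measurable_fun setT Z ->
  (forall A B, measurable A -> measurable B ->
    P (H @^-1` A `&` Z @^-1` B) = (P (H @^-1` A) * m2 B)%E) ->
  measurable_fun setT phi -> (forall t, 0 <= phi t)%E ->
  (\int[P]_w phi (H w, Z w) = \int[P]_w \int[m2]_t phi (H w, t))%E.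
Proof.
move=> mH mZ indep mphi phi0.
have mJ : measurable_fun setT (fun w => (H w, Z w)) by exact: measurable_fun_pair.
pose H' : {RV P >-> T1} := mfun_Sub (mem_set mH).
pose J : {RV P >-> (T1 * T2)%type} := mfun_Sub (mem_set mJ).
have -> : (\int[P]_w phi (H w, Z w) = \int[distribution P J]_t phi t)%E.
  by rewrite ge0_integral_distribution.
have -> : (\int[distribution P J]_t phi t = \int[distribution P H' \x m2]_t phi t)%E.
  apply: eq_measure_integral => A mA _.
  apply/esym; apply: (@product_measure_unique _ _ _ _ _ (distribution P H') m2) => //.
rewrite fubini_tonelli1//.
rewrite -(@ge0_integral_distribution _ _ _ _ _ P H' (fubini_F m2 phi))//.
  exact: measurable_fun_fubini_tonelli_F.
by move=> x; apply: integral_ge0.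
Qed.

Section borel_vectors.
Context {R : realType} {n : nat}.

Lemma continuous_measurable_borelRV (f : 'rV[R]_n -> R) :
  continuous f -> measurable_fun [set: borelRV R n] f.
Proof.
move=> /continuousP cf; apply: (measurability _ (RGenOpens.measurableE R)).
move=> _ [_ [a [b ->] <-]]; rewrite setTI; apply: sub_sigma_algebra.
by apply: cf; exact: interval_open.
Qed.

Lemma measurable_coord (i : 'I_n) : measurable_fun [set: borelRV R n] (fun x => x 0 i).
Proof. by apply: continuous_measurable_borelRV => x; exact: coord_continuous. Qed.

(** A countable base of the topology. The index type is countable, so unions over it are enumerated
    through [unpickle], with the empty set for numbers that code nothing. *)
Definition rational_box (q : 'rV[rat]_n * nat) : set 'rV[R]_n :=
  [set y | forall i, `|y 0 i - ratr (q.1 0 i)| < q.2.+1%:R^-1].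

Lemma measurable_rational_box d (T : measurableType d) (f : T -> 'rV[R]_n) q :
  (forall i, measurable_fun setT (fun t => f t 0 i)) ->
  measurable (f @^-1` rational_box q).
Proof.
move=> mf; have -> : f @^-1` rational_box q = \bigcap_(i in [set: 'I_n])
    ((fun t => f t 0 i) @^-1` (ball (ratr (q.1 0 i) : R) q.2.+1%:R^-1)).
  apply/seteqP; split => t /= tq i; first by move=> _; rewrite /ball/= distrC; exact: tq.
  by have := tq i I; rewrite /ball/= distrC.
apply: fin_bigcap_measurable => // i _; rewrite -[X in measurable X]setTI.
by apply: mf => //; exact: measurable_ball.
Qed.

Lemma open_rational_box (U : set 'rV[R]_n) x : open U -> U x ->
  exists q, rational_box q x /\ rational_box q `<=` U.
Proof.
move=> oU Ux.
have /nbhs_ballP[e /= e0 xeU] : nbhs x U by exact: open_nbhs_nbhs.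
have e2 : 0 < e / 2 by rewrite divr_gt0.
pose N := Num.trunc (e / 2)^-1.
have Ne : N.+1%:R^-1 < e / 2.
  by rewrite invf_plt ?posrE// /N truncnS_gt.
have /choice[q qx] : forall i, exists r : rat, `|x 0 i - ratr r| < N.+1%:R^-1.
  move=> i; have : x 0 i - N.+1%:R^-1 < x 0 i + N.+1%:R^-1.
    by rewrite ltrD2l gtrN.
  move=> /rat_in_itvoo[r]; rewrite in_itv/= => /andP[r1 r2]; exists r.
  by rewrite ltr_distlC r1 r2.
exists (\row_i q i, N); split; first by move=> i /=; rewrite mxE.
move=> y /= yq; apply: xeU; split => // i j; rewrite (ord1 i).
have := qx j; have := yq j; rewrite mxE /ball/= => yqj xqj.
rewrite (splitr e); apply: le_lt_trans (ler_distD (ratr (q j)) _ _) _.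
by apply: ltrD; [exact: lt_trans xqj Ne|rewrite distrC; exact: lt_trans yqj Ne].
Qed.

Lemma measurable_rV d (T : measurableType d) (f : T -> 'rV[R]_n) :
  (forall i, measurable_fun setT (fun t => f t 0 i)) ->
  measurable_fun setT (f : T -> borelRV R n).
Proof.
move=> mf; apply: (@measurability _ _ _ (borelRV R n) setT f (@open 'rV[R]_n)) => // _ [U oU <-].
rewrite setTI.
have -> : f @^-1` U = \bigcup_k (if choice.unpickle k is Some q then
    if `[< rational_box q `<=` U >] then f @^-1` rational_box q else set0 else set0).
  apply/seteqP; split => [t Ut|t [k _]]; last first.
    by case: (choice.unpickle k) => //= q; case: ifPn => // /asboolP qU /qU.
  have [q [qt qU]] := open_rational_box oU Ut.
  by exists (choice.pickle q) => //; rewrite choice.pickleK ifT//; exact/asboolP.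
apply: bigcupT_measurable => k; case: (choice.unpickle k) => [q|] //.
by case: ifPn => // _; exact: measurable_rational_box.
Qed.

Lemma measurable_rVP d (T : measurableType d) (f : T -> 'rV[R]_n) (i : 'I_n) :
  measurable_fun setT (f : T -> borelRV R n) -> measurable_fun setT (fun t => f t 0 i).
Proof. by move=> mf; apply: (measurableT_comp (measurable_coord i) mf). Qed.

(** A point outside the support lies in a null rational box, and there are countably many of these.
    The smoothness assumptions hold only along directions in the support, so this is what lets them
    be integrated over all directions. *)
Lemma msupport_full (P : probability (borelRV R n) R) :
  exists2 N : set (borelRV R n), measurable N /\ P N = 0%E &
    forall u, ~ N u -> msupport P u.
Proof.
pose B k : set (borelRV R n) := if choice.unpickle k is Some q then
  if P (rational_box q) == 0%E then rational_box q else set0 else set0.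
have mB k : measurable (B k).
  rewrite /B; case: choice.unpickle => // q; case: ifPn => // _.
  exact: (@measurable_rational_box _ (borelRV R n) id q measurable_coord).
exists (\bigcup_k B k).
  split; first exact: bigcupT_measurable.
  apply/negligibleP; first exact: bigcupT_measurable.
  apply: negligible_bigcup => k; apply/negligibleP => //.
  by rewrite /B; case: choice.unpickle => // q; case: ifPn => // /eqP.
move=> u Nu U oU Uu; rewrite lt0e measure_ge0 andbT; apply/eqP => PU0; apply: Nu.
have [q [qu qU]] := open_rational_box oU Uu.
exists (choice.pickle q) => //; rewrite /B choice.pickleK ifT//.
rewrite eq_le measure_ge0 andbT -PU0; apply: le_measure; rewrite ?inE//.
  exact: (@measurable_rational_box _ (borelRV R n) id q measurable_coord).
exact: sub_sigma_algebra.
Qed.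

End borel_vectors.

Section caratheodory.
Context {R : realType} {n : nat} {d} {T : measurableType d}.
Variable F : 'rV[R]_n -> T -> R.

Let grid (k : nat) (y : 'rV[R]_n) : 'rV[R]_n :=
  \row_i ((Num.floor (y 0 i * k.+1%:R))%:~R / k.+1%:R).

Let grid_close k (y : 'rV[R]_n) i : `|y 0 i - grid k y 0 i| <= k.+1%:R^-1.
Proof.
rewrite mxE; set a := y 0 i.
have k0 : (0 : R) < k.+1%:R by [].
have := floor_itv (a * k.+1%:R) => /andP[].
set N := (Num.floor _)%:~R => f1 f2.
have {}f2 : a * k.+1%:R < N + 1 by move: f2; rewrite intrD.
have -> : a - N / k.+1%:R = (a * k.+1%:R - N) / k.+1%:R by field; rewrite ?gt_eqF.
rewrite normrM ger0_norm ?subr_ge0// gtr0_norm ?invr_gt0// ler_piMl ?invr_ge0 ?ltW//.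
by rewrite ltrBlDl.
Qed.

(** Rounding the vector down to a grid of mesh 1/(k+1) leaves countably many sections, each
    measurable in the sample; continuity in the vector makes these roundings converge pointwise to
    [F]. *)
Lemma measurable_caratheodory :
  (forall x, measurable_fun setT (F x)) -> (forall z, continuous (F^~ z)) ->
  measurable_fun [set: borelRV R n * T] (fun a => F a.1 a.2).
Proof.
move=> mF cF.
apply: (@measurable_fun_cvg _ _ _ setT (fun k (a : borelRV R n * T) => F (grid k a.1) a.2)); last first.
  move=> [y z] _ /=; apply: (@cvg_comp _ _ _ (fun k => grid k y) (F^~ z) _ (nbhs y)); last exact: cF.
  apply/cvg_ballP => e e0; near=> k; split => // i j; rewrite (ord1 i) /ball/=.
  apply: le_lt_trans (grid_close k y j) _.
  by near: k; exact: near_infty_natSinv_lt (PosNum e0).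
move=> k _ B mB; rewrite setTI.
pose cell (N : 'rV[int]_n) : set (borelRV R n) :=
  \bigcap_(i in [set: 'I_n]) ((fun y => y 0 i) @^-1`
    `[(N 0 i)%:~R / k.+1%:R, ((N 0 i)%:~R + 1) / k.+1%:R[%classic).
have k0 : (0 : R) < k.+1%:R by [].
have cellP N y : cell N y -> grid k y = \row_i ((N 0 i)%:~R / k.+1%:R).
  move=> cy; apply/rowP => i; rewrite !mxE; congr (_%:~R / _).
  have := cy i I; rewrite /= in_itv/= ler_pdivrMr// ltr_pdivlMr// => yN.
  by apply: floor_def; rewrite intrD.
have -> : (fun a : borelRV R n * T => F (grid k a.1) a.2) @^-1` B =
    \bigcup_j (if choice.unpickle j is Some N then
      cell N `*` (F (\row_i ((N 0 i)%:~R / k.+1%:R)) @^-1` B) else set0).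
  apply/seteqP; split => [[y z] /= Byz|[y z] [j _]]; last first.
    by case: choice.unpickle => //= N [/= /cellP ->].
  pose N := \row_i Num.floor (y 0 i * k.+1%:R) : 'rV[int]_n.
  have cy : cell N y.
    move=> i _; rewrite /= in_itv/= mxE ler_pdivrMr// ltr_pdivlMr//.
    by have := floor_itv (y 0 i * k.+1%:R); rewrite intrD.
  by exists (choice.pickle N) => //; rewrite choice.pickleK/=; split => //=; rewrite -(cellP _ _ cy).
apply: bigcupT_measurable => j; case: choice.unpickle => [N|]; last exact: measurable0.
apply: measurableX.
  apply: fin_bigcap_measurable => // i _; rewrite -[X in measurable X]setTI.
  by apply: measurable_coord => //; exact: measurable_itv.
by rewrite -[X in measurable X]setTI; exact: mF.
Unshelve. all: by end_near. Qed.

End caratheodory.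

Section independence.
Context {d} {W : measurableType d} {R : realType} (P : probability W R).

(** Both sides are finite measures in [A], namely [P] restricted to [C] and [P] scaled by [P C];
    they agree on a pi-system containing the whole space. *)
Lemma indep_sigma_extend (C : set W) (G : set (set W)) :
  measurable C -> G `<=` measurable -> G setT -> setI_closed G ->
  (forall A, G A -> P (C `&` A) = (P C * P A)%E) ->
  forall A, <<s G >> A -> P (C `&` A) = (P C * P A)%E.
Proof.
move=> mC Gm GT GI CG A GA.
have PC : P C \is a fin_num by exact: fin_num_measure.
have PC0 : 0 <= fine (P C) by exact: fine_ge0.
have cover : \bigcup_(k in [set: nat]) (fun=> [set: W]) k = [set: W].
  by apply/seteqP; split => // w _; exists 0%N.
have mE B : mscale (NngNum PC0) P B = (P C * P B)%E by rewrite /mscale/= fineK.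
rewrite -mE setIC; apply: (@g_sigma_algebra_measure_unique _ R W G Gm (fun=> setT)
  (fun=> GT) cover (mrestr P mC) (mscale (NngNum PC0) P) GI) => //.
- by move=> B GB; apply: etrans (esym (mE B)); rewrite -[LHS]/(P (B `&` C)) setIC CG.
- by move=> _; rewrite -[X in (X < _)%E]/(P (setT `&` C)) setTI ltey_eq PC.
Qed.

Variables (I : choiceType) (D : set I) (G : I -> set (set W)).
Hypothesis indep : mutually_independent P D G.
Hypothesis Gm : forall i, G i `<=` measurable.
Hypothesis GT : forall i, G i setT.
Hypothesis GI : forall i, setI_closed (G i).

(** The pi-system generated by a block of sources. Events are chosen for all indices, also outside
    [J], so that two cylinders can be intersected index by index. *)
Let cylinder (D1 : set I) : set (set W) :=
  [set A | exists (J : {fset I}) (E : I -> set W),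
     [/\ [set` J] `<=` D1, forall i, G i (E i) & A = \bigcap_(i in [set` J]) E i]].

Let cylinder_measurable D1 : cylinder D1 `<=` measurable.
Proof.
move=> _ [J [E [_ GE ->]]]; apply: fin_bigcap_measurable => // i _.
exact: Gm (GE i).
Qed.

Let cylinderT D1 : cylinder D1 setT.
Proof.
exists fset0, (fun=> setT); split => //.
by apply/seteqP; split.
Qed.

Let cylinderI D1 : setI_closed (cylinder D1).
Proof.
move=> _ _ [J [E [JD GE ->]]] [J' [E' [JD' GE' ->]]].
exists (J `|` J')%fset, (fun i => (if i \in J then E i else setT)
                         `&` (if i \in J' then E' i else setT)); split.
- by move=> i /=; rewrite inE => /orP[/JD|/JD'].
- by move=> i; apply: GI; case: ifP.
- apply/seteqP; split => [w [JE JE'] i _|w H].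
    by split; case: ifPn => // iJ; [exact: JE|exact: JE'].
  split => i /= iJ.
    by have := H i; rewrite /= inE iJ => /(_ isT)[].
  by have := H i; rewrite /= inE iJ orbT => /(_ isT)[].
Qed.

Let sub_cylinder D1 : \bigcup_(i in D1) G i `<=` cylinder D1.
Proof.
move=> A [i Di GA]; exists [fset i]%fset, (fun j => if j == i then A else setT); split.
- by move=> j /=; rewrite inE => /eqP ->.
- by move=> j; case: eqVneq => // ->.
- apply/seteqP; split => [w Aw j /=|w /(_ i)/=]; first by rewrite inE => ->.
  by rewrite inE eqxx; apply.
Qed.

Let cylinder_indep D1 D2 A B : D1 `<=` D -> D2 `<=` D -> [disjoint D1 & D2] ->
  cylinder D1 A -> cylinder D2 B -> P (A `&` B) = (P A * P B)%E.
Proof.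
move=> sD1 sD2 /disj_setPS D12 [J [E [JD GE ->]]] [J' [E' [JD' GE' ->]]].
have J'J i : i \in J' -> i \in J = false.
  by move=> iJ'; apply/negP => iJ; apply: (D12 i); split; [exact: JD|exact: JD'].
pose E2 i := if i \in J then E i else E' i.
have -> : \bigcap_(i in [set` J]) E i `&` \bigcap_(i in [set` J']) E' i
    = \bigcap_(i in [set` (J `|` J')%fset]) E2 i.
  apply/seteqP; split => [w [JE JE'] i|w H].
    by rewrite /= inE /E2; case: ifPn => [/JE //|_ /= /JE'].
  split => i /= iJ; have := H i; rewrite /= inE /E2 iJ ?orbT => /(_ isT) //.
  by rewrite J'J.
rewrite !bigcap_fset !indep//; first last.
- by move=> i _; rewrite /E2; case: ifP.
- by move=> i /=; rewrite inE => /orP[/JD/sD1|/JD'/sD2].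
- by move=> i iJ /=; exact: sD1 (JD _ iJ).
- by move=> i iJ /=; exact: sD2 (JD' _ iJ).
rewrite (big_fsetID _ (mem J))/=.
have -> : [fset x in (J `|` J')%fset | x \in J]%fset = J.
  by apply/fsetP => i; rewrite !inE/= andbC; case: (i \in J).
have -> : [fset x in (J `|` J')%fset | x \notin J]%fset = J'.
  apply/fsetP => i; rewrite !inE/=; case: (boolP (i \in J')) => [/J'J -> //|].
  by rewrite orbF andbN.
congr (_ * _)%E; apply: eq_big_seq => i iJ; rewrite /E2 ?iJ//.
by rewrite J'J.
Qed.

(** The product rule holds on cylinders and is extended to the generated sigma-algebras one factor
    at a time. *)
Lemma indep_g_sigma_algebra (D1 D2 : set I) (A B : set W) :
  D1 `<=` D -> D2 `<=` D -> [disjoint D1 & D2] ->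
  <<s \bigcup_(i in D1) G i >> A -> <<s \bigcup_(i in D2) G i >> B ->
  P (A `&` B) = (P A * P B)%E.
Proof.
move=> sD1 sD2 D12 GA GB.
have sub D' C : <<s \bigcup_(i in D') G i >> C -> <<s cylinder D' >> C.
  by apply: sub_sigma_algebra2; exact: sub_cylinder.
have mA : measurable A.
  by apply: (smallest_sub _ _ GA) => [|C [i _]]; [exact: sigma_algebra_measurable|exact: Gm].
apply: (@indep_sigma_extend A (cylinder D2)) => //.
- move=> C cC; rewrite setIC muleC.
  apply: (@indep_sigma_extend C (cylinder D1)) => //; last exact: sub.
  + exact: cylinder_measurable cC.
  + by move=> C1 cC1; rewrite setIC muleC; apply: (cylinder_indep sD1 sD2).
- exact: sub.
Qed.

End independence.

(** * Calculus along segments and measurability of vector-valued maps *)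

Section line_calculus.
Context {R : realType} {d : nat}.
Implicit Types (f : 'rV[R]_d -> R) (x v : 'rV[R]_d).

Lemma derive_dotv f x v : differentiable f x -> 'D_v f x = dotv (gradient f x) v.
Proof.
move=> df; rewrite deriveE// {1}(row_sum_delta v) linear_sum.
by apply: eq_bigr => i _; rewrite linearZ/= mxE deriveE// mulrC.
Qed.

Lemma is_derive_line f x v (t : R) : differentiable f (x + t *: v) ->
  is_derive t 1 (fun s : R => f (x + s *: v)) (dotv (gradient f (x + t *: v)) v).
Proof.
move=> df.
have quotE : (fun h : R => h^-1 *: (((fun s : R => f (x + s *: v)) \o shift t) (h *: (1 : R)) -
     f (x + t *: v))) =
   (fun h : R => h^-1 *: ((f \o shift (x + t *: v)) (h *: v) - f (x + t *: v))).
  apply/funext => h /=; congr (_ *: (f _ - _)).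
  by rewrite scaler1 scalerDl addrCA.
have := @diff_derivable _ _ _ _ _ v df; rewrite /derivable -quotE => cvf.
have dE : 'D_1 (fun s : R => f (x + s *: v)) t = 'D_v f (x + t *: v).
  exact: (congr1 (fun g : R -> R => lim (g @ 0^')) quotE).
by rewrite -derive_dotv//; exact: DeriveDef.
Qed.

Lemma continuous_line x v : continuous (fun t : R => x + t *: v).
Proof.
move=> t; apply: (@cvgD _ _ _ _ _ (cst x) (fun t => t *: v)); first exact: cvg_cst.
exact: scalel_continuous.
Qed.

Lemma continuous_dotv_gradient f v : continuous (gradient f) ->
  continuous (fun x => dotv (gradient f x) v).
Proof.
move=> cf; apply: (continuous_big add_continuous) => i _ x.
have cgi : (fun y => gradient f y 0 i) y @[y --> x] --> gradient f x 0 i.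
  by apply: (@cvg_comp _ _ _ (gradient f) (fun y : 'rV[R]_d => y 0 i) _
    (nbhs (gradient f x))); [exact: cf|exact: coord_continuous].
exact: (@cvgZr_tmp _ _ _ _ _ (fun y => gradient f y 0 i) _ (v 0 i : R^o) cgi).
Qed.

End line_calculus.

Section square_increment.
Context {R : realType}.
Local Notation mu := (@lebesgue_measure R).

(** With [c = f 1 - f 0], the function [2 c df - c^2] integrates to [c^2] over [0, 1] and lies
    pointwise below [df^2] by completing the square. The right side may be infinite, which is
    harmless in the extended reals. *)
Lemma sqr_increment_le (f df : R -> R) :
  (forall t : R, is_derive t 1 f (df t)) -> continuous df ->
  (((f 1 - f 0) ^+ 2)%:E <= \int[mu]_(t in `[0%R, 1%R]) (df t ^+ 2)%:E)%E.
Proof.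
move=> fdf cdf; set c := f 1 - f 0.
pose g t := 2 * c * f t + (0 + t * - c ^+ 2).
pose dg t := 2 * c * df t + - c ^+ 2.
have gdg (t : R) : is_derive t 1 g (dg t).
  apply: is_deriveD; last exact: is_derive_affine.
have cdg : continuous dg.
  move=> t; apply: cvgD; last exact: cvg_cst.
  by apply: cvgM; [exact: cvg_cst|exact: cdf].
have cg : continuous g.
  by move=> t; apply: differentiable_continuous; apply/derivable1_diffP; have [] := gdg t.
have gint : (\int[mu]_(t in `[0%R, 1%R]) (dg t)%:E = (c ^+ 2)%:E)%E.
  rewrite (@continuous_FTC2 _ dg g)//.
  - by rewrite -EFinB /g -/c; congr EFin; rewrite /c; ring.
  - by apply: continuous_subspaceT.
  - split.
    + by move=> t _; have [] := gdg t.
    + by apply: cvg_at_right_filter; exact: cg.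
    + by apply: cvg_at_left_filter; exact: cg.
  - by move=> t _; rewrite derive1E; have [_ ->] := gdg t.
rewrite -gint; apply: le_integral => //.
- apply: continuous_compact_integrable; first exact: segment_compact.
  exact: continuous_subspaceT.
- apply: continuous_compact_integrable; first exact: segment_compact.
  apply: continuous_subspaceT => t.
  by apply: (@continuousM _ _ df df); exact: cdf.
- move=> t _; rewrite lee_fin /dg; have := sqr_ge0 (df t - c); nra.
Qed.

End square_increment.

Section vector_measurability.
Context {R : realType} {d} {T : measurableType d}.

Definition measurable_vec n (f : T -> 'rV[R]_n) :=
  forall i, measurable_fun setT (fun t => f t 0 i).

Context {n : nat}.
Implicit Types (f g : T -> 'rV[R]_n).

Lemma measurable_vecD f g : measurable_vec f -> measurable_vec g ->
  measurable_vec (fun t => f t + g t).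
Proof.
move=> mf mg i; rewrite [X in measurable_fun _ X](_ : _ = fun t => f t 0 i + g t 0 i).
  exact: measurable_funD.
by apply/funext => t; rewrite mxE.
Qed.

Lemma measurable_vecZ (a : T -> R) f : measurable_fun setT a -> measurable_vec f ->
  measurable_vec (fun t => a t *: f t).
Proof.
move=> ma mf i; rewrite [X in measurable_fun _ X](_ : _ = fun t => a t * f t 0 i).
  exact: measurable_funM.
by apply/funext => t; rewrite mxE.
Qed.

Lemma measurable_vecB f g : measurable_vec f -> measurable_vec g ->
  measurable_vec (fun t => f t - g t).
Proof.
move=> mf mg i; rewrite [X in measurable_fun _ X](_ : _ = fun t => f t 0 i - g t 0 i).
  exact: measurable_funB.
by apply/funext => t; rewrite !mxE.
Qed.

Lemma measurable_vec_cst (a : 'rV[R]_n) : measurable_vec (fun=> a).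
Proof. by move=> i; exact: measurable_cst. Qed.

Lemma measurable_vec_sum (I : Type) (s : seq I) (f : I -> T -> 'rV[R]_n) :
  (forall i, measurable_vec (f i)) -> measurable_vec (fun t => \sum_(i <- s) f i t).
Proof.
move=> mf i; rewrite [X in measurable_fun _ X](_ : _ = fun t => \sum_(j <- s) f j t 0 i).
  by apply: measurable_sum => j; exact: mf.
by apply/funext => t; rewrite summxE.
Qed.

Lemma measurable_dotv f g : measurable_vec f -> measurable_vec g ->
  measurable_fun setT (fun t => dotv (f t) (g t)).
Proof. by move=> mf mg; apply: measurable_sum => i; exact: measurable_funM. Qed.

Lemma measurable_lpnorm (p : R) f : measurable_vec f ->
  measurable_fun setT (fun t => lpnorm p (f t)).
Proof.
move=> mf; rewrite [X in measurable_fun _ X](_ : _ =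
    (@powR R)^~ p^-1 \o (fun t => \sum_i `|f t 0 i| `^ p)); last first.
  by apply/funext => t; rewrite lpnormE.
apply: measurableT_comp => //; apply: measurable_sum => i.
apply: (measurableT_comp (measurable_powR p)) => //.
by apply: measurableT_comp => //; exact: mf.
Qed.

Lemma measurable_lpnorm_sqr (p : R) f : measurable_vec f ->
  measurable_fun setT (fun t => (lpnorm p (f t) ^+ 2)%:E).
Proof.
by move=> mf; apply/measurable_EFinP/measurable_funX; exact: measurable_lpnorm.
Qed.

(** A partial derivative is the pointwise limit of difference quotients with steps 1/(k+1). *)
Lemma measurable_gradient (F : 'rV[R]_n -> T -> R) x :
  (forall y, measurable_fun setT (F y)) -> (forall t, differentiable (F^~ t) x) ->
  measurable_vec (fun t => gradient (F^~ t) x).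
Proof.
move=> mF dF i.
pose q k t := k.+1%:R * (F (k.+1%:R^-1 *: delta_mx 0 i + x) t - F x t).
apply: (@measurable_fun_cvg _ _ _ setT q).
  move=> k; apply: measurable_funM; first exact: measurable_cst.
  by apply: measurable_funB; exact: mF.
move=> t _; rewrite mxE.
have : (fun h : R => h^-1 *: ((F^~ t \o shift x) (h *: delta_mx 0 i) - F x t)) @ 0^'
   --> 'D_(delta_mx 0 i) (F^~ t) x.
  exact: (@diff_derivable _ _ _ _ _ (delta_mx 0 i) (dF t)).
move=> /cvgr_dnbhsP/(_ (fun k => k.+1%:R^-1)); rewrite /q /= => H.
rewrite (_ : (fun k => _) = (fun k =>
    k.+1%:R^-1^-1 *: (F (k.+1%:R^-1 *: delta_mx 0 i + x) t - F x t))); last first.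
  by apply/funext => k; rewrite invrK.
apply: H; split; first by move=> k; rewrite invr_neq0.
exact: cvg_harmonic.
Qed.

End vector_measurability.

Section square_integrable.
Context {R : realType} {d} {T : measurableType d} (P : probability T R).
Local Open Scope ereal_scope.

Lemma integrable_of_sqr (f : T -> R) : measurable_fun setT f ->
  \int[P]_t (f t ^+ 2)%:E < +oo -> P.-integrable setT (EFin \o f).
Proof.
move=> mf fI.
apply: (@le_integrable _ _ _ P setT _ _ (fun t => (1 + f t ^+ 2)%:E)) => //.
- exact/measurable_EFinP.
- move=> t _; rewrite /= lee_fin [leRHS]ger0_norm ?addr_ge0 ?sqr_ge0//.
  by rewrite -real_normK ?num_real//; have := sqr_ge0 (`|f t| - 1)%R; have := normr_ge0 (f t); nra.
apply/integrableP; split.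
  by apply/measurable_EFinP; apply: measurable_funD => //; exact: measurable_funX.
rewrite (eq_integral (fun t => (1 + f t ^+ 2)%:E)); last first.
  by move=> t _; rewrite gee0_abs// lee_fin addr_ge0 ?sqr_ge0.
under eq_integral do rewrite EFinD.
rewrite ge0_integralD//.
- by rewrite integral_cst//= probability_setT mule1 lte_add_pinfty// ltry.
- by move=> t _; rewrite lee_fin sqr_ge0.
- by apply/measurable_EFinP; exact: measurable_funX.
Qed.

Lemma integral_cstT (a : R) : \int[P]_t a%:E = a%:E.
Proof. by rewrite integral_cst//= probability_setT mule1. Qed.

End square_integrable.

Section product_expectation.
Context {R : realType} {d1 d2} {T1 : measurableType d1} {T2 : measurableType d2}.
Variables (P1 : probability T1 R) (P2 : probability T2 R).
Local Open Scope ereal_scope.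

Lemma integral_prod_mul (a : T1 -> R) (b : T2 -> R) :
  P1.-integrable setT (EFin \o a) -> P2.-integrable setT (EFin \o b) ->
  (P1 \x P2).-integrable setT (fun t => (a t.1 * b t.2)%:E) /\
  \int[P1 \x P2]_t (a t.1 * b t.2)%:E = (\int[P1]_x (a x)%:E) * (\int[P2]_y (b y)%:E).
Proof.
move=> ia ib.
have ma : measurable_fun setT a by apply/measurable_EFinP; exact: measurable_int ia.
have mb : measurable_fun setT b by apply/measurable_EFinP; exact: measurable_int ib.
have mab : measurable_fun setT (fun t : T1 * T2 => (a t.1 * b t.2)%:E).
  apply/measurable_EFinP; apply: measurable_funM.
    exact: (measurableT_comp ma measurable_fst).
  exact: (measurableT_comp mb measurable_snd).
have abI : (P1 \x P2).-integrable setT (fun t => (a t.1 * b t.2)%:E).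
  apply/integrableP; split => //.
  rewrite fubini_tonelli1//; last exact: measurableT_comp.
  rewrite /fubini_F/=.
  have /integrableP[_ iaoo] := ia; have /integrableP[_ iboo] := ib.
  have mabsb : measurable_fun setT (fun y => `|b y|%:E).
    by apply/measurable_EFinP; exact: measurableT_comp.
  rewrite (eq_integral (fun x => `|a x|%:E * \int[P2]_y `|b y|%:E)); last first.
    move=> x _; rewrite -ge0_integralZl//.
    by apply: eq_integral => y _; rewrite normrM EFinM.
  rewrite ge0_integralZr//.
  - by apply: lte_mul_pinfty => //; [exact: integral_ge0|rewrite ge0_fin_numE// integral_ge0].
  - by apply/measurable_EFinP; exact: measurableT_comp.
  - exact: integral_ge0.
split => //; rewrite -integral12_prod_meas1// /fubini_F/=.
rewrite (eq_integral (fun x => (a x)%:E * \int[P2]_y (b y)%:E)); last first.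
  by move=> x _; rewrite -integralZl.
set B := \int[P2]_y _; have Bfin : B \is a fin_num by exact: integrable_fin_num.
by rewrite -(fineK Bfin) integralZr.
Qed.

End product_expectation.

Ltac nneg := repeat first [ done | exact: sqr_ge0 | exact: lpnorm_ge0 | exact: ltW
  | apply: addr_ge0 | apply: mulr_ge0 | apply: exprn_ge0 | rewrite invr_ge0 ].

Lemma expectationE {R : realType} {d} {T : measurableType d} (P : probability T R)
  (X : T -> R) : ('E_P[X] = \int[P]_w (X w)%:E)%E.
Proof. by rewrite unlock. Qed.

Lemma poweR_half_le {R : realType} (a : \bar R) (b : R) :
  (0 <= a)%E -> (a `^ 2^-1 <= b%:E)%E -> (a <= (b ^+ 2)%:E)%E.
Proof.
case: a => [r| |]//; last by rewrite poweRyr ?invr_neq0.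
rewrite lee_fin poweR_EFin !lee_fin => r0; rewrite powR12_sqrt// => rb.
rewrite -[r]sqr_sqrtr// lerXn2r ?nnegrE ?sqrtr_ge0//.
exact: le_trans (sqrtr_ge0 _) rb.
Qed.

Section real_integrals.
Context {R : realType} {d} {T : measurableType d} (P : probability T R).
Local Open Scope ereal_scope.

(** An integral is the difference of those of the positive and negative parts, and such a difference
    is finite only if both are. In this way the mean values asserted in the assumptions carry
    integrability. *)
Lemma integrable_of_fin (f : T -> R) : measurable_fun setT f ->
  \int[P]_t (f t)%:E \is a fin_num -> P.-integrable setT (EFin \o f).
Proof.
move=> /measurable_EFinP mf; rewrite integralE => H.
apply/integrableP; split => //.
rewrite (_ : (fun x => _) = abse \o (EFin \o f))// fune_abse ge0_integralD//; last 2 first.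
  exact: measurable_funepos.
  exact: measurable_funeneg.
move: H; set a := integral _ _ _; set b := integral _ _ _.
have : 0 <= a by exact: integral_ge0.
have : 0 <= b by exact: integral_ge0.
by case: a => [a| |]//; case: b => [b| |]//= _ _ _; rewrite -EFinD ltry.
Qed.

Lemma le_integral_lin (f g : T -> R) (c A B : R) :
  measurable_fun setT f -> measurable_fun setT g ->
  (forall t, 0 <= f t)%R -> (forall t, 0 <= g t)%R -> (0 <= c)%R ->
  \int[P]_t (f t)%:E <= A%:E -> \int[P]_t (g t)%:E <= B%:E ->
  \int[P]_t (c * f t + g t)%:E <= (c * A + B)%:E.
Proof.
move=> mf mg f0 g0 c0 fA gB.
under eq_integral do rewrite EFinD EFinM.
rewrite ge0_integralD//; last 4 first.
- by move=> t _; rewrite -EFinM lee_fin mulr_ge0.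
- by apply: measurable_funeM; exact/measurable_EFinP.
- by move=> t _; rewrite lee_fin.
- exact/measurable_EFinP.
rewrite EFinD EFinM leeD// ge0_integralZl//; last 2 first.
- exact/measurable_EFinP.
- by move=> t _; rewrite lee_fin.
by rewrite lee_wpmul2l.
Qed.

Lemma integral_dotv n (Y : T -> 'rV[R]_n) (l w : 'rV[R]_n) :
  (forall i, P.-integrable setT (fun t => (Y t 0%R i)%:E)) ->
  (forall i, \int[P]_t (Y t 0%R i)%:E = (w 0%R i)%:E) ->
  P.-integrable setT (fun t => (dotv l (Y t))%:E) /\
  \int[P]_t (dotv l (Y t))%:E = (dotv l w)%:E.
Proof.
move=> YI Yw.
have E t : (dotv l (Y t))%:E = \sum_(i < n) (l 0%R i)%:E * (Y t 0%R i)%:E.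
  by rewrite sumEFin; congr EFin; apply: eq_bigr.
have I i : P.-integrable setT (fun t => (l 0%R i)%:E * (Y t 0%R i)%:E).
  exact: integrableZl.
split; first by under eq_fun do rewrite E; apply: integrable_sum.
under eq_integral do rewrite E.
rewrite integral_sum// (eq_bigr (fun i => (l 0%R i * w 0%R i)%:E)) ?sumEFin// => i _.
by rewrite integralZl// Yw EFinM.
Qed.

(** Testing [Y] against its own mean: the pairing with [w] is at most half the sum of the two
    squared norms, and half of [|w|^2] is absorbed on the left. *)
Lemma lpnorm2_mean_le n (Y : T -> 'rV[R]_n) (w : 'rV[R]_n) (B : R) :
  (forall i, P.-integrable setT (fun t => (Y t 0%R i)%:E)) ->
  (forall i, \int[P]_t (Y t 0%R i)%:E = (w 0%R i)%:E) ->
  \int[P]_t (lpnorm 2 (Y t) ^+ 2)%:E <= B%:E -> (lpnorm 2 w ^+ 2 <= B)%R.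
Proof.
move=> YI Yw YB; have [dI dE] := integral_dotv w YI Yw.
have mY : measurable_vec Y by move=> i; apply/measurable_EFinP; exact: measurable_int (YI i).
have H : (dotv w w)%:E <= (2^-1 * B + 2^-1 * lpnorm 2 w ^+ 2)%:E.
  rewrite -dE; apply: le_trans (@le_integral_lin (fun t => lpnorm 2 (Y t) ^+ 2)%R
      (fun=> 2^-1 * lpnorm 2 w ^+ 2)%R 2^-1 B _ _ _ _ _ _ YB _).
  - apply: le_integral => //.
      apply: integrable_of_fin.
        apply: measurable_funD => //; apply: measurable_funM => //.
        by apply: measurable_funX; exact: measurable_lpnorm.
      rewrite ge0_fin_numE; last first.
        by apply: integral_ge0 => t _; rewrite lee_fin; nneg.
      apply: le_lt_trans (@le_integral_lin (fun t => lpnorm 2 (Y t) ^+ 2)%R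
        (fun=> 2^-1 * lpnorm 2 w ^+ 2)%R 2^-1 B (2^-1 * lpnorm 2 w ^+ 2)%R _ _ _ _ _ YB _) _.
      + by apply: measurable_funX; exact: measurable_lpnorm.
      + exact: measurable_cst.
      + by move=> t; exact: sqr_ge0.
      + by move=> t; nneg.
      + by rewrite invr_ge0.
      + by rewrite integral_cstT.
      + exact: ltry.
    move=> t _; rewrite lee_fin; apply: le_trans (ler_norm _) _.
    apply: le_trans (cauchy_schwarz_dotv _ _) _.
    by have := sqr_ge0 (lpnorm 2 w - lpnorm 2 (Y t)); nra.
  - by apply: measurable_funX; exact: measurable_lpnorm.
  - exact: measurable_cst.
  - by move=> t; exact: sqr_ge0.
  - by move=> t; nneg.
  - by rewrite invr_ge0.
  - by rewrite integral_cstT.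
by move: H; rewrite -lpnorm2_sqr lee_fin; lra.
Qed.

End real_integrals.

(** * Two-point gradient estimators *)

Section norm_inequalities.
Context {R : realType} {d : nat} (p : R).
Hypothesis p1 : 1 < p.
Implicit Types a b c e : 'rV[R]_d.

Lemma lpnorm_sqrD a b :
  lpnorm p (a + b) ^+ 2 <= 2 * lpnorm p a ^+ 2 + 2 * lpnorm p b ^+ 2.
Proof.
have := ler_lpnormD a b p1; have := lpnorm_ge0 p (a + b).
set x := lpnorm p (a + b); set y := lpnorm p a; set z := lpnorm p b => x0 xyz.
by have := sqr_ge0 (y - z); nra.
Qed.

Lemma lpnorm_sqrB a b :
  lpnorm p (a - b) ^+ 2 <= 2 * lpnorm p a ^+ 2 + 2 * lpnorm p b ^+ 2.
Proof. by rewrite -(@lpnormN _ _ p b) ?lpnorm_sqrD// gt_eqF// (lt_trans _ p1). Qed.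

Lemma lpnorm_sqrD4 a b c e : lpnorm p (a + b + (c + e)) ^+ 2 <=
  4 * (lpnorm p a ^+ 2 + lpnorm p b ^+ 2 + lpnorm p c ^+ 2 + lpnorm p e ^+ 2).
Proof.
have := lpnorm_sqrD (a + b) (c + e); have := lpnorm_sqrD a b; have := lpnorm_sqrD c e.
lra.
Qed.

(** The weight [alpha ^+ 2] is kept on the first vector only, the one that will carry the variance
    of a single estimator; powers of [1 - alpha] are bounded by 1. *)
Lemma lpnorm_sqr_combination alpha a b c e : 0 <= alpha <= 1 ->
  lpnorm p (alpha *: a + (1 - alpha) *: b + (c + (- (1 - alpha)) *: e)) ^+ 2 <=
  4 * (alpha ^+ 2 * lpnorm p a ^+ 2 + lpnorm p b ^+ 2 + lpnorm p c ^+ 2 + lpnorm p e ^+ 2).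
Proof.
move=> /andP[al0 al1]; apply: le_trans (lpnorm_sqrD4 _ _ _ _) _.
have one_alpha (r : R) : (1 - alpha) ^+ 2 * r ^+ 2 <= r ^+ 2.
  by rewrite ler_piMl ?sqr_ge0// exprn_ile1 ?subr_ge0// lerBlDr lerDl.
have nZ (r : R) y : lpnorm p (r *: y) ^+ 2 = r ^+ 2 * lpnorm p y ^+ 2.
  by rewrite lpnormZ ?gt_eqF ?(lt_trans _ p1)// exprMn real_normK ?num_real.
rewrite !nZ sqrrN.
have := one_alpha (lpnorm p b); have := one_alpha (lpnorm p e); lra.
Qed.

End norm_inequalities.

Section estimator.
Context {R : realType} {d : nat} {dX} {Xi : measurableType dX}.
Variables (Pxi : probability Xi R) (Pu : probability (borelRV R d) R).
Variables (F : 'rV[R]_d -> Xi -> R) (f : 'rV[R]_d -> R) (X Onu : set 'rV[R]_d).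
Variables (p nu L_f M_f sigma S_p : R).
Hypothesis F_meas : forall x, measurable_fun setT (F x).
Hypothesis F_C1 : forall z, continuously_differentiable (F^~ z).
Hypothesis p2 : 2 <= p.
Hypothesis nu0 : 0 < nu.
Hypothesis L_f0 : 0 < L_f.
Hypothesis X_Onu : enlarged_set X Pu nu `<=` Onu.
Hypothesis f_bound : forall x, X x -> lpnorm 2 (gradient f x) <= M_f.
Hypothesis f_smooth : forall x y, X x -> X y ->
  lpnorm 2 (gradient f x - gradient f y) <= L_f * lpnorm 2 (x - y).
Hypothesis hA2 : assumption2 Pxi F Onu f sigma.
Hypothesis hA3 : assumption3 Pxi F Onu L_f.
Hypothesis hA4 : assumption4 p Pu S_p.

Local Notation M := (Pu \x Pxi)%E.
Let U6 := fine (sixth_moment Pu).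
Let r2 := L_f ^+ 2 * nu ^+ 2 * U6.
Let sg := stochastic_gradient F.

Let p1 : 1 < p. Proof. by apply: lt_le_trans p2; rewrite ltr1n. Qed.
Let p0 : 0 < p. Proof. by apply: lt_trans p1. Qed.

Let msupport_nonempty : exists u, msupport Pu u.
Proof.
have [N [mN N0] NP] := msupport_full Pu.
apply: contrapT => H; have NT : N = setT.
  by apply/seteqP; split => // u _; apply: contrapT => /NP Su; apply: H; exists u.
by move: N0; rewrite NT probability_setT => /eqP; rewrite onee_eq0.
Qed.

Let X_sub x : X x -> Onu x.
Proof.
move=> Xx; have [u Su] := msupport_nonempty; apply: X_Onu.
by exists x, 0, u; rewrite lexx ler01; split => //; rewrite mul0r scale0r addr0.
Qed.

Let X_seg x u t : X x -> msupport Pu u -> 0 <= t <= 1 -> Onu (x + t *: (nu *: u)).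
Proof. by move=> Xx Su t01; apply: X_Onu; exists x, t, u; rewrite scalerA. Qed.

Let F_diff x z : differentiable (F^~ z) x.
Proof. by have [dF _] := F_C1 z; exact: dF. Qed.

Lemma measurable_sg x : measurable_vec (sg x).
Proof. by apply: measurable_gradient => // z; exact: F_diff. Qed.

Lemma measurable_sg_joint i :
  measurable_fun setT (fun a : borelRV R d * Xi => sg a.1 a.2 0 i).
Proof.
apply: (@measurable_caratheodory _ _ _ _ (fun x z => sg x z 0 i)).
  by move=> x; exact: measurable_sg.
move=> z x; apply: (@cvg_comp _ _ _ (gradient (F^~ z)) (fun y : 'rV[R]_d => y 0 i) _
  (nbhs (gradient (F^~ z) x))); last exact: coord_continuous.
by have [_ cF] := F_C1 z; exact: cF.
Qed.

Lemma measurable_F_joint : measurable_fun setT (fun a : borelRV R d * Xi => F a.1 a.2).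
Proof.
apply: measurable_caratheodory => // z x.
exact: differentiable_continuous (F_diff x z).
Qed.

Lemma sg_sqr_diff x y : Onu x -> Onu y ->
  (\int[Pxi]_z (lpnorm 2 (sg x z - sg y z) ^+ 2)%:E
    <= (L_f ^+ 2 * lpnorm 2 (x - y) ^+ 2)%:E)%E.
Proof.
move=> Ox Oy; rewrite -exprMn; apply: poweR_half_le.
  by apply: integral_ge0 => z _; rewrite lee_fin sqr_ge0.
have := hA3 Ox Oy; rewrite expectationE pnormE.
by under eq_integral do rewrite pnormE.
Qed.

Lemma sg_sqr x : X x ->
  (\int[Pxi]_z (lpnorm 2 (sg x z) ^+ 2)%:E <= (2 * (sigma ^+ 2 + M_f ^+ 2))%:E)%E.
Proof.
move=> Xx; have := A2_variance hA2 (X_sub Xx); rewrite expectationE.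
under eq_integral do rewrite pnormE.
move=> var; apply: (@le_trans _ _ (\int[Pxi]_z
  ((2 * lpnorm 2 (sg x z - gradient f x) ^+ 2)%:E + (2 * M_f ^+ 2)%:E))%E).
  apply: ge0_le_integral => //.
  - by move=> z _; rewrite lee_fin sqr_ge0.
  - by apply: measurable_lpnorm_sqr; exact: measurable_sg.
  - apply: emeasurable_funD; last exact: measurable_cst.
    apply/measurable_EFinP; apply: measurable_funM; first exact: measurable_cst.
    apply: measurable_funX; apply: measurable_lpnorm; apply: measurable_vecB.
      exact: measurable_sg.
    exact: measurable_vec_cst.
  - move=> z _; rewrite -EFinD lee_fin -{1}(subrK (gradient f x) (sg x z)).
    apply: le_trans (lpnorm_sqrD _ _ _) _; first by rewrite ltr1n.
    by rewrite lerD2l ler_wpM2l// lerXn2r ?nnegrE ?lpnorm_ge0 ?f_bound// (le_trans _ (f_bound Xx)) ?lpnorm_ge0.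
rewrite ge0_integralD//.
- rewrite integral_cstT mulrDr EFinD leeD2r//.
  under eq_integral do rewrite EFinM.
  rewrite ge0_integralZl//.
  + by rewrite EFinM lee_wpmul2l.
  + apply: measurable_lpnorm_sqr; apply: measurable_vecB; first exact: measurable_sg.
    exact: measurable_vec_cst.
  + by move=> z _; rewrite lee_fin sqr_ge0.
- by move=> z _; rewrite lee_fin; nneg.
- apply/measurable_EFinP; apply: measurable_funM; first exact: measurable_cst.
  apply: measurable_funX; apply: measurable_lpnorm; apply: measurable_vecB.
    exact: measurable_sg.
  exact: measurable_vec_cst.
- by move=> z _; rewrite lee_fin; nneg.
Qed.

(** Remainder of the finite difference against the directional derivative. The estimator is then
    [dotv (sg x z) u *: u], the part governed by (A4), plus [delta x u z *: u]. *)
Let delta x u z := (F (x + nu *: u) z - F x z) / nu - dotv (sg x z) u.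

(** Mean-square smoothness (A3) bounds no single sample. The squared remainder is therefore bounded
    by the integral over the segment of the squared derivative gap, the two integrals are exchanged,
    and (A3) is used at each point of the segment. *)
Lemma delta_sqr x u : X x -> msupport Pu u ->
  (\int[Pxi]_z (delta x u z ^+ 2)%:E
    <= (L_f ^+ 2 * nu ^+ 2 * lpnorm 2 u ^+ 4)%:E)%E.
Proof.
move=> Xx Su; set v := nu *: u.
pose psi z t := dotv (sg (x + t *: v) z - sg x z) v.
have mpsi : measurable_fun setT (fun a : Xi * R => psi a.1 a.2).
  apply: measurable_dotv; last exact: measurable_vec_cst.
  apply: measurable_vecB => i; last first.
    exact: (measurableT_comp (measurable_sg x i) measurable_fst).
  apply: (@measurableT_comp _ _ _ _ _ _ (fun a : borelRV R d * Xi => sg a.1 a.2 0 i) _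
    (fun a : Xi * R => (x + a.2 *: v : borelRV R d, a.1)) (measurable_sg_joint i)).
  apply: measurable_fun_pair => //; apply: measurable_rV; apply: measurable_vecD.
    exact: measurable_vec_cst.
  by apply: measurable_vecZ => //; exact: measurable_vec_cst.
have psi_sqr t : 0 <= t <= 1 ->
    (\int[Pxi]_z (psi z t ^+ 2)%:E <= (L_f ^+ 2 * lpnorm 2 v ^+ 4)%:E)%E.
  move=> t01; have Ot := X_seg Xx Su t01.
  apply: (@le_trans _ _ (\int[Pxi]_z ((lpnorm 2 v ^+ 2)%:E *
      (lpnorm 2 (sg (x + t *: v) z - sg x z) ^+ 2)%:E))%E).
    apply: ge0_le_integral => //.
    - by move=> z _; rewrite lee_fin sqr_ge0.
    - apply/measurable_EFinP; apply: measurable_funX.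
      exact: (measurableT_comp mpsi (pair2_measurable t)).
    - apply: emeasurable_funM; first exact: measurable_cst.
      by apply: measurable_lpnorm_sqr; apply: measurable_vecB; exact: measurable_sg.
    - move=> z _; rewrite -EFinM lee_fin -exprMn -[leLHS]real_normK ?num_real//.
      rewrite lerXn2r ?nnegrE ?mulr_ge0 ?lpnorm_ge0//.
      by rewrite mulrC; exact: cauchy_schwarz_dotv.
  rewrite ge0_integralZl ?lee_fin ?sqr_ge0//; last 2 first.
    by apply: measurable_lpnorm_sqr; apply: measurable_vecB; exact: measurable_sg.
    by move=> z _; rewrite lee_fin sqr_ge0.
  apply: le_trans (lee_wpmul2l _ (sg_sqr_diff Ot (X_sub Xx))) _.
    by rewrite lee_fin sqr_ge0.
  rewrite -EFinM lee_fin addrAC subrr add0r (@lpnormZ _ _ 2 t v)//.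
  have [/andP[t0 t1]] := t01; have n0 := lpnorm_ge0 2 v.
  rewrite exprMn real_normK ?num_real//.
  rewrite (_ : lpnorm 2 v ^+ 4 = lpnorm 2 v ^+ 2 * lpnorm 2 v ^+ 2); last by ring.
  rewrite mulrCA ler_wpM2l ?sqr_ge0// mulrC ler_wpM2r ?sqr_ge0//.
  by rewrite ler_piMl ?sqr_ge0// exprn_ile1.
have key : (\int[Pxi]_z ((nu * delta x u z) ^+ 2)%:E <= (L_f ^+ 2 * lpnorm 2 v ^+ 4)%:E)%E.
  (* The indicator extends the segment integral to the whole line, so that Tonelli applies to a
     product of full spaces. *)
  pose H (a : Xi * R) : \bar R := ((psi a.1 a.2 ^+ 2)%:E * (\1_(`[0%R, 1%R]%classic) a.2)%:E)%E.
  have mH : measurable_fun setT H.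
    apply: emeasurable_funM.
      by apply/measurable_EFinP; apply: measurable_funX.
    apply/measurable_EFinP; apply: (measurableT_comp _ measurable_snd).
    by apply: measurable_indic.
  have H0 a : (0 <= H a)%E by rewrite /H mule_ge0// lee_fin ?sqr_ge0.
  apply: (@le_trans _ _ (\int[Pxi]_z \int[lebesgue_measure]_t H (z, t))%E).
    apply: ge0_le_integral => //.
    - by move=> z _; rewrite lee_fin sqr_ge0.
    - apply/measurable_EFinP; apply: measurable_funX; apply: measurable_funM => //.
      apply: measurable_funB; last first.
        by apply: measurable_dotv; [exact: measurable_sg|exact: measurable_vec_cst].
      by apply: measurable_funM => //; apply: measurable_funB.
    - by apply: measurable_fun_fubini_tonelli_F.
    - move=> z _; pose phi t := F (x + t *: v) z + (0 + t * - dotv (sg x z) v).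
      have dphi (t : R) : is_derive t 1 phi (psi z t).
        rewrite /psi dotvBl; apply: is_deriveD; last exact: is_derive_affine.
        exact: is_derive_line.
      have cpsi : continuous (psi z).
        move=> t; rewrite /psi.
        have -> : (fun t => dotv (sg (x + t *: v) z - sg x z) v) =
          (fun t => dotv (sg (x + t *: v) z) v - dotv (sg x z) v).
          by apply/funext => s; rewrite dotvBl.
        apply: cvgB; last exact: cvg_cst.
        have [_ cF] := F_C1 z.
        apply: (@cvg_comp _ _ _ (fun t : R => x + t *: v)
          (fun y => dotv (gradient (F^~ z) y) v) _ (nbhs (x + t *: v))).
          exact: continuous_line.
        exact: continuous_dotv_gradient.
      have := sqr_increment_le dphi cpsi.
      have -> : phi 1 - phi 0 = nu * delta x u z.
        rewrite /phi /delta scale1r scale0r addr0 -/v dotvZr; field.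
        by rewrite gt_eqF.
      move=> /le_trans; apply; rewrite integral_mkcond.
      apply: ge0_le_integral => //.
      - by move=> t _; rewrite patchE; case: ifP => // _; rewrite lee_fin sqr_ge0.
      - apply/(measurable_restrictT _ _).1 => //.
        apply/measurable_EFinP/measurable_funX; apply: measurable_funTS.
        exact: (measurableT_comp mpsi (pair1_measurable z)).
      - exact: (measurableT_comp mH (pair1_measurable z)).
      - move=> t _; rewrite patchE /H indicE/=.
        by case: ifP => _; rewrite ?mule1 ?mule0.
  rewrite [leLHS](_ : _ = (\int[lebesgue_measure]_t \int[Pxi]_z H (z, t))%E); last first.
    exact: (@fubini_tonelli _ _ _ _ _ Pxi lebesgue_measure H mH H0).
  apply: (@le_trans _ _ (\int[lebesgue_measure]_t ((L_f ^+ 2 * lpnorm 2 v ^+ 4)%:E *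
      (\1_(`[0%R, 1%R]%classic) t)%:E))%E).
    apply: ge0_le_integral => //.
    - by move=> t _; apply: integral_ge0.
    - exact: measurable_fun_fubini_tonelli_G.
    - apply: emeasurable_funM; first exact: measurable_cst.
      by apply/measurable_EFinP; exact: measurable_indic.
    - move=> t _; rewrite /H/= indicE; have [t01|_] := boolP (t \in _).
        under eq_integral do rewrite mule1.
        rewrite mule1; apply: psi_sqr.
        by move: t01; rewrite inE/= in_itv.
      by under eq_integral do rewrite mule0; rewrite integral0 mule0.
  rewrite ge0_integralZl//.
  - rewrite integral_indic// setIT (_ : _ `[0%R, 1%R]%classic = 1%E) ?mule1//.
    by have := @lebesgue_measure_itv R `[0%R, 1%R]; rewrite /= lte01 oppr0 adde0.
  - by apply/measurable_EFinP; exact: measurable_indic.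
  - by rewrite lee_fin; nneg.
have -> : (\int[Pxi]_z (delta x u z ^+ 2)%:E =
    (nu ^- 2)%:E * \int[Pxi]_z ((nu * delta x u z) ^+ 2)%:E)%E.
  rewrite -ge0_integralZl//.
  - apply: eq_integral => z _; rewrite -EFinM; congr EFin.
    by rewrite exprMn mulKf// expf_neq0// gt_eqF.
  - apply/measurable_EFinP; apply: measurable_funX; apply: measurable_funM => //.
    apply: measurable_funB; last first.
      by apply: measurable_dotv; [exact: measurable_sg|exact: measurable_vec_cst].
    by apply: measurable_funM => //; apply: measurable_funB.
  - by move=> z _; rewrite lee_fin sqr_ge0.
  - by rewrite lee_fin invr_ge0 sqr_ge0.
apply: le_trans (lee_wpmul2l _ key) _; first by rewrite lee_fin invr_ge0 sqr_ge0.
rewrite -EFinM lee_fin /v lpnormZ// gtr0_norm//.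
by rewrite le_eqVlt; apply/orP; left; apply/eqP; field; rewrite gt_eqF.
Qed.

Lemma measurable_F_comp {dT} {T : measurableType dT} (y : T -> 'rV[R]_d) (z : T -> Xi) :
  measurable_vec y -> measurable_fun setT z -> measurable_fun setT (fun t => F (y t) (z t)).
Proof.
move=> my mz; apply: (@measurableT_comp _ _ _ _ _ _ (fun a : borelRV R d * Xi => F a.1 a.2)
  _ (fun t => (y t : borelRV R d, z t)) measurable_F_joint).
by apply: measurable_fun_pair => //; exact: measurable_rV.
Qed.

Lemma measurable_zo_estimator {dT} {T : measurableType dT} (x u : T -> 'rV[R]_d) (z : T -> Xi) :
  measurable_vec x -> measurable_vec u -> measurable_fun setT z ->
  measurable_vec (fun t => zo_estimator F nu (x t) (u t) (z t)).
Proof.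
move=> mx mu mz; apply: measurable_vecZ => //.
apply: measurable_funM; last exact: measurable_cst.
apply: measurable_funB; apply: measurable_F_comp => //.
by apply: measurable_vecD => //; apply: measurable_vecZ.
Qed.

Let measurable_u : measurable_vec (fun t : borelRV R d * Xi => t.1 : 'rV[R]_d).
Proof. by move=> i; exact: (measurableT_comp (measurable_coord i) measurable_fst). Qed.

Let measurable_a (a : Xi -> 'rV[R]_d) : measurable_vec a ->
  measurable_vec (fun t : borelRV R d * Xi => a t.2).
Proof. by move=> ma i; exact: (measurableT_comp (ma i) measurable_snd). Qed.

Let S1 : 1 <= S_p. Proof. exact: A4_Sp_ge1 hA4. Qed.

Let U6E : sixth_moment Pu = U6%:E.
Proof.
rewrite fineK// ge0_fin_numE; first exact: A4_sixth_moment hA4.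
by rewrite /sixth_moment expectationE; apply: integral_ge0 => u _; rewrite lee_fin pnormE; nneg.
Qed.

Let U6_ge0 : 0 <= U6.
Proof.
rewrite -lee_fin -U6E /sixth_moment expectationE.
by apply: integral_ge0 => u _; rewrite lee_fin pnormE; nneg.
Qed.

(** The direction is integrated first with the sample frozen, so that (A4) applies with
    [g = a z]. *)
Lemma int_rank1 (a : Xi -> 'rV[R]_d) (B : R) : measurable_vec a ->
  (\int[Pxi]_z (lpnorm 2 (a z) ^+ 2)%:E <= B%:E)%E ->
  (\int[M]_t (lpnorm p (dotv (a t.2) t.1 *: (t.1 : 'rV[R]_d)) ^+ 2)%:E <= (S_p * B)%:E)%E.
Proof.
move=> ma aB; have S0 : 0 <= S_p by apply: le_trans S1.
have mH : measurable_fun setT (fun t : borelRV R d * Xi =>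
    (lpnorm p (dotv (a t.2) t.1 *: (t.1 : 'rV[R]_d)) ^+ 2)%:E).
  apply: measurable_lpnorm_sqr; apply: measurable_vecZ => //.
  by apply: measurable_dotv => //; exact: measurable_a.
have H0 (t : borelRV R d * Xi) : (0 <= (lpnorm p (dotv (a t.2) t.1 *: (t.1 : 'rV[R]_d)) ^+ 2)%:E)%E.
  by rewrite lee_fin sqr_ge0.
rewrite fubini_tonelli2//.
apply: (@le_trans _ _ (\int[Pxi]_z (S_p%:E * (lpnorm 2 (a z) ^+ 2)%:E))%E).
  apply: ge0_le_integral => //.
  - by move=> z _; apply: integral_ge0 => u _; exact: H0 (u, z).
  - exact: measurable_fun_fubini_tonelli_G.
  - by apply: measurable_funeM; exact: measurable_lpnorm_sqr.
  - move=> z _; rewrite /fubini_G/=.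
    have := A4_Sp hA4 (a z); rewrite expectationE pnormE EFinM.
    by under eq_integral do rewrite pnormE.
rewrite ge0_integralZl//.
- by rewrite EFinM lee_wpmul2l.
- exact: measurable_lpnorm_sqr.
- by move=> z _; rewrite lee_fin sqr_ge0.
Qed.

Let measurable_delta x : measurable_fun setT (fun t : borelRV R d * Xi => delta x t.1 t.2).
Proof.
apply: measurable_funB.
  apply: measurable_funM => //; apply: measurable_funB; apply: measurable_F_comp => //.
  - apply: measurable_vecD; first exact: measurable_vec_cst.
    by apply: measurable_vecZ => //; exact: measurable_cst.
by apply: measurable_dotv => //; apply: measurable_a; exact: measurable_sg.
Qed.

Let rem x (t : borelRV R d * Xi) : 'rV[R]_d := delta x t.1 t.2 *: (t.1 : 'rV[R]_d).

Let measurable_rem x : measurable_vec (rem x).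
Proof. by apply: measurable_vecZ => //; exact: measurable_delta. Qed.

(** The fourth power of [|u|] from [delta_sqr] meets the square from the factor [u]: this is the
    origin of the sixth moment. Directions outside the support form a null set. *)
Lemma int_rem x : X x -> (\int[M]_t (lpnorm 2 (rem x t) ^+ 2)%:E <= r2%:E)%E.
Proof.
move=> Xx.
have mH : measurable_fun setT (fun t => (lpnorm 2 (rem x t) ^+ 2)%:E).
  exact: measurable_lpnorm_sqr.
have H0 t : (0 <= (lpnorm 2 (rem x t) ^+ 2)%:E)%E by rewrite lee_fin sqr_ge0.
rewrite fubini_tonelli1// /fubini_F.
have [N [mN N0] NP] := msupport_full Pu.
have mu2 k : measurable_fun setT (fun u : borelRV R d => lpnorm 2 (u : 'rV[R]_d) ^+ k).
  by apply: measurable_funX; apply: measurable_lpnorm => i; exact: measurable_coord.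
apply: (@le_trans _ _ (\int[Pu]_u ((L_f ^+ 2 * nu ^+ 2)%:E *
    (lpnorm 2 (u : 'rV[R]_d) ^+ 6)%:E))%E).
  apply: (ge0_le_integral_off mN) => //.
  - by move=> u; apply: integral_ge0.
  - by move=> u; rewrite -EFinM lee_fin; nneg.
  - move=> u /NP Su; rewrite /rem/=.
    have -> : (\int[Pxi]_z (lpnorm 2 (delta x u z *: (u : 'rV[R]_d)) ^+ 2)%:E =
      (lpnorm 2 (u : 'rV[R]_d) ^+ 2)%:E * \int[Pxi]_z (delta x u z ^+ 2)%:E)%E.
      rewrite -ge0_integralZl//.
      + apply: eq_integral => z _; rewrite lpnormZ// exprMn real_normK ?num_real//.
        by rewrite -EFinM mulrC.
      + apply/measurable_EFinP; apply: measurable_funX.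
        exact: (measurableT_comp (measurable_delta x) (pair1_measurable u)).
      + by move=> z _; rewrite lee_fin sqr_ge0.
      + by rewrite lee_fin sqr_ge0.
    apply: le_trans (lee_wpmul2l _ (delta_sqr Xx Su)) _; first by rewrite lee_fin sqr_ge0.
    rewrite -!EFinM lee_fin le_eqVlt; apply/orP; left; apply/eqP; ring.
rewrite ge0_integralZl//.
- rewrite /r2 [in leRHS]EFinM -U6E /sixth_moment expectationE.
  by under [in leRHS]eq_integral do rewrite pnormE.
- exact/measurable_EFinP.
- by move=> u _; rewrite lee_fin; nneg.
- by rewrite lee_fin; nneg.
Qed.

Let rank1 x (t : borelRV R d * Xi) : 'rV[R]_d := dotv (sg x t.2) t.1 *: (t.1 : 'rV[R]_d).

Let measurable_rank1 x : measurable_vec (rank1 x).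
Proof.
apply: measurable_vecZ => //; apply: measurable_dotv => //.
by apply: measurable_a; exact: measurable_sg.
Qed.

Let zo x (t : borelRV R d * Xi) : 'rV[R]_d := zo_estimator F nu x t.1 t.2.

Let zoE x t : zo x t = rank1 x t + rem x t.
Proof. by rewrite /zo /zo_estimator /rank1 /rem /delta -scalerDl; congr (_ *: _); rewrite [RHS]addrC subrK. Qed.

Let mean_rank1 x i : X x -> M.-integrable setT (fun t => (rank1 x t 0 i)%:E) /\
  (\int[M]_t (rank1 x t 0%R i)%:E = (gradient f x 0%R i)%:E)%E.
Proof.
move=> Xx.
have cov j : Pu.-integrable setT (EFin \o (fun u : borelRV R d => (u : 'rV[R]_d) 0 j * (u : 'rV[R]_d) 0 i)).
  apply: integrable_of_fin; first by apply: measurable_funM; exact: measurable_coord.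
  by have := A4_covariance hA4 j i; rewrite expectationE => ->.
have gI j : Pxi.-integrable setT (EFin \o (fun z => sg x z 0 j)).
  apply: integrable_of_fin; first exact: measurable_sg.
  by have := A2_unbiased hA2 j (X_sub Xx); rewrite expectationE => ->.
have E t : (rank1 x t 0 i)%:E = (\sum_(j < d) ((t.1 : 'rV[R]_d) 0%R j *
    (t.1 : 'rV[R]_d) 0%R i * sg x t.2 0%R j)%:E)%E.
  rewrite sumEFin; congr EFin; rewrite mxE mulr_suml; apply: eq_bigr => j _; ring.
have PM j := integral_prod_mul (cov j) (gI j).
split.
  by under eq_fun do rewrite E; apply: integrable_sum => // j _; have [] := PM j.
under eq_integral do rewrite E.
rewrite integral_sum//; last by move=> j; have [] := PM j.
rewrite (eq_bigr (fun j => ((j == i)%:R * gradient f x 0 j)%:E)); last first.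
  move=> j _; have [_ ->] := PM j.
  have := A4_covariance hA4 j i; rewrite expectationE => ->.
  by have := A2_unbiased hA2 j (X_sub Xx); rewrite expectationE => ->.
rewrite sumEFin (bigD1 i)//= eqxx mul1r big1 ?addr0// => j /negbTE ->.
by rewrite mul0r.
Qed.

Let rem_integrable x i : X x -> M.-integrable setT (fun t => (rem x t 0 i)%:E).
Proof.
move=> Xx; apply: integrable_of_sqr; first exact: measurable_rem.
apply: le_lt_trans (le_trans _ (int_rem Xx)) (ltry _).
apply: ge0_le_integral => //.
- by move=> t _; rewrite lee_fin sqr_ge0.
- by apply/measurable_EFinP; apply: measurable_funX; exact: measurable_rem.
- exact: measurable_lpnorm_sqr.
- move=> t _; rewrite lee_fin -real_normK ?num_real//.
  by rewrite lerXn2r ?nnegrE ?lpnorm_ge0//; exact: le_coord_lpnorm.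
Qed.

(** Centre used for the noise. The estimator is biased, and centring at its own mean keeps
    increments exactly mean zero; the distance to the gradient is a separate deterministic term,
    [zo_bias]. *)
Definition zo_mean x : 'rV[R]_d :=
  \row_i fine (\int[M]_t (zo_estimator F nu x t.1 t.2 0%R i)%:E)%E.

Lemma zo_integrable x i : X x -> M.-integrable setT (fun t => (zo_estimator F nu x t.1 t.2 0 i)%:E).
Proof.
move=> Xx; under eq_fun do rewrite -/(zo x _) zoE mxE EFinD.
by apply: integrableD => //; [have [] := mean_rank1 i Xx|exact: rem_integrable].
Qed.

Lemma zo_meanE x i : X x ->
  (\int[M]_t (zo_estimator F nu x t.1 t.2 0%R i)%:E = (zo_mean x 0%R i)%:E)%E.
Proof.
by move=> Xx; rewrite mxE fineK//; apply: integrable_fin_num => //; exact: zo_integrable.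
Qed.

Lemma zo_bias x : X x -> lpnorm 2 (zo_mean x - gradient f x) ^+ 2 <= r2.
Proof.
move=> Xx; apply: (@lpnorm2_mean_le _ _ _ M _ (rem x)) (int_rem Xx).
  by move=> i; exact: rem_integrable.
move=> i; have [rI rE] := mean_rank1 i Xx.
have zI := zo_integrable i Xx.
rewrite (_ : (zo_mean x - gradient f x) 0 i = zo_mean x 0 i - gradient f x 0 i); last first.
  by rewrite [LHS]mxE [X in _ + X]mxE.
rewrite EFinB -zo_meanE//.
rewrite -rE -integralB//; apply: eq_integral => t _.
by rewrite -EFinB -/(zo x t) zoE [X in X - _]mxE addrAC subrr add0r.
Qed.

Let zo_mean_sqr x : X x -> lpnorm p (zo_mean x) ^+ 2 <= 2 * M_f ^+ 2 + 2 * r2.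
Proof.
move=> Xx.
apply: (@le_trans _ _ (lpnorm 2 (zo_mean x) ^+ 2)).
  by rewrite lerXn2r ?nnegrE ?lpnorm_ge0//; exact: le_lpnorm.
rewrite -(subrK (gradient f x) (zo_mean x)) addrC.
apply: le_trans (lpnorm_sqrD _ _ _) _; first by rewrite ltr1n.
rewrite lerD// ler_wpM2l//; last exact: zo_bias.
by rewrite lerXn2r ?nnegrE ?lpnorm_ge0 ?f_bound// (le_trans _ (f_bound Xx)) ?lpnorm_ge0.
Qed.

Let sqr_le2 (y : 'rV[R]_d) : lpnorm p y ^+ 2 <= lpnorm 2 y ^+ 2.
Proof. by rewrite lerXn2r ?nnegrE ?lpnorm_ge0//; exact: le_lpnorm. Qed.

Let measurable_sqr (q : R) (Y : borelRV R d * Xi -> 'rV[R]_d) : measurable_vec Y ->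
  measurable_fun setT (fun t => lpnorm q (Y t) ^+ 2).
Proof. by move=> mY; apply: measurable_funX; exact: measurable_lpnorm. Qed.

(** Estimator and mean are separated at a factor 2, the estimator into its two parts at a further 2.
    The rank-one part gives [4 * S_p * 2 (sigma^2 + M_f^2)]; the remainder and the mean give [4 r2]
    each. *)
Lemma zo_variance x : X x ->
  (\int[M]_t (lpnorm p (zo_estimator F nu x t.1 t.2 - zo_mean x) ^+ 2)%:E
    <= (8 * S_p * (sigma ^+ 2 + M_f ^+ 2) + 4 * M_f ^+ 2 + 8 * r2)%:E)%E.
Proof.
move=> Xx; set K := 4 * M_f ^+ 2 + 4 * r2.
have K0 : 0 <= K by rewrite /K; nneg.
have m1 : measurable_fun setT (fun t => lpnorm 2 (rem x t) ^+ 2) by exact: measurable_sqr.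
have m2 : measurable_fun setT (fun t => lpnorm p (rank1 x t) ^+ 2) by exact: measurable_sqr.
have m3 : measurable_fun setT (fun t => 4 * lpnorm 2 (rem x t) ^+ 2 + K).
  by apply: measurable_funD => //; exact: measurable_funM.
have I1 : (\int[M]_t (4 * lpnorm 2 (rem x t) ^+ 2 + K)%:E <= (4 * r2 + K)%:E)%E.
  apply: le_integral_lin (int_rem Xx) _ => //.
  - by move=> t; exact: sqr_ge0.
  - by rewrite integral_cstT.
have I2 : (\int[M]_t (4 * lpnorm p (rank1 x t) ^+ 2 + (4 * lpnorm 2 (rem x t) ^+ 2 + K))%:E
    <= (4 * (S_p * (2 * (sigma ^+ 2 + M_f ^+ 2))) + (4 * r2 + K))%:E)%E.
  apply: le_integral_lin (int_rank1 (@measurable_sg x) (sg_sqr Xx)) I1 => //.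
  - by move=> t; exact: sqr_ge0.
  - by move=> t; nneg.
apply: le_trans (le_trans I2 _); last first.
  by rewrite lee_fin le_eqVlt; apply/orP; left; apply/eqP; rewrite /K; ring.
apply: ge0_le_integral => //.
- by move=> t _; rewrite lee_fin sqr_ge0.
- apply: measurable_lpnorm_sqr; apply: measurable_vecB; last exact: measurable_vec_cst.
  by apply: measurable_zo_estimator => //; exact: measurable_vec_cst.
- by apply/measurable_EFinP; apply: measurable_funD => //; exact: measurable_funM.
- move=> t _; rewrite lee_fin -/(zo x t) zoE.
  apply: le_trans (lpnorm_sqrB p1 _ _) _.
  have := lpnorm_sqrD p1 (rank1 x t) (rem x t); have := zo_mean_sqr Xx.
  have := sqr_le2 (rem x t); rewrite /K; lra.
Qed.

(** The variance reduction: both estimators use the same draw, so their difference is small with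
    [x - y], and only an [alpha] fraction of a full estimator remains. *)
Lemma zo_diff_variance x y alpha : X x -> X y -> 0 <= alpha <= 1 ->
  (\int[M]_t (lpnorm p (zo_estimator F nu x t.1 t.2 - zo_mean x
      - (1 - alpha) *: (zo_estimator F nu y t.1 t.2 - zo_mean y)) ^+ 2)%:E
    <= (alpha ^+ 2 * (16 * S_p * (sigma ^+ 2 + M_f ^+ 2) + 8 * M_f ^+ 2)
        + 16 * S_p * L_f ^+ 2 * lpnorm 2 (x - y) ^+ 2 + 32 * r2)%:E)%E.
Proof.
move=> Xx Xy /andP[al0 al1].
pose D := lpnorm 2 (x - y) ^+ 2; have D0 : 0 <= D by exact: sqr_ge0.
set K := 8 * (alpha ^+ 2 * M_f ^+ 2 + L_f ^+ 2 * D + 2 * r2).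
have K0 : 0 <= K by rewrite /K; nneg.
pose rank1d (t : borelRV R d * Xi) : 'rV[R]_d :=
  dotv (sg x t.2 - sg y t.2) t.1 *: (t.1 : 'rV[R]_d).
have mdiff : measurable_vec (fun z => sg x z - sg y z).
  by apply: measurable_vecB; exact: measurable_sg.
have mrank1d : measurable_vec rank1d.
  apply: measurable_vecZ => //; apply: measurable_dotv => //.
  exact: (measurable_a mdiff).
have m1 v : measurable_fun setT (fun t => lpnorm 2 (rem v t) ^+ 2) by exact: measurable_sqr.
have m2 : measurable_fun setT (fun t => lpnorm p (rank1 x t) ^+ 2) by exact: measurable_sqr.
have m3 : measurable_fun setT (fun t => lpnorm p (rank1d t) ^+ 2) by exact: measurable_sqr.
have I1 : (\int[M]_t (8 * lpnorm 2 (rem y t) ^+ 2 + K)%:E <= (8 * r2 + K)%:E)%E.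
  apply: le_integral_lin (int_rem Xy) _ => //.
  - by move=> t; exact: sqr_ge0.
  - by rewrite integral_cstT.
have n1 : measurable_fun setT (fun t => 8 * lpnorm 2 (rem y t) ^+ 2 + K).
  by apply: measurable_funD => //; exact: measurable_funM.
have I2 : (\int[M]_t (8 * lpnorm 2 (rem x t) ^+ 2 + (8 * lpnorm 2 (rem y t) ^+ 2 + K))%:E
    <= (8 * r2 + (8 * r2 + K))%:E)%E.
  apply: le_integral_lin (int_rem Xx) I1 => //.
  - by move=> t; exact: sqr_ge0.
  - by move=> t; nneg.
have n2 : measurable_fun setT (fun t => 8 * lpnorm 2 (rem x t) ^+ 2 + (8 * lpnorm 2 (rem y t) ^+ 2 + K)).
  by apply: measurable_funD => //; exact: measurable_funM.
have I3 : (\int[M]_t (8 * lpnorm p (rank1d t) ^+ 2 +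
     (8 * lpnorm 2 (rem x t) ^+ 2 + (8 * lpnorm 2 (rem y t) ^+ 2 + K)))%:E
    <= (8 * (S_p * (L_f ^+ 2 * D)) + (8 * r2 + (8 * r2 + K)))%:E)%E.
  apply: le_integral_lin (int_rank1 mdiff (sg_sqr_diff (X_sub Xx) (X_sub Xy))) I2 => //.
  - by move=> t; exact: sqr_ge0.
  - by move=> t; nneg.
have n3 : measurable_fun setT (fun t => 8 * lpnorm p (rank1d t) ^+ 2 +
     (8 * lpnorm 2 (rem x t) ^+ 2 + (8 * lpnorm 2 (rem y t) ^+ 2 + K))).
  by apply: measurable_funD => //; exact: measurable_funM.
have I4 : (\int[M]_t (8 * alpha ^+ 2 * lpnorm p (rank1 x t) ^+ 2 + (8 * lpnorm p (rank1d t) ^+ 2 +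
     (8 * lpnorm 2 (rem x t) ^+ 2 + (8 * lpnorm 2 (rem y t) ^+ 2 + K))))%:E
    <= (8 * alpha ^+ 2 * (S_p * (2 * (sigma ^+ 2 + M_f ^+ 2))) +
        (8 * (S_p * (L_f ^+ 2 * D)) + (8 * r2 + (8 * r2 + K))))%:E)%E.
  apply: le_integral_lin (int_rank1 (@measurable_sg x) (sg_sqr Xx)) I3 => //.
  - by move=> t; exact: sqr_ge0.
  - by move=> t; nneg.
  - by nneg.
apply: le_trans (le_trans I4 _); last first.
  rewrite lee_fin /K -/D.
  (* The means contribute [L_f ^+ 2 * D] with no factor [S_p]; [S_p >= 1] merges it with the random
     contribution. *)
  have : 0 <= (S_p - 1) * (L_f ^+ 2 * D).
    by rewrite mulr_ge0 ?subr_ge0//; nneg.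
  lra.
apply: ge0_le_integral => //.
- by move=> t _; rewrite lee_fin sqr_ge0.
- apply: measurable_lpnorm_sqr; apply: measurable_vecB.
    apply: measurable_vecB; last exact: measurable_vec_cst.
    by apply: measurable_zo_estimator => //; exact: measurable_vec_cst.
  apply: measurable_vecZ; first exact: measurable_cst.
  apply: measurable_vecB; last exact: measurable_vec_cst.
  by apply: measurable_zo_estimator => //; exact: measurable_vec_cst.
- apply/measurable_EFinP; apply: measurable_funD => //; apply: measurable_funM => //.
- move=> t _; rewrite lee_fin -/(zo x t) -/(zo y t) !zoE.
  (* Writing [1 = alpha + (1 - alpha)] in front of the terms at [x] groups what is left with weight
     [1 - alpha] into differences between [x] and [y]; the means follow the same pattern with
     gradients in place of rank-one parts. *)
  have -> : rank1 x t + rem x t - zo_mean x - (1 - alpha) *: (rank1 y t + rem y t - zo_mean y) =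
    (alpha *: rank1 x t + (1 - alpha) *: rank1d t + (rem x t + (- (1 - alpha)) *: rem y t))
    - (alpha *: gradient f x + (1 - alpha) *: (gradient f x - gradient f y)
       + (zo_mean x - gradient f x + (- (1 - alpha)) *: (zo_mean y - gradient f y))).
    by apply/rowP => i; rewrite /rank1d dotvBl !mxE; ring.
  apply: le_trans (lpnorm_sqrB p1 _ _) _.
  have al01 : 0 <= alpha <= 1 by rewrite al0.
  have := lpnorm_sqr_combination p1 (rank1 x t) (rank1d t) (rem x t) (rem y t) al01.
  have := lpnorm_sqr_combination p1 (gradient f x) (gradient f x - gradient f y)
    (zo_mean x - gradient f x) (zo_mean y - gradient f y) al01.
  have := sqr_le2 (rem x t); have := sqr_le2 (rem y t).
  have := le_trans (sqr_le2 _) (zo_bias Xx); have := le_trans (sqr_le2 _) (zo_bias Xy).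
  have : lpnorm p (gradient f x - gradient f y) ^+ 2 <= L_f ^+ 2 * D.
    apply: le_trans (sqr_le2 _) _; rewrite -exprMn lerXn2r ?nnegrE ?lpnorm_ge0 ?f_smooth//.
    by rewrite mulr_ge0 ?lpnorm_ge0// ltW.
  have : alpha ^+ 2 * lpnorm p (gradient f x) ^+ 2 <= alpha ^+ 2 * M_f ^+ 2.
    rewrite ler_wpM2l ?sqr_ge0//; apply: le_trans (sqr_le2 _) _.
    by rewrite lerXn2r ?nnegrE ?lpnorm_ge0 ?f_bound// (le_trans _ (f_bound Xx)) ?lpnorm_ge0.
  rewrite /K; lra.
Qed.

End estimator.

(** * Mirror steps *)

Section lipschitz_topology.
Context {R : realType} {d : nat}.
Implicit Types x y : 'rV[R]_d.

(** Links the sup-norm topology to the p-norms; Lipschitz bounds in any of the latter then give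
    continuity. *)
Lemma ball_lpnorm (p e : R) x y : 1 <= p -> ball x e y -> lpnorm p (x - y) <= d%:R * e.
Proof.
move=> p1 [e0 xy]; apply: le_trans (le_lpnorm (x - y) ltr01 p1) _.
rewrite lpnormE invr1 powRr1 ?sum_powR_ge0//.
rewrite -[d in leRHS]card_ord mulr_natl -sumr_const; apply: ler_sum => i _.
by rewrite powRr1// !mxE; apply: ltW; exact: (xy 0 i).
Qed.

Lemma lipschitz_within (A : set 'rV[R]_d) (f : 'rV[R]_d -> R) (p C : R) : 1 <= p ->
  (forall x y, A x -> A y -> `|f x - f y| <= C * lpnorm p (x - y)) ->
  {within A, continuous f}.
Proof.
move=> p1 fC; apply/subspace_continuousP => x Ax.
apply/cvg_ballP => e e0.
pose r := e / (`|C| * d%:R + 1).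
have C1 : 0 < `|C| * d%:R + 1 by rewrite ltr_wpDl// mulr_ge0.
have r0 : 0 < r by rewrite divr_gt0.
near=> y; rewrite /ball/=.
have Ay : A y by near: y; exact: withinT.
have xy : ball x r y by near: y; apply: cvg_within; exact: nbhsx_ballx.
apply: le_lt_trans (fC _ _ Ax Ay) _.
apply: (@le_lt_trans _ _ (`|C| * (d%:R * r))).
  apply: le_trans (ler_wpM2r (lpnorm_ge0 _ _) (ler_norm C)) _.
  by apply: ler_wpM2l => //; exact: ball_lpnorm.
rewrite (_ : _ * _ = `|C| * d%:R * e / (`|C| * d%:R + 1)); last by rewrite /r !mulrA.
by rewrite ltr_pdivrMr// mulrC ltr_pM2l// ltrDl.
Unshelve. all: by end_near. Qed.

Lemma lipschitz_continuous (f : 'rV[R]_d -> R) (p C : R) : 1 <= p ->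
  (forall x y, `|f x - f y| <= C * lpnorm p (x - y)) -> continuous f.
Proof.
move=> p1 fC; apply/continuous_subspace_setT; apply: (lipschitz_within p1) => x y _ _.
exact: fC.
Qed.

Lemma ler_lpnorm_dist (p : R) x y : 1 < p -> `|lpnorm p x - lpnorm p y| <= lpnorm p (x - y).
Proof.
move=> p1; have p0 : p != 0 by rewrite gt_eqF// (lt_trans _ p1).
rewrite ler_norml; apply/andP; split.
  rewrite lerNl opprB lerBlDr (lpnorm_distC _ _ p0) -{1}(subrK x y).
  exact: ler_lpnormD.
by rewrite lerBlDr -{1}(subrK y x); exact: ler_lpnormD.
Qed.

Lemma lpnorm_continuous (p : R) : 1 < p -> continuous (fun x : 'rV[R]_d => lpnorm p x).
Proof.
move=> p1; apply: (@lipschitz_continuous _ p 1 (ltW p1)) => x y.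
by rewrite mul1r; exact: ler_lpnorm_dist.
Qed.

Lemma addl_continuous (w : 'rV[R]_d) : continuous (fun x : 'rV[R]_d => w + x).
Proof.
move=> x B /nbhs_ballP[e e0 eB]; apply/nbhs_ballP; exists e => // y [_ xy].
apply: eB; split => // i j; rewrite !mxE /ball/= opprD addrACA subrr add0r; exact: xy.
Qed.

Lemma dotv_continuous (w : 'rV[R]_d) : continuous (dotv w).
Proof.
apply: (@lipschitz_continuous _ 2 (lpnorm 2 w)); first by rewrite ler1n.
by move=> x y; rewrite -dotvBr; exact: cauchy_schwarz_dotv.
Qed.

Lemma gradient_coord_cvg (f : 'rV[R]_d -> R) x i : differentiable f x ->
  (k.+1%:R * (f (k.+1%:R^-1 *: delta_mx 0 i + x) - f x)) @[k --> \oo]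
    --> gradient f x 0 i.
Proof.
move=> df; rewrite mxE.
have : (fun h : R => h^-1 *: ((f \o shift x) (h *: delta_mx 0 i) - f x)) @ 0^'
   --> 'D_(delta_mx 0 i) f x.
  exact: (@diff_derivable _ _ _ _ _ (delta_mx 0 i) df).
move=> /cvgr_dnbhsP/(_ (fun k => k.+1%:R^-1)) /= H.
rewrite (_ : (fun k => _) = (fun k =>
    k.+1%:R^-1^-1 *: (f (k.+1%:R^-1 *: delta_mx 0 i + x) - f x))); last first.
  by apply/funext => k; rewrite invrK.
apply: H; split; first by move=> k; rewrite invr_neq0.
exact: cvg_harmonic.
Qed.

Lemma measurable_continuous_comp {dT} {T : measurableType dT} (f : 'rV[R]_d -> R)
    (x : T -> 'rV[R]_d) : continuous f -> measurable_vec x ->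
  measurable_fun setT (fun t => f (x t)).
Proof.
move=> cf mx; apply: (@measurableT_comp _ _ _ _ _ _ (f : borelRV R d -> R) _
  (x : T -> borelRV R d)).
  exact: continuous_measurable_borelRV.
exact: measurable_rV.
Qed.

(** Meant also for [v], of which only differentiability is assumed: the gradient is a limit of
    continuous difference quotients. *)
Lemma measurable_gradient_comp {dT} {T : measurableType dT} (f : 'rV[R]_d -> R)
    (x : T -> 'rV[R]_d) : (forall y, differentiable f y) -> measurable_vec x ->
  measurable_vec (fun t => gradient f (x t)).
Proof.
move=> df mx i.
apply: (@measurable_fun_cvg _ _ _ setT (fun k t =>
    k.+1%:R * (f (k.+1%:R^-1 *: delta_mx 0 i + x t) - f (x t)))); last first.
  by move=> t _; exact: gradient_coord_cvg.
have cf : continuous f by move=> y; exact: differentiable_continuous.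
move=> k; apply: measurable_funM; first exact: measurable_cst.
apply: measurable_funB; apply: measurable_continuous_comp => //.
by apply: measurable_vecD => //; exact: measurable_vec_cst.
Qed.

Lemma continuous_image_closure (f : 'rV[R]_d -> 'rV[R]_d) (A : set 'rV[R]_d) x :
  continuous f -> (forall y, A y -> A (f y)) -> closure A x -> closure A (f x).
Proof.
move=> cf fA Ax B nB; have [y [Ay By]] := Ax _ (cf x _ nB).
by exists (f y); split => //; exact: fA.
Qed.

End lipschitz_topology.

(** * Approximate normal vectors through the tangent cone *)

Section tangent_cone.
Context {R : realType} {d : nat} (X : set 'rV[R]_d) (x : 'rV[R]_d).
Hypothesis X_convex : forall y z (t : R), X y -> X z -> 0 <= t <= 1 ->
  X (t *: y + (1 - t) *: z).
Hypothesis Xx : X x.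

Let cone : set 'rV[R]_d := [set a | exists s y, [/\ 0 <= s, X y & a = s *: (y - x)]].

Let coneD a b : cone a -> cone b -> cone (a + b).
Proof.
move=> [s [y [s0 Xy ->]]] [r [z [r0 Xz ->]]].
have [sr|sr] := eqVneq (s + r) 0.
  have [s00 r00] : s = 0 /\ r = 0 by split; lra.
  by exists 0, x; rewrite s00 r00 !scale0r addr0.
have srp : 0 < s + r by rewrite lt_def sr addr_ge0.
exists (s + r), ((s / (s + r)) *: y + (1 - s / (s + r)) *: z); split.
- exact: ltW.
- apply: X_convex => //; rewrite divr_ge0 ?(ltW srp)//=.
  by rewrite ler_pdivrMr// mul1r lerDl.
- by apply/rowP => i; rewrite !mxE; field.
Qed.

Let coneZ r a : 0 <= r -> cone a -> cone (r *: a).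
Proof.
by move=> r0 [s [y [s0 Xy ->]]]; exists (r * s), y; rewrite scalerA mulr_ge0.
Qed.

Let quadratic_slope (b c : R) : (forall r, 0 <= r <= 1 -> 0 <= 2 * r * b + r ^+ 2 * c) -> 0 <= b.
Proof.
move=> H; rewrite leNgt; apply/negP => b0.
have c0 : 0 < c by have := H 1; rewrite lexx ler01 => /(_ isT); lra.
(* For this [r] the quadratic equals [r * b * (1 + r)], which is negative when [b < 0]. *)
pose r := - b / (c - b).
have cb : 0 < c - b by lra.
have rc : r * (c - b) = - b by rewrite /r divfK// gt_eqF.
have r0 : 0 < r by rewrite divr_gt0// oppr_gt0.
have r1 : r <= 1 by rewrite ler_pdivrMr// mul1r; lra.
have := H r; rewrite (ltW r0) r1 => /(_ isT).
nra.
Qed.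

(* Moreau decomposition of [- w] along the closed tangent cone at [x]; its
   normal part is [- w - t]. *)
Lemma normal_cone_approx (w : 'rV[R]_d) (L : R) : 0 <= L ->
  (forall y, X y -> 0 <= dotv w (y - x) + L * lpnorm 2 (y - x)) ->
  exists t, lpnorm 2 t <= L /\ normal_cone X x (- w - t).
Proof.
move=> L0 wL.
have cone0 : cone 0 by exists 0, x; rewrite scale0r.
pose psi t := lpnorm 2 (w + t).
have n12 : 1 < 2 :> R by rewrite ltr1n.
have cpsi : continuous psi.
  move=> t; apply: (@cvg_comp _ _ _ (fun t => w + t) (fun t => lpnorm 2 t) _ (nbhs (w + t))).
    exact: addl_continuous.
  exact: lpnorm_continuous.
(* The cone is unbounded; the sublevel set through 0 makes the minimization compact without losing
   the minimizer. *)
pose K := closure cone `&` [set t | psi t <= lpnorm 2 w].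
have psi0 : psi 0 = lpnorm 2 w by rewrite /psi addr0.
have K0 : K 0 by split; [exact: subset_closure|rewrite /= psi0].
have Kc : compact K.
  apply: bounded_closed_compact.
    exists (2 * lpnorm 2 w); split; first exact: num_real.
    move=> B wB t [_ /= tw]; rewrite -[leLHS]/(mx_norm t).
    have B0 : 0 <= B by apply: le_trans (ltW wB); rewrite mulr_ge0 ?lpnorm_ge0.
    rewrite mx_normrE; apply: bigmax_le => // -[i j] _ /=.
    rewrite (ord1 i); apply: le_trans (le_coord_lpnorm t j (lt_trans ltr01 n12)) _.
    apply: le_trans (ltW wB); rewrite -(addKr w t) addrC.
    apply: le_trans (ler_lpnormB _ _ n12) _.
    by move: tw; rewrite /psi; set a := lpnorm 2 (w + t); set b := lpnorm 2 w; lra.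
  apply: closedI; first exact: closed_closure.
  exact: (closed_comp (fun t _ => cpsi t) (@closed_le R (lpnorm 2 w))).
have [t] := EVT_min_rV (ex_intro _ 0 K0) Kc (continuous_subspaceT cpsi).
rewrite inE => -[Tt wt] tmin.
have tmin' z : closure cone z -> psi t <= psi z.
  move=> Tz; have [zw|/ltW wz] := leP (psi z) (lpnorm 2 w); last exact: le_trans wz.
  by apply: tmin; rewrite inE.
have slope z : (forall r : R, 0 <= r <= 1 -> closure cone (t + r *: z)) -> 0 <= dotv (w + t) z.
  move=> Hz; apply: (@quadratic_slope _ (lpnorm 2 z ^+ 2)) => r r01.
  have := tmin' _ (Hz r r01); rewrite /psi => H.
  have : lpnorm 2 (w + t) ^+ 2 <= lpnorm 2 (w + (t + r *: z)) ^+ 2.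
    by rewrite lerXn2r ?nnegrE ?lpnorm_ge0.
  rewrite !lpnorm2_sqr addrA; move: (w + t) => a.
  by rewrite dotvDl !dotvDr !dotvZl !dotvZr (dotvC z a); lra.
have scal (r : R) : continuous (fun a : 'rV[R]_d => r *: a) by exact: scaler_continuous.
(* The cone contains [(1 - r) *: t], so [- t] is an admissible direction. Hence
   [|t|^2 <= - dotv w t], which the next bound turns into [|t|^2 <= L |t|]. *)
have tL : dotv (w + t) t <= 0.
  rewrite -oppr_ge0 -dotvNr; apply: slope => r /andP[r0 r1].
  rewrite scalerN -{1}(scale1r t) -scalerBl.
  apply: (continuous_image_closure (scal (1 - r))) => // y.
  by apply: coneZ; rewrite subr_ge0.
(* The hypothesis concerns differences [y - x]; it passes to the cone by homogeneity and to its
   closure by continuity. *)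
have wt_lb : 0 <= dotv w t + L * lpnorm 2 t.
  rewrite leNgt; apply/negP => neg.
  pose th a := dotv w a + L * lpnorm 2 a.
  have cth : continuous th.
    apply: (@lipschitz_continuous _ _ _ 2 (lpnorm 2 w + L)) => [|a b]; first exact: ltW.
    rewrite /th opprD addrACA -dotvBr -mulrBr mulrDl.
    apply: le_trans (ler_normD _ _) _; apply: lerD; first exact: cauchy_schwarz_dotv.
    by rewrite normrM (ger0_norm L0) ler_wpM2l//; exact: ler_lpnorm_dist.
  have [a [[s [y [s0 Xy ->]]] /=]] := Tt _ (cvgr_lt _ (cth t) _ neg).
  rewrite /th dotvZr lpnormZ// ger0_norm// => H.
  have := mulr_ge0 s0 (wL _ Xy); rewrite mulrDr mulrCA; lra.
exists t; split.
  have [->|t0] := eqVneq (lpnorm 2 t) 0; first by [].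
  rewrite -(@ler_pM2r _ (lpnorm 2 t)) ?lt_def ?t0 ?lpnorm_ge0// -expr2 lpnorm2_sqr.
  by move: tL; rewrite dotvDl; lra.
split=> // y Xy; rewrite -opprD dotvNl oppr_le0; apply: slope => r /andP[r0 r1].
rewrite addrC; apply: (@continuous_image_closure _ _ (fun a => r *: (y - x) + a)) => //.
  exact: addl_continuous.
move=> a; apply: coneD; apply: coneZ => //.
by exists 1, y; rewrite scale1r.
Qed.

End tangent_cone.

Lemma continuousD_fun {R : realType} {T : topologicalType} (f g : T -> R) :
  continuous f -> continuous g -> continuous (fun t => f t + g t).
Proof. by move=> cf cg t; apply: cvgD; [exact: cf|exact: cg]. Qed.

Lemma continuousC_fun {R : realType} {T : topologicalType} (a : R) :
  continuous (fun _ : T => a).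
Proof. by move=> t; exact: cvg_cst. Qed.

Lemma continuousZ_fun {R : realType} {T : topologicalType} (a : R) (f : T -> R) :
  continuous f -> continuous (fun t => a * f t).
Proof. by move=> cf t; apply: cvgM; [exact: cvg_cst|exact: cf]. Qed.

Lemma derive_at_right_ge {R : realType} (f : R -> R) (D b : R) : is_derive (0 : R) 1 f D ->
  (forall t, 0 < t <= 1 -> b * t <= f t - f 0) -> b <= D.
Proof.
move=> /is_derive1_caratheodory[g [fg cg g0]] H; rewrite leNgt; apply/negP => Db.
have bD : 0 < b - D by rewrite subr_gt0.
have /nbhs_ballP[e /= e0 He] : nbhs (0 : R) [set t | g t < b].
  by apply: (cvgr_lt _ cg); rewrite g0.
pose t := Num.min 1 (e / 2).
have t0 : 0 < t by rewrite lt_min ltr01 divr_gt0.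
have t1 : t <= 1 by rewrite ge_min lexx.
have gt : g t < b.
  apply: He; rewrite /ball/= sub0r normrN gtr0_norm//.
  apply: (@le_lt_trans _ _ (e / 2)); first by rewrite ge_min lexx orbT.
  by rewrite ltr_pdivrMr// ltr_pMr// ltr1n.
have := H t; rewrite t0 t1 fg subr0 ler_pM2r// => /(_ isT).
by rewrite leNgt gt.
Qed.

Section mirror_step_theory.
Context {R : realType} {d : nat}.
Variables (X : set 'rV[R]_d) (h : 'rV[R]_d -> \bar R) (v : 'rV[R]_d -> R).
Variables (p q eta D_X M_h : R).
Hypothesis X_nonempty : X !=set0.
Hypothesis X_closed : closed X.
Hypothesis X_convex : forall y z (t : R), X y -> X z -> 0 <= t <= 1 ->
  X (t *: y + (1 - t) *: z).
Hypothesis X_bounded : forall x, X x -> lpnorm q x <= D_X.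
Let hr x := fine (h x).
Hypothesis h_fin : forall x, X x -> h x = (hr x)%:E.
Hypothesis h_lip : forall x y, X x -> X y -> hr x - hr y <= M_h * lpnorm 2 (x - y).
Hypothesis h_convex : forall x y (t : R), X x -> X y -> 0 <= t <= 1 ->
  hr (t *: x + (1 - t) *: y) <= t * hr x + (1 - t) * hr y.
Hypothesis v_diff : forall x, differentiable v x.
Hypothesis v_strong : forall x y,
  lpnorm q (x - y) ^+ 2 <= dotv (x - y) (gradient v x - gradient v y).
Hypothesis eta0 : 0 < eta.
Hypotheses (p0 : 0 < p) (q1 : 1 < q) (pq : p^-1 + q^-1 = 1).

Let q0 : 0 < q. Proof. exact: lt_trans q1. Qed.

(** Bounded subgradients make [h] Lipschitz on [X], so the objective is continuous on a compact set
    and [get] returns an actual minimizer. *)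
Lemma mirror_step_argmin g x : argmin_on X
  (fun y => (dotv g y)%:E + h y + (eta^-1 * bregman v x y)%:E)%E
  (mirror_step X h v eta g x).
Proof.
apply: getPex.
pose psi y := hr y + (dotv (g - eta^-1 *: gradient v x) y
  + (eta^-1 * v y + eta^-1 * (dotv (gradient v x) x - v x))).
have cv : continuous v by move=> y; exact: differentiable_continuous.
have cpsi : {within X, continuous psi}.
  apply: continuousD_fun.
    apply: (@lipschitz_within _ _ _ _ 2 M_h); first by rewrite ler1n.
    move=> y z Xy Xz; rewrite ler_norml h_lip// andbT lerNl opprB (@lpnorm_distC _ _ 2)//.
    exact: h_lip.
  apply: continuous_subspaceT; apply: continuousD_fun; first exact: dotv_continuous.
  apply: continuousD_fun; first exact: continuousZ_fun.
  exact: continuousC_fun.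
have Xc : compact X.
  apply: bounded_closed_compact => //; exists D_X; split; first exact: num_real.
  move=> B DB y Xy; change (mx_norm y <= B).
  have B0 : 0 <= B.
    by apply: le_trans (ltW DB); apply: le_trans (X_bounded Xy); exact: lpnorm_ge0.
  rewrite mx_normrE; apply: bigmax_le => // -[i j] _ /=.
  rewrite (ord1 i); apply: le_trans (le_coord_lpnorm y j q0) _.
  exact: le_trans (X_bounded Xy) (ltW DB).
have [y] := EVT_min_rV X_nonempty Xc cpsi.
rewrite inE => Xy ymin; exists y; split => // z Xz.
have E w : X w -> ((dotv g w)%:E + h w + (eta^-1 * bregman v x w)%:E = (psi w)%:E)%E.
  move=> Xw; rewrite (h_fin Xw) -!EFinD; congr EFin.
  by rewrite /psi /bregman dotvBl dotvBr dotvZl; ring.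
by rewrite !E// lee_fin; apply: ymin; rewrite inE.
Qed.

Lemma mirror_step_in g x : X (mirror_step X h v eta g x).
Proof. by have [] := mirror_step_argmin g x. Qed.

(** The minimizer [y] is compared with [y + t (z - y)]. Convexity bounds the change of [h] by
    [t (h z - h y)], so only [v] is differentiated, from the right at [t = 0]. *)
Lemma mirror_step_optimal g x z : X z ->
  let y := mirror_step X h v eta g x in
  0 <= dotv (g + eta^-1 *: (gradient v y - gradient v x)) (z - y) + (hr z - hr y).
Proof.
move=> Xz /=; have [Xy ymin] := mirror_step_argmin g x.
move: Xy ymin; set y := mirror_step _ _ _ _ _ _ => Xy ymin.
pose b := - eta * (dotv g (z - y) + (hr z - hr y) - eta^-1 * dotv (gradient v x) (z - y)).
have dv : is_derive (0 : R) 1 (fun t : R => v (y + t *: (z - y))) (dotv (gradient v y) (z - y)).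
  have := @is_derive_line R d v y (z - y) 0 (v_diff _).
  by rewrite scale0r addr0.
have := derive_at_right_ge (b := b) dv.
have H : forall t, 0 < t <= 1 -> b * t <= v (y + t *: (z - y)) - v (y + 0 *: (z - y)).
  move=> t /andP[t0 t1]; rewrite scale0r addr0.
  have t01 : 0 <= t <= 1 by rewrite (ltW t0).
  have E : y + t *: (z - y) = t *: z + (1 - t) *: y by apply/rowP => i; rewrite !mxE; ring.
  have Xt : X (y + t *: (z - y)) by rewrite E; exact: X_convex.
  have := ymin _ Xt; rewrite (h_fin Xy) (h_fin Xt) -!EFinD lee_fin.
  have := h_convex Xz Xy t01; rewrite -E.
  rewrite /bregman !dotvDr !dotvZr !dotvBr !dotvNr /b !dotvBr.
  set hyt := hr (y + _); set vyt := v (y + _).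
  set gz := dotv g z; set gy := dotv g y.
  set a1 := dotv _ z; set a2 := dotv _ y; set a3 := dotv _ x.
  move=> hh mm.
  have mm' : eta * (gy + hr y + eta^-1 * (v y - v x - (a2 - a3))) <=
     eta * (gy + t * (gz - gy) + hyt + eta^-1 * (vyt - v x - (a2 + t * (a1 - a2) - a3))).
    by rewrite ler_pM2l.
  have hh' : eta * hyt <= eta * (t * hr z + (1 - t) * hr y) by rewrite ler_pM2l.
  have K (r s : R) : eta * (r + eta^-1 * s) = eta * r + s by field; rewrite gt_eqF.
  rewrite !K in mm'.
  have -> : - eta * (gz - gy + (hr z - hr y) - eta^-1 * (a1 - a2)) * t =
    - eta * (gz - gy + (hr z - hr y)) * t + (a1 - a2) * t by field; rewrite gt_eqF.
  nra.
move=> /(_ H) bD.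
have : 0 <= eta^-1 * (dotv (gradient v y) (z - y) - b) by apply: mulr_ge0; rewrite ?invr_ge0 ?subr_ge0// ltW.
rewrite dotvDl dotvZl dotvBl; set A := dotv g _; set B := dotv _ (z - y); set C := dotv _ (z - y).
have -> : eta^-1 * (B - b) = A + (hr z - hr y) + eta^-1 * (B - C).
  by rewrite /b -/A -/C; field; rewrite gt_eqF.
lra.
Qed.

(** Each optimality condition is tested at the other minimizer; in the sum [h] cancels, strong
    monotonicity of the gradient of [v] bounds one side below and Hoelder the other above. The step
    therefore depends on [g] and [x] only through [eta *: g - gradient v x]. *)
Lemma mirror_step_lip g1 g2 x1 x2 :
  lpnorm q (mirror_step X h v eta g1 x1 - mirror_step X h v eta g2 x2) <=
  lpnorm p ((eta *: g1 - gradient v x1) - (eta *: g2 - gradient v x2)).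
Proof.
set y1 := mirror_step _ _ _ _ g1 x1; set y2 := mirror_step _ _ _ _ g2 x2.
pose w := (eta *: g1 - gradient v x1) - (eta *: g2 - gradient v x2).
rewrite -/w.
have H1 := mirror_step_optimal g1 x1 (mirror_step_in g2 x2).
have H2 := mirror_step_optimal g2 x2 (mirror_step_in g1 x1).
rewrite /= -/y1 -/y2 in H1 H2; clearbody y1 y2.
have [->|n0] := eqVneq (lpnorm q (y1 - y2)) 0; first exact: lpnorm_ge0.
rewrite -(@ler_pM2r _ (lpnorm q (y1 - y2))) ?lt_def ?n0 ?lpnorm_ge0// -expr2.
apply: le_trans (v_strong _ _) _.
apply: le_trans (hoelder_dotv w (y1 - y2) p0 q0 pq).
rewrite -normrN; apply: le_trans (ler_norm _).
have := addr_ge0 H1 H2; rewrite /w.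
rewrite -(opprB y1 y2) (dotvC (y1 - y2) (_ - _)).
move: (y1 - y2) (gradient v y1) (gradient v y2) (gradient v x1) (gradient v x2) => e {n0 H1 H2} a1 a2 b1 b2.
rewrite !(dotvNr, dotvDl, dotvNl, dotvZl).
move: (dotv g1 e) (dotv g2 e) (dotv a1 e) (dotv a2 e) (dotv b1 e) (dotv b2 e) => d1 d2 {}a1 {}a2 {}b1 {}b2.
move=> H; have := mulr_ge0 (ltW eta0) H.
have -> : eta * (- d1 - eta^-1 * (a1 - b1) + (hr y2 - hr y1) + (d2 + eta^-1 * (a2 - b2) + (hr y1 - hr y2)))
  = - eta * d1 - (a1 - b1) + eta * d2 + (a2 - b2) by field; rewrite gt_eqF.
lra.
Qed.

Lemma measurable_mirror_step {dT} {T : measurableType dT} (g x : T -> 'rV[R]_d) :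
  measurable_vec g -> measurable_vec x ->
  measurable_vec (fun t => mirror_step X h v eta (g t) (x t)).
Proof.
move=> mg mx i.
(* The step as a function of the dual variable alone, realized from the base point 0. It is
   Lipschitz, hence measurable, even though [get] is an abstract choice. *)
pose Psi w := mirror_step X h v eta (eta^-1 *: (w + gradient v 0)) 0.
have PsiE w : eta *: (eta^-1 *: (w + gradient v 0)) - gradient v 0 = w.
  by rewrite scalerA mulfV ?gt_eqF// scale1r addrK.
have E t : mirror_step X h v eta (g t) (x t) = Psi (eta *: g t - gradient v (x t)).
  apply/eqP; rewrite -subr_eq0; apply/eqP; apply: (lpnorm_eq0 q0); apply/eqP.
  rewrite eq_le lpnorm_ge0 andbT; apply: le_trans (mirror_step_lip _ _ _ _) _.
  by rewrite PsiE subrr lpnorm0// gt_eqF.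
rewrite (_ : (fun t => _) = (fun t => Psi (eta *: g t - gradient v (x t)) 0 i)); last first.
  by apply/funext => t; rewrite E.
apply: (@measurable_continuous_comp _ _ _ _ (fun w => Psi w 0 i)).
  have p1 : 1 <= p.
    have : p^-1 <= 1 by rewrite -pq lerDl invr_ge0 ltW.
    by rewrite invf_ple ?posrE// invr1.
  apply: (@lipschitz_continuous _ _ _ p 1) => // a b; rewrite mul1r.
  rewrite -[X in lpnorm p (X - _)](PsiE a) -[X in lpnorm p (_ - X)](PsiE b).
  apply: le_trans (mirror_step_lip _ _ _ _); apply: le_trans (le_coord_lpnorm _ i q0).
  by rewrite !mxE.
apply: measurable_vecB; last exact: measurable_gradient_comp.
by apply: measurable_vecZ => //; exact: measurable_cst.
Qed.

End mirror_step_theory.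

(** * Inequalities along one iteration *)

Lemma abs_increment_le {R : realType} (f df : R -> R) (M : R) :
  (forall t : R, 0 <= t <= 1 -> is_derive t 1 f (df t)) ->
  (forall t : R, 0 <= t <= 1 -> `|df t| <= M) -> `|f 1 - f 0| <= M.
Proof.
move=> fdf dfM.
have [|||c /andP[c0 c1]] := @MVT_segment R f df 0 1.
- exact: ler01.
- by move=> t; rewrite in_itv/= => /andP[t0 t1]; apply: fdf; rewrite !ltW.
- apply: derivable_within_continuous => t; rewrite in_itv/= => t01.
  by have [] := fdf t t01.
- by rewrite !bnd_simp in c0 c1; rewrite subr0 mulr1 => ->; apply: dfM; rewrite c0.
Qed.

(** Differentiate along the gradient, scaled to stay in the open set [U]: the derivative is a
    multiple of [|g|^2] while the Lipschitz bound gives the same multiple of [M |g|]. This turns the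
    Lipschitz constant on [Onu] into a gradient bound on [X]. *)
Lemma lpnorm2_gradient_le {R : realType} {d} (f : 'rV[R]_d -> R) (U : set 'rV[R]_d)
    (M : R) (x : 'rV[R]_d) : 0 <= M -> open U -> U x -> differentiable f x ->
  (forall y, U y -> `|f y - f x| <= M * lpnorm 2 (y - x)) ->
  lpnorm 2 (gradient f x) <= M.
Proof.
move=> M0 oU Ux dfx fM; set g := gradient f x.
have [e0 He] : exists r : R, 0 < r /\ forall t, 0 <= t <= 1 -> U (x + t *: (r *: g)).
  have : nbhs (0 : R) [set t | U (x + t *: g)].
    have := @continuous_line R d x g 0; rewrite /continuous_at scale0r addr0; apply.
    exact: open_nbhs_nbhs.
  move=> /nbhs_ballP[e /= e0 He]; exists (e / 2); split; first by rewrite divr_gt0.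
  move=> t /andP[t0 t1]; rewrite scalerA; apply: He.
  have h0 : 0 < e / 2 by rewrite divr_gt0.
  rewrite /ball/= sub0r normrN ger0_norm ?mulr_ge0// ?ltW//.
  apply: (@le_lt_trans _ _ (e / 2)); first by rewrite ler_piMl// ltW.
  by rewrite ltr_pdivrMr// ltr_pMr// ltr1n.
case: He => r0 He.
have d1 : is_derive (0 : R) 1 (fun t : R => f (x + t *: (e0 *: g))) (dotv g (e0 *: g)).
  have := @is_derive_line R d f x (e0 *: g) 0; rewrite scale0r addr0; exact.
have := derive_at_right_ge (b := - (M * lpnorm 2 (e0 *: g))) (is_deriveN d1).
have E t : 0 < t <= 1 -> - (M * lpnorm 2 (e0 *: g)) * t <=
    - f (x + t *: (e0 *: g)) - - f (x + 0 *: (e0 *: g)).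
  move=> /andP[t0 t1]; rewrite scale0r addr0.
  have := fM _ (He t _); rewrite (ltW t0) t1 => /(_ isT).
  rewrite (addrC x) addrK [lpnorm 2 (t *: _)]lpnormZ// (gtr0_norm t0) => /ler_normlP[_].
  set a := lpnorm _ _; nra.
move=> /(_ E); rewrite lerN2 dotvZr -lpnorm2_sqr lpnormZ// gtr0_norm//.
rewrite (mulrCA M) ler_pM2l// expr2.
have [->|n0] := eqVneq (lpnorm 2 g) 0; first by [].
by rewrite ler_pM2r// lt_def n0 lpnorm_ge0.
Qed.

Section regularizer.
Context {R : realType} {d : nat}.
Variables (X : set 'rV[R]_d) (h : 'rV[R]_d -> \bar R) (M_h : R).
Hypothesis h_gtNy : forall x, (-oo < h x)%E.
Hypothesis h_proper : proper_on X h.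
Hypothesis h_convex : convex_efun h.
Hypothesis h_subdiff : forall x, X x -> subdifferential h x !=set0.
Hypothesis h_bound : forall x g, X x -> subdifferential h x g -> pnorm 2 g <= M_h.

(** A subgradient at [x], evaluated at a point where [h] is below +oo, bounds [h x] from above. *)
Lemma subdiff_fin x : X x -> h x = (fine (h x))%:E.
Proof.
move=> Xx; rewrite fineK// fin_numElt h_gtNy /=.
have [[x0 _ h0] _] := h_proper; have [g /(_ x0) Hg] := h_subdiff Xx.
by case: (h x) Hg => [r|//|] Hg; rewrite ?ltry//; move: (le_lt_trans Hg h0).
Qed.

Lemma subdiff_lipschitz x y : X x -> X y ->
  fine (h x) - fine (h y) <= M_h * lpnorm 2 (x - y).
Proof.
move=> Xx Xy; have [g Hg] := h_subdiff Xx.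
have := Hg y; rewrite (subdiff_fin Xx) (subdiff_fin Xy) -EFinD lee_fin => H.
have Mg := h_bound Xx Hg; rewrite pnormE in Mg.
have : dotv g (x - y) <= M_h * lpnorm 2 (x - y).
  apply: le_trans (ler_norm _) _; apply: le_trans (cauchy_schwarz_dotv _ _) _.
  by apply: ler_wpM2r => //; exact: lpnorm_ge0.
by rewrite -(opprB y x) dotvNr; lra.
Qed.

Lemma subdiff_convex (x y : 'rV[R]_d) (t : R) : X x -> X y -> 
  X (t *: x + (1 - t) *: y) -> 0 <= t <= 1 ->
  fine (h (t *: x + (1 - t) *: y)) <= t * fine (h x) + (1 - t) * fine (h y).
Proof.
move=> Xx Xy Xt t01; have := h_convex x y t01.
by rewrite (subdiff_fin Xx) (subdiff_fin Xy) (subdiff_fin Xt).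
Qed.

End regularizer.

Section linear_jacobian.
Context {R : realType} {d m : nat} (c : 'rV[R]_d -> 'rV[R]_m).

Lemma dotv_jacT x l y : dotv (jacT c x l) y = \sum_i l 0 i * dotv (gradient (fun y => c y 0 i) x) y.
Proof.
rewrite /dotv; under [RHS]eq_bigr do rewrite mulr_sumr.
rewrite exchange_big/=; apply: eq_bigr => j _.
rewrite summxE mulr_suml; apply: eq_bigr => i _.
by rewrite mxE mulrA.
Qed.

Lemma jacTD x a b : jacT c x (a + b) = jacT c x a + jacT c x b.
Proof. by rewrite /jacT -big_split; apply: eq_bigr => i _; rewrite mxE scalerDl. Qed.

Lemma jacTZ x t a : jacT c x (t *: a) = t *: jacT c x a.
Proof. by rewrite /jacT scaler_sumr; apply: eq_bigr => i _; rewrite mxE scalerA. Qed.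

Lemma lpnorm_jacT x (l : 'rV[R]_m) b M : (forall i, `|l 0 i| <= b) ->
  (forall i, lpnorm 2 (gradient (fun y => c y 0 i) x) <= M) ->
  lpnorm 2 (jacT c x l) <= m%:R * (b * M).
Proof.
move=> lb gM; apply: le_trans (ler_lpnorm_sum _ _ _) _; first by rewrite ltr1n.
apply: le_trans (_ : _ <= \sum_(i < m) (b * M)) _; last first.
  by rewrite sumr_const card_ord mulr_natl.
by apply: ler_sum => i _; rewrite lpnormZ//; apply: ler_pM => //; exact: lpnorm_ge0.
Qed.

End linear_jacobian.
Lemma is_derive_comb {R : realType} (f g : R -> R) (df dg t a b : R) :
  is_derive t 1 f df -> is_derive t 1 g dg ->
  is_derive t 1 (fun s => a * f s + b * g s) (a * df + b * dg).
Proof. by move=> Hf Hg; apply: is_deriveD; exact: is_deriveZ. Qed.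

Section step_inequalities.
Context {R : realType} {d m : nat}.
Variables (X : set 'rV[R]_d) (f v : 'rV[R]_d -> R) (h : 'rV[R]_d -> \bar R)
  (c : 'rV[R]_d -> 'rV[R]_m).
Variables (p q eta mu beta rho D_X L_v L_f M_f M_h M_c B L_c : R).
Hypothesis X_nonempty : X !=set0.
Hypothesis X_closed : closed X.
Hypothesis X_convex : forall y z (t : R), X y -> X z -> 0 <= t <= 1 ->
  X (t *: y + (1 - t) *: z).
Hypothesis X_bounded : forall x, X x -> lpnorm q x <= D_X.
Let hr x := fine (h x).
Hypothesis h_fin : forall x, X x -> h x = (hr x)%:E.
Hypothesis h_lip : forall x y, X x -> X y -> hr x - hr y <= M_h * lpnorm 2 (x - y).
Hypothesis h_convex : forall x y (t : R), X x -> X y -> 0 <= t <= 1 ->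
  hr (t *: x + (1 - t) *: y) <= t * hr x + (1 - t) * hr y.
Hypothesis v_diff : forall x, differentiable v x.
Hypothesis v_strong : forall x y,
  lpnorm q (x - y) ^+ 2 <= dotv (x - y) (gradient v x - gradient v y).
Hypothesis v_smooth : forall x y, X x -> X y ->
  lpnorm p (gradient v x - gradient v y) <= L_v * lpnorm q (x - y).
Hypothesis f_diff : forall x, differentiable f x.
Hypothesis f_bound : forall x, X x -> lpnorm 2 (gradient f x) <= M_f.
Hypothesis f_smooth : forall x y, X x -> X y ->
  lpnorm 2 (gradient f x - gradient f y) <= L_f * lpnorm 2 (x - y).
Local Notation ci i := (fun y => c y 0 i).
Hypothesis c_diff : forall i x, differentiable (ci i) x.
Hypothesis c_bound : forall i x, X x -> `|c x 0 i| <= B.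
Hypothesis c_grad : forall i x, X x -> lpnorm 2 (gradient (ci i) x) <= M_c.
Hypothesis c_smooth : forall i x y, X x -> X y ->
  lpnorm 2 (gradient (ci i) x - gradient (ci i) y) <= L_c * lpnorm 2 (x - y).
Hypotheses (p2 : 2 <= p) (q1 : 1 < q) (q2 : q <= 2) (pq : p^-1 + q^-1 = 1).
Hypotheses (eta0 : 0 < eta) (mu0 : 0 < mu) (beta0 : 0 < beta) (rho0 : 0 < rho).
Hypotheses (M_h0 : 0 <= M_h) (M_c0 : 0 <= M_c) (B0 : 0 <= B).
Let Lmu := L_const m L_f M_c B L_c rho mu.
Hypothesis eta_small : Lmu * eta <= 1 / 2.

Let p0 : 0 < p. Proof. by apply: lt_le_trans p2. Qed.
Let p1 : 1 < p. Proof. by apply: lt_le_trans p2; rewrite ltr1n. Qed.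
Let q0 : 0 < q. Proof. exact: lt_trans q1. Qed.
Let pn0 : p != 0. Proof. by rewrite gt_eqF. Qed.
Let qn0 : q != 0. Proof. by rewrite gt_eqF. Qed.

Let line_in x y (t : R) : X x -> X y -> 0 <= t <= 1 -> X (x + t *: (y - x)).
Proof.
move=> Xx Xy t01; rewrite (_ : x + _ = t *: y + (1 - t) *: x); first exact: X_convex.
by apply/rowP => i; rewrite !mxE; ring.
Qed.

Lemma c_lipschitz i x y : X x -> X y -> `|c x 0 i - c y 0 i| <= M_c * lpnorm 2 (x - y).
Proof.
move=> Xx Xy.
have := @abs_increment_le R (fun t => c (y + t *: (x - y)) 0 i)
  (fun t => dotv (gradient (ci i) (y + t *: (x - y))) (x - y)) (M_c * lpnorm 2 (x - y)).
rewrite /= scale1r scale0r addr0 (addrC y) subrK; apply.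
  by move=> t _; exact: is_derive_line (c_diff i _).
move=> t t01; apply: le_trans (cauchy_schwarz_dotv _ _) _.
by apply: ler_wpM2r; [exact: lpnorm_ge0|apply: c_grad; exact: line_in].
Qed.

(** A product rule for each constraint: coefficients are bounded by [(rho + mu) B] and vary at rate
    [mu M_c]. The multiplier bound [rho * B] is the one that a run maintains. *)
Lemma jacT_lipschitz x y (l : 'rV[R]_m) : X x -> X y -> (forall i, `|l 0 i| <= rho * B) ->
  lpnorm 2 (jacT c y (l + mu *: c y) - jacT c x (l + mu *: c x)) <=
  (Lmu - L_f) * lpnorm 2 (y - x).
Proof.
move=> Xx Xy lb.
rewrite /jacT -sumrB; apply: le_trans (ler_lpnorm_sum _ _ _) _; first by rewrite ltr1n.
apply: le_trans (_ : _ <= \sum_(i < m) (mu * M_c ^+ 2 + mu * B * L_c + rho * B * L_c) * lpnorm 2 (y - x)) _;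
    last first.
  by rewrite sumr_const card_ord -[leLHS]mulr_natl mulrA /Lmu /L_const (addrC L_f) addrK.
apply: ler_sum => i _.
have -> : (l + mu *: c y) 0 i *: gradient (ci i) y - (l + mu *: c x) 0 i *: gradient (ci i) x =
   (l 0 i + mu * c y 0 i) *: (gradient (ci i) y - gradient (ci i) x) +
   (mu * (c y 0 i - c x 0 i)) *: gradient (ci i) x.
  by apply/rowP => j; rewrite !mxE; ring.
apply: le_trans (ler_lpnormD _ _ _) _; first by rewrite ltr1n.
rewrite !lpnormZ// normrM (gtr0_norm mu0).
have H1 : `|l 0 i + mu * c y 0 i| <= rho * B + mu * B.
  apply: le_trans (ler_normD _ _) _; apply: lerD => //.
  by rewrite normrM (gtr0_norm mu0) ler_pM2l//; exact: c_bound.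
have := c_lipschitz i Xy Xx; have := c_smooth i Xy Xx; have := c_grad i Xx.
have := lpnorm_ge0 2 (gradient (ci i) x).
have := lpnorm_ge0 2 (gradient (ci i) y - gradient (ci i) x).
have := lpnorm_ge0 2 (y - x); move: H1 (normr_ge0 (l 0 i + mu * c y 0 i)) (normr_ge0 (c y 0 i - c x 0 i)).
move: `|_| `|_| (lpnorm _ _) (lpnorm _ _) (lpnorm _ _) => a b n1 n2 n3 H1 a0 b0 n10 n20 n30 H2 H3 H4.
apply: le_trans (_ : (rho * B + mu * B) * (L_c * n3) + mu * (M_c * n3) * M_c <= _); last by rewrite le_eqVlt; apply/orP; left; apply/eqP; ring.
apply: lerD; first by apply: ler_pM.
by apply: ler_pM => //; [apply: mulr_ge0 => //; exact: ltW|rewrite ler_pM2l].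
Qed.

(** Smooth part of the augmented Lagrangian, without [h]; [gA] is its gradient in [x]. *)
Let A (l : 'rV[R]_m) x := f x + (dotv l (c x) + mu / 2 * lpnorm 2 (c x) ^+ 2).
Let gA (l : 'rV[R]_m) x := gradient f x + jacT c x (l + mu *: c x).

Lemma gradient_lagrangian_lip x y (l : 'rV[R]_m) : X x -> X y -> (forall i, `|l 0 i| <= rho * B) ->
  lpnorm 2 (gA l y - gA l x) <= Lmu * lpnorm 2 (y - x).
Proof.
move=> Xx Xy lb; rewrite /gA opprD addrACA; apply: le_trans (ler_lpnormD _ _ _) _; first by rewrite ltr1n.
have := jacT_lipschitz Xx Xy lb; have := f_smooth Xy Xx; rewrite mulrBl; lra.
Qed.

Lemma is_derive_lagrangian (l : 'rV[R]_m) (x y : 'rV[R]_d) (t : R) :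
  is_derive t 1 (fun t : R => A l (x + t *: y)) (dotv (gA l (x + t *: y)) y).
Proof.
have E : (fun t : R => A l (x + t *: y)) = (fun t : R => f (x + t *: y)) +
  (fun t => \sum_i (l 0 i * c (x + t *: y) 0 i + mu / 2 * (c (x + t *: y) 0 i * c (x + t *: y) 0 i))).
  apply/funext => s; rewrite /A lpnorm2_sqr /dotv mulr_sumr -big_split//.
rewrite E dotvDl dotv_jacT; apply: is_deriveD; first exact: is_derive_line (f_diff _).
apply: is_derive_sum_fun => i.
have dc : is_derive t 1 (fun s : R => c (x + s *: y) 0 i)
    (dotv (gradient (ci i) (x + t *: y)) y) by exact: is_derive_line (c_diff i _).
have H := is_derive_comb (l 0 i) (mu / 2) dc (is_deriveM_fun dc dc).
by apply: (is_derive_eq H); rewrite !mxE; field.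
Qed.

Lemma lagrangian_smooth x y (l : 'rV[R]_m) : X x -> X y -> (forall i, `|l 0 i| <= rho * B) ->
  A l y <= A l x + dotv (gA l x) (y - x) + Lmu / 2 * lpnorm 2 (y - x) ^+ 2.
Proof.
move=> Xx Xy lb.
have := @taylor_upper R (fun t => A l (x + t *: (y - x)))
  (fun t => dotv (gA l (x + t *: (y - x))) (y - x)) (Lmu * lpnorm 2 (y - x) ^+ 2).
rewrite /= scale1r scale0r addr0 (addrC x) subrK mulrAC; apply.
  by move=> t _; exact: is_derive_lagrangian.
move=> t t01; rewrite -dotvBl; apply: le_trans (ler_norm _) _.
apply: le_trans (cauchy_schwarz_dotv _ _) _.
rewrite expr2 mulrA mulrAC; apply: ler_wpM2r; first exact: lpnorm_ge0.
have := gradient_lagrangian_lip Xx (line_in Xx Xy t01) lb.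
by rewrite (addrC x) addrK lpnormZ// (ger0_norm (proj1 (andP t01))) [t * _]mulrC mulrA; apply; rewrite addrC.
Qed.

Section one_step.
Variables (x s : 'rV[R]_d) (l : 'rV[R]_m).
Hypothesis Xx : X x.
Hypothesis lb : forall i, `|l 0 i| <= rho * B.
Let g := s + jacT c x (l + mu *: c x).
Let y := mirror_step X h v eta g x.
Let e := s - gradient f x.
Let D := lpnorm q (y - x) ^+ 2 / eta ^+ 2.

Let Xy : X y.
Proof. exact: (@mirror_step_in R d X h v q eta D_X M_h X_nonempty X_closed X_bounded h_fin h_lip v_diff q1 g x). Qed.

Let gE : g = gA l x + e.
Proof. by rewrite /gA /e /g; apply/rowP => i; rewrite !mxE; ring. Qed.

(** Strong convexity provides [|y - x|_q^2 / eta]. A quarter pays for smoothness since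
    [Lmu * eta <= 1/2] and the 2-norm is below the q-norm, a quarter pays for the error term by
    Young, and half is left as descent. *)
Lemma step_descent : A l y + hr y <= A l x + hr x - eta * D / 2 + eta * lpnorm p e ^+ 2.
Proof.
have := mirror_step_optimal X_nonempty X_closed X_convex X_bounded h_fin h_lip h_convex
  v_diff eta0 q1 g x Xx.
rewrite -/y /= -(opprB y x) dotvNr dotvDl dotvZl gE dotvDl => opt.
have := v_strong y x; rewrite dotvC => vs.
have := lagrangian_smooth Xx Xy lb => sm.
have := hoelder_dotv e (y - x) p0 q0 pq => /ler_normlP[+ _] => ho.
have n2 : lpnorm 2 (y - x) ^+ 2 <= lpnorm q (y - x) ^+ 2.
  by rewrite ler_sqr ?nnegrE ?lpnorm_ge0//; exact: le_lpnorm.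
rewrite /D; move: opt vs sm ho n2 (lpnorm_ge0 p e) (lpnorm_ge0 q (y - x)) (lpnorm_ge0 2 (y - x)).
rewrite -/(hr x) -/(hr y).
move: (dotv (gA l x) _) (dotv e _) (dotv (gradient v y - gradient v x) _) (lpnorm p e) (lpnorm q _) (lpnorm 2 _).
move: (A l x) (A l y) (hr x) (hr y) => a b hx hy r1 r2 r3 ne nq n2 opt vs sm ho nn ne0 nq0 n20.
have etai : eta * eta^-1 = 1 by rewrite mulfV// gt_eqF.
have i0 : 0 < eta^-1 by rewrite invr_gt0.
have Li : Lmu <= eta^-1 / 2.
  by rewrite -(@ler_pM2r _ eta)// mulrAC (mulrC eta^-1) etai.
have -> : eta * (nq ^+ 2 / eta ^+ 2) / 2 = eta^-1 * nq ^+ 2 / 2 by field; rewrite gt_eqF.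
have H1 : Lmu / 2 * n2 ^+ 2 <= eta^-1 / 4 * nq ^+ 2.
  apply: le_trans (_ : eta^-1 / 4 * n2 ^+ 2 <= _).
    by apply: ler_wpM2r; [exact: sqr_ge0|lra].
  by apply: ler_wpM2l => //; lra.
have H2 : ne * nq <= eta * ne ^+ 2 + eta^-1 / 4 * nq ^+ 2.
  rewrite -subr_ge0 (_ : _ - _ = eta * (ne - eta^-1 * nq / 2) ^+ 2); first by nneg.
  by field; rewrite gt_eqF.
have H3 : eta^-1 * nq ^+ 2 <= eta^-1 * r3 by rewrite ler_pM2l.
lra.
Qed.

(** The actual step uses [g], the gradient mapping the exact gradient; the two minimizers differ by
    at most [eta * |e|_p] by [mirror_step_lip]. *)
Lemma step_gradient_mapping :
  lpnorm q (gradient_mapping X h v eta (gA l x) x) ^+ 2 <= 2 * D + 2 * lpnorm p e ^+ 2.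
Proof.
have -> : gradient_mapping X h v eta (gA l x) x =
   eta^-1 *: (x - y) + eta^-1 *: (y - mirror_step X h v eta (gA l x) x).
  by rewrite -scalerDr addrA subrK.
apply: le_trans (lpnorm_sqrD q1 _ _) _; rewrite !lpnormZ// !exprMn.
have -> : `|eta^-1| ^+ 2 * lpnorm q (x - y) ^+ 2 = D.
  by rewrite lpnorm_distC// ger0_norm ?invr_ge0 ?ltW// exprVn mulrC.
rewrite lerD2l ler_pM2l// -exprMn ler_sqr ?nnegrE ?lpnorm_ge0 ?mulr_ge0//; last exact: lpnorm_ge0.
have := mirror_step_lip X_nonempty X_closed X_convex X_bounded h_fin h_lip h_convex
  v_diff v_strong eta0 p0 q1 pq g (gA l x) x x.
rewrite -/y (_ : _ - _ - _ = eta *: e); last by rewrite opprB addrA subrK -scalerBr gE (addrC (gA l x)) addrK.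
have i0 : 0 < eta^-1 by rewrite invr_gt0.
by rewrite lpnormZ// (gtr0_norm eta0) (gtr0_norm i0) ler_pdivrMl.
Qed.

Lemma step_constraint :
  beta * lpnorm p (c y) <= distp p (jacT c y (c y)) [set - z | z in normal_cone X y] ->
  mu ^+ 2 * beta ^+ 2 * lpnorm p (c y) ^+ 2 <=
  9 * (M_f ^+ 2 + M_h ^+ 2 + m%:R ^+ 2 * rho ^+ 2 * B ^+ 2 * M_c ^+ 2)
  + 3 / 2 * (2 * lpnorm p e ^+ 2 + (4 * L_v ^+ 2 + 1) * D).
Proof.
move=> Hb; pose dv := gradient v y - gradient v x.
(* In the optimality condition [h z - h y] is replaced by its Lipschitz bound, so a vector [t] with
   2-norm at most [M_h] stands in for a subgradient of [h], and no sum rule is invoked. *)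
have [t [tM tN]] := normal_cone_approx X_convex Xy (w := g + eta^-1 *: dv) M_h0 (fun z Xz =>
  le_trans (mirror_step_optimal X_nonempty X_closed X_convex X_bounded h_fin h_lip h_convex
    v_diff eta0 q1 g x Xz) (lerD (lexx _) (h_lip Xz Xy))).
have cone : normal_cone X y (mu^-1 *: (- (g + eta^-1 *: dv) - t)).
  split => // z Xz; rewrite dotvZl pmulr_rle0 ?invr_gt0//; exact: (proj2 tN).
have Hd : distp p (jacT c y (c y)) [set - z | z in normal_cone X y] <=
   lpnorm p (jacT c y (c y) + mu^-1 *: (- (g + eta^-1 *: dv) - t)).
  apply: ge_inf.
    by exists 0 => _ [z _ <-]; rewrite pnormE; exact: lpnorm_ge0.
  exists (- (mu^-1 *: (- (g + eta^-1 *: dv) - t))); first by exists (mu^-1 *: (- (g + eta^-1 *: dv) - t)).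
  by rewrite pnormE opprK.
have mb : mu * beta * lpnorm p (c y) <= lpnorm p (mu *: jacT c y (c y) - (g + eta^-1 *: dv) - t).
  rewrite -mulrA -ler_pdivlMl//; apply: le_trans Hb _; apply: le_trans Hd _.
  have mi0 : 0 < mu^-1 by rewrite invr_gt0.
  rewrite -[X in X * _](gtr0_norm mi0) -lpnormZ// le_eqVlt; apply/orP; left; apply/eqP.
  congr lpnorm; move: (jacT _ _ _) (g + _) => a b.
  by apply/rowP => i; rewrite !mxE; field; rewrite gt_eqF.
(* The large term [mu *: jacT c y (c y)] is absorbed in [gA l y - gA l x], of size [Lmu |y - x|];
   what is left outside is bounded independently of [mu]. *)
have decomp : mu *: jacT c y (c y) - (g + eta^-1 *: dv) - t =
   (- e - eta^-1 *: dv + (gA l y - gA l x)) - (gradient f y + t + jacT c y l).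
  rewrite gE /gA !jacTD !jacTZ; apply/rowP => i; rewrite !mxE; ring.
have lp2 (z : 'rV[R]_d) : lpnorm p z <= lpnorm 2 z by apply: le_lpnorm.
have N1 : lpnorm p (- e - eta^-1 *: dv + (gA l y - gA l x)) <=
    lpnorm p e + (L_v + 1 / 2) * (lpnorm q (y - x) / eta).
  apply: le_trans (ler_lpnormD _ _ p1) _.
  have h1 : lpnorm p (- e - eta^-1 *: dv) <= lpnorm p e + L_v * (lpnorm q (y - x) / eta).
    apply: le_trans (ler_lpnormB _ _ p1) _; rewrite lpnormN// lerD2l lpnormZ//.
    have i0 : 0 < eta^-1 by rewrite invr_gt0.
    by rewrite (gtr0_norm i0) (mulrC eta^-1) mulrA ler_pM2r//; exact: v_smooth.
  have h2 : lpnorm p (gA l y - gA l x) <= 1 / 2 * (lpnorm q (y - x) / eta).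
    apply: le_trans (lp2 _) _; apply: le_trans (gradient_lagrangian_lip Xx Xy lb) _.
    have : Lmu <= 1 / 2 / eta by rewrite ler_pdivlMr.
    have := le_lpnorm (y - x) q0 q2; have := lpnorm_ge0 2 (y - x).
    have : 0 < eta^-1 by rewrite invr_gt0.
    move: (lpnorm 2 _) (lpnorm q _) eta^-1 => n2 nq i i0 n20 n2q Li.
    apply: le_trans (_ : 1 / 2 * i * n2 <= _); first exact: ler_wpM2r.
    by rewrite -mulrA ler_pM2l ?divr_gt0// mulrC ler_pM2r.
  lra.
have N2 : lpnorm p (gradient f y + t + jacT c y l) <= M_f + M_h + m%:R * (rho * B * M_c).
  apply: le_trans (lp2 _) _; apply: le_trans (ler_lpnormD _ _ _) _; first by rewrite ltr1n.
  apply: lerD; last by apply: lpnorm_jacT => // i; exact: c_grad.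
  apply: le_trans (ler_lpnormD _ _ _) _; first by rewrite ltr1n.
  by apply: lerD => //; exact: f_bound.
have := le_trans mb _; rewrite decomp => /(_ _ (le_trans (ler_lpnormB _ _ p1) (lerD N1 N2))).
rewrite -!exprMn.
have := lpnorm_ge0 p (c y); have := lpnorm_ge0 p e.
have := lpnorm_ge0 q (y - x); rewrite /D -expr_div_n.
have : 0 <= lpnorm q (y - x) / eta by rewrite divr_ge0 ?lpnorm_ge0// ltW.
have : 0 <= m%:R * (rho * B * M_c) by nneg.
have -> : m%:R * rho * B * M_c = m%:R * (rho * B * M_c) by rewrite !mulrA.
have : 0 < mu * beta by rewrite mulr_gt0.
move: (mu * beta) (lpnorm q _ / eta) (lpnorm p e) (lpnorm p (c y)) (m%:R * _) => b a n1 n2 r b0 r0 a0 _ n10 n20 H.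
have H2 : (b * n2) ^+ 2 <= (n1 + (L_v + 1 / 2) * a + (M_f + M_h + r)) ^+ 2.
  have bn : 0 <= b * n2 by rewrite mulr_ge0// ltW.
  by rewrite ler_sqr ?nnegrE//; exact: le_trans H.
apply: le_trans H2 _.
(* Weights 3/2 and 3 have reciprocals summing to 1. The three constants in [w] then cost a further
   factor 3, giving the 9. *)
have K1 (z w : R) : (z + w) ^+ 2 <= 3 / 2 * z ^+ 2 + 3 * w ^+ 2.
  by have := sqr_ge0 (z - 2 * w); rewrite -subr_ge0; lra.
apply: le_trans (K1 _ _) _; rewrite addrC; apply: lerD.
  have := sqr_ge0 (M_f - M_h); have := sqr_ge0 (M_f - r); have := sqr_ge0 (M_h - r).
  by lra.
rewrite ler_pM2l ?divr_gt0//.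
have k2 : ((L_v + 1 / 2) * a) ^+ 2 <= (2 * L_v ^+ 2 + 1 / 2) * a ^+ 2.
  rewrite exprMn; apply: ler_wpM2r; first exact: sqr_ge0.
  by have := sqr_ge0 (L_v - 1 / 2); lra.
by have := sqr_ge0 (n1 - (L_v + 1 / 2) * a); lra.
Qed.

End one_step.
End step_inequalities.

(** In the smoothness inequality of the squared p-norm the linear form depends on [a] only, so it
    integrates to zero against a centred increment. *)
Lemma lpnorm_increment_mean {R : realType} {d} {dT} {T : measurableType dT}
    (M : probability T R) (p B : R) (a : 'rV[R]_d) (Y : T -> 'rV[R]_d) : 2 <= p ->
  (forall i, M.-integrable setT (fun t => (Y t 0 i)%:E)) ->
  (forall i, \int[M]_t (Y t 0%R i)%:E = 0)%E ->
  (\int[M]_t (lpnorm p (Y t) ^+ 2)%:E <= B%:E)%E ->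
  (\int[M]_t (lpnorm p (a + Y t) ^+ 2)%:E <= (lpnorm p a ^+ 2 + (p - 1) * B)%:E)%E.
Proof.
move=> p2 YI Y0 YB; have [l Hl] := lpnorm_smooth a p2.
have mY : measurable_vec Y by move=> i; apply/measurable_EFinP; exact: measurable_int (YI i).
have mYp := measurable_lpnorm_sqr p mY.
have Y0' i : (\int[M]_t (Y t 0%R i)%:E = ((0 : 'rV[R]_d) 0%R i)%:E)%E by rewrite Y0 mxE.
have [lI l0] := @integral_dotv _ _ _ M _ Y l 0 YI Y0'.
rewrite dotv0r in l0.
have YpI : M.-integrable setT (fun t => (lpnorm p (Y t) ^+ 2)%:E).
  apply/integrableP; split => //.
  under eq_integral do rewrite gee0_abs ?lee_fin ?sqr_ge0//.
  exact: le_lt_trans YB (ltry _).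
have aI : M.-integrable setT (fun t => (lpnorm p a ^+ 2)%:E) by exact: finite_measure_integrable_cst.
apply: (@le_trans _ _ (\int[M]_t ((lpnorm p a ^+ 2)%:E + ((dotv l (Y t))%:E + (p - 1)%:E * (lpnorm p (Y t) ^+ 2)%:E)))%E).
  have RI : M.-integrable setT (fun t => ((lpnorm p a ^+ 2)%:E + ((dotv l (Y t))%:E + (p - 1)%:E * (lpnorm p (Y t) ^+ 2)%:E))%E).
    by apply: integrableD => //; apply: integrableD => //; exact: integrableZl.
  have H t : ((lpnorm p (a + Y t) ^+ 2)%:E <= (lpnorm p a ^+ 2)%:E + ((dotv l (Y t))%:E + (p - 1)%:E * (lpnorm p (Y t) ^+ 2)%:E))%E.
    by rewrite -EFinM -!EFinD lee_fin addrA.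
  have G0 t : (0 <= (lpnorm p (a + Y t) ^+ 2)%:E)%E by rewrite lee_fin sqr_ge0.
  apply: ge0_le_integral => //.
  - by apply: measurable_lpnorm_sqr; apply: measurable_vecD => //; exact: measurable_vec_cst.
  - exact: measurable_int RI.
rewrite integralD//; last first.
  by apply: integrableD => //; exact: integrableZl.
rewrite integralD//; last exact: integrableZl.
rewrite integral_cstT l0 add0e integralZl// (EFinD (lpnorm p a ^+ 2)) (EFinM (p - 1)) leeD2l// lee_wpmul2l// lee_fin.
by lra.
Qed.

(** * Sampling *)

(** [W] retyped with the sigma-algebra generated by the sources in [D]; measurability from it
    expresses dependence on these sources only. *)
Notation history u xi idx D :=
  (g_sigma_algebraType (\bigcup_(s in D) source_events u xi idx s)).

Section sampling_theory.
Context {R : realType} {d : nat} {dX} {Xi : measurableType dX}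
  {dW} {W : measurableType dW} (P : probability W R).
Variables (Pu : probability (borelRV R d) R) (Pxi : probability Xi R) (K n0 n : nat).
Variables (u : nat -> nat -> {RV P >-> borelRV R d})
          (xi : nat -> nat -> {RV P >-> Xi}) (idx : W -> 'I_K).
Hypothesis Hs : sampling Pu Pxi n0 n u xi idx.
Local Notation G := (source_events u xi idx).
Local Notation hist D := (history u xi idx D).
Local Notation used := (@source_used K n0 n).
Local Notation M := (Pu \x Pxi)%E.
Local Notation du k j := (inl (inl (k, j)) : source).
Local Notation dxi k j := (inl (inr (k, j)) : source).

Lemma source_events_measurable s : G s `<=` measurable.
Proof.
case: s => [[[k j]|[k j]]|[]] A [B mB <-] /=.
- by rewrite -[X in measurable X]setTI; exact: measurable_funP.
- by rewrite -[X in measurable X]setTI; exact: measurable_funP.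
- rewrite (_ : idx @^-1` B = \bigcup_(r in [set r | B r]) (idx @^-1` [set r])).
    apply: fin_bigcup_measurable => // r _; exact: sampling_idx_meas Hs r.
  by apply/seteqP; split => [w Bw|w [r Br /= ->]]//; exists (idx w).
Qed.

Lemma source_eventsT s : G s setT.
Proof. by case: s => [[[k j]|[k j]]|[]]; exists setT; rewrite ?preimage_setT. Qed.

Lemma source_eventsI s : setI_closed (G s).
Proof.
by case: s => [[[k j]|[k j]]|[]] A B [A' mA <-] [B' mB <-]; exists (A' `&` B') => //; exact: measurableI.
Qed.

Lemma history_measurable D (A : set W) : <<s \bigcup_(s in D) G s >> A -> measurable A.
Proof.
apply: smallest_sub; first exact: sigma_algebra_measurable.
by move=> B [s _]; exact: source_events_measurable.
Qed.

Lemma measurable_to_history D : measurable_fun setT (id : W -> hist D).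
Proof. by move=> _ A mA; rewrite setTI; exact: history_measurable mA. Qed.

Lemma history_fun d' (T : measurableType d') D (f : W -> T) :
  measurable_fun [set: hist D] f -> measurable_fun setT f.
Proof. move=> mf _ B mB; rewrite setTI; apply: (@history_measurable D).
by have := mf measurableT _ mB; rewrite setTI. Qed.

Lemma history_weaken d' (T : measurableType d') D1 D2 (f : W -> T) : D1 `<=` D2 ->
  measurable_fun [set: hist D1] f -> measurable_fun [set: hist D2] f.
Proof.
move=> D12 mf _ A mA; have := mf measurableT _ mA.
by apply: sub_sigma_algebra2; exact: bigcup_subset.
Qed.

Lemma history_u D k j : D (du k j) -> measurable_fun [set: hist D] (u k j : W -> borelRV R d).
Proof.
move=> Dk _ B mB; rewrite setTI; apply: sub_sigma_algebra; exists (du k j) => //.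
by exists B.
Qed.

Lemma history_xi D k j : D (dxi k j) -> measurable_fun [set: hist D] (xi k j : W -> Xi).
Proof.
move=> Dk _ B mB; rewrite setTI; apply: sub_sigma_algebra; exists (dxi k j) => //.
by exists B.
Qed.

Lemma history_indep D1 D2 (A B : set W) : D1 `<=` used -> D2 `<=` used ->
  (forall s, D1 s -> D2 s -> False) ->
  <<s \bigcup_(s in D1) G s >> A -> <<s \bigcup_(s in D2) G s >> B ->
  P (A `&` B) = (P A * P B)%E.
Proof.
move=> s1 s2 D12; apply: (indep_g_sigma_algebra (sampling_indep Hs)
  source_events_measurable source_eventsT source_eventsI s1 s2).
by apply/disj_set2P/seteqP; split => // s [] /D12.
Qed.

Lemma sample_law k j B : used (du k j) -> measurable B ->
  P ((fun w => (u k j w : borelRV R d, xi k j w)) @^-1` B) = M B.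
Proof.
move=> ukj mB; have mZ : measurable_fun setT (fun w => (u k j w : borelRV R d, xi k j w)).
  by apply: measurable_fun_pair; exact: measurable_funP.
pose Z : {mfun W >-> (borelRV R d * Xi)%type} := mfun_Sub (mem_set mZ).
rewrite (@product_measure_unique _ _ _ _ _ Pu Pxi (distribution P Z))// => A C mA mC.
transitivity (P (u k j @^-1` A) * P (xi k j @^-1` C))%E; last first.
  by congr (_ * _)%E; [exact: (sampling_u Hs ukj mA)|exact: (@sampling_xi _ _ _ _ _ _ _ _ _ _ _ _ _ _ _ Hs k j ukj _ mC)].
apply: (@history_indep [set du k j] [set dxi k j]) => [_ ->//|_ ->//|s -> //||].
  by apply: sub_sigma_algebra; exists (du k j) => //; exists A.
by apply: sub_sigma_algebra; exists (dxi k j) => //; exists C.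
Qed.

(** The fresh pair has law [M] and is independent of the history, so it can be integrated for each
    fixed [w], where [lpnorm_increment_mean] applies. *)
Lemma expected_increment (p : R) D k j (a : W -> 'rV[R]_d)
    (psi : W -> borelRV R d * Xi -> 'rV[R]_d) (B : W -> R) : 2 <= p ->
  used (du k j) -> D `<=` used -> ~ D (du k j) -> ~ D (dxi k j) ->
  measurable_vec (a : hist D -> 'rV[R]_d) ->
  measurable_vec (fun t : (hist D * (borelRV R d * Xi))%type => psi t.1 t.2) ->
  (forall w i, M.-integrable setT (fun t => (psi w t 0 i)%:E)) ->
  (forall w i, \int[M]_t (psi w t 0%R i)%:E = 0)%E ->
  (forall w, \int[M]_t (lpnorm p (psi w t) ^+ 2)%:E <= (B w)%:E)%E ->
  (\int[P]_w (lpnorm p (a w + psi w (u k j w : borelRV R d, xi k j w)) ^+ 2)%:E <=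
   \int[P]_w (lpnorm p (a w) ^+ 2 + (p - 1) * B w)%:E)%E.
Proof.
move=> p2 ukj Du Dk1 Dk2 ma mpsi psiI psi0 psiB.
have mZ : measurable_fun setT (fun w => (u k j w : borelRV R d, xi k j w)).
  by apply: measurable_fun_pair; exact: measurable_funP.
rewrite (@indep_integral _ _ _ W (hist D) (borelRV R d * Xi)%type R P M id
  (fun w => (u k j w : borelRV R d, xi k j w))
  (fun t => (lpnorm p (a t.1 + psi t.1 t.2) ^+ 2)%:E))//; first last.
- by move=> t; rewrite lee_fin sqr_ge0.
- apply: measurable_lpnorm_sqr; apply: measurable_vecD => //.
  by move=> i; apply: (@measurableT_comp _ _ _ _ _ _ (fun w : hist D => a w 0 i) _ fst) => //.
- move=> A C mA mC; transitivity (P A * P ((fun w => (u k j w : borelRV R d, xi k j w)) @^-1` C))%E; last first.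
    by congr (_ * _)%E; exact: sample_law.
  apply: (@history_indep D [set s | s = du k j \/ s = dxi k j]) => //.
  + by move=> _ [->|->].
  + by move=> s Ds [E|E]; rewrite E in Ds.
  + have m2 : measurable_fun [set: hist [set s | s = du k j \/ s = dxi k j]]
        (fun w => (u k j w : borelRV R d, xi k j w)).
      by apply: measurable_fun_pair; [apply: history_u; left|apply: history_xi; right].
    by have := m2 measurableT _ mC; rewrite setTI.
- exact: measurable_to_history.
(* The empty exceptional set gives plain monotonicity of the integral with no measurability demanded
   of [B]. *)
apply: (@ge0_le_integral_off _ _ _ P set0) => //.
- by move=> w; apply: integral_ge0 => t _; rewrite lee_fin sqr_ge0.
- move=> w; rewrite lee_fin addr_ge0 ?sqr_ge0// mulr_ge0//; first lra.
  rewrite -lee_fin; apply: le_trans (psiB w); apply: integral_ge0 => t _.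
  by rewrite lee_fin sqr_ge0.
move=> w _; exact: (@lpnorm_increment_mean R d _ _ M p (B w) (a w) (psi w) p2 (psiI w) (psi0 w) (psiB w)).
Qed.

(** Split along the events that the output index equals [r]; each is independent of the history and
    has probability 1/K. *)
Lemma expected_output (D : set source) (g : nat -> W -> R) : D `<=` used -> ~ D (inr tt) ->
  (forall r, (r < K)%N -> measurable_fun [set: hist D] (g r)) ->
  (forall r w, 0 <= g r w) ->
  (\int[P]_w (g (idx w) w)%:E = K%:R^-1%:E * \sum_(r < K) \int[P]_w (g r w)%:E)%E.
Proof.
move=> Du Di mg g0.
have memE (r : 'I_K) w : (w \in idx @^-1` [set r]) = (idx w == r).
  by apply/idP/idP => [|/eqP e]; rewrite inE //= => ->.
have E (r : 'I_K) : (\int[P]_w (g r w * (idx w == r)%:R)%:E = K%:R^-1%:E * \int[P]_w (g r w)%:E)%E.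
  pose Z w : bool := idx w == r.
  have mZ : measurable_fun setT Z.
    apply: (measurable_fun_bool true); rewrite setTI (_ : _ @^-1` _ = idx @^-1` [set r]).
      exact: sampling_idx_meas Hs r.
    by apply/seteqP; split => w /= /eqP.
  pose Zf : {mfun W >-> bool} := mfun_Sub (mem_set mZ).
  have := @indep_integral _ _ _ W (hist D) bool R P (distribution P Zf) id Z
    (fun t => (g r t.1 * t.2%:R)%:E).
  rewrite /= => ->//; first last.
  - by move=> t; rewrite lee_fin mulr_ge0.
  - apply/measurable_EFinP; apply: measurable_funM.
      exact: (@measurableT_comp _ _ _ _ _ _ (g r : hist D -> R) _ fst (mg r (ltn_ord r))).
    by apply: (@measurableT_comp _ _ _ _ _ _ (fun b : bool => b%:R : R) _ snd).
  - move=> A C mA mC; apply: (@history_indep D [set inr tt]) => //.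
    + by move=> _ ->.
    + by move=> s Ds E; rewrite E in Ds.
    + apply: sub_sigma_algebra; exists (inr tt) => //; exists [set s | C (s == r)] => //.
  - exact: measurable_to_history.
  rewrite -ge0_integralZl//; last 2 first.
  - by apply/measurable_EFinP; exact: history_fun (mg r (ltn_ord r)).
  - by move=> w _; rewrite lee_fin.
  apply: eq_integral => w _.
  rewrite ge0_integral_distribution//=; last by move=> b; rewrite lee_fin mulr_ge0.
  have -> : (fun x => ((fun b : bool => (g r w * b%:R)%:E) \o Z) x) =
     (fun x => (g r w)%:E * (\1_(idx @^-1` [set r]) x)%:E)%E.
    apply/funext => x /=; rewrite EFinM indicE; congr (_ * (_%:R)%:E)%E.
    by rewrite memE.
  rewrite ge0_integralZl ?lee_fin//; last first.
    by apply/measurable_EFinP; apply: measurable_indic; exact: sampling_idx_meas Hs r.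
  rewrite integral_indic//; last exact: sampling_idx_meas Hs r.
  by rewrite setIT muleC; congr (_ * _)%E; exact: (sampling_idx Hs r).
have -> : (fun w => (g (idx w) w)%:E) = (fun w => \sum_(r < K) (g r w * (idx w == r)%:R)%:E)%E.
  apply/funext => w; rewrite sumEFin; congr EFin.
  rewrite (bigD1 (idx w))//= eqxx mulr1 big1 ?addr0// => r /negbTE rw.
  by rewrite eq_sym rw mulr0.
rewrite ge0_integral_sum//; last 2 first.
- move=> r; apply/measurable_EFinP; apply: measurable_funM.
    exact: history_fun (mg r (ltn_ord r)).
  have -> : (fun w => (idx w == r)%:R : R) = \1_(idx @^-1` [set r]).
    apply/funext => w; rewrite indicE; by rewrite memE.
  by apply: measurable_indic; exact: sampling_idx_meas Hs r.
- by move=> r w _; rewrite lee_fin mulr_ge0.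
rewrite ge0_sume_distrr; last by move=> r _; apply: integral_ge0 => w _; rewrite lee_fin.
by apply: eq_bigr => r _; rewrite E.
Qed.

End sampling_theory.

Section mean_zero.
Context {R : realType} {dT} {T : measurableType dT} (M : probability T R).

Lemma integral_centered (Y : T -> R) : M.-integrable setT (EFin \o Y) ->
  M.-integrable setT (fun t => (Y t - fine (\int[M]_t (Y t)%:E))%:E) /\
  (\int[M]_t (Y t - fine (\int[M]_t (Y t)%:E))%:E = 0)%E.
Proof.
move=> YI; have wf : (\int[M]_t (Y t)%:E)%E \is a fin_num by exact: integrable_fin_num.
have cI (a : R) : M.-integrable setT (fun=> a%:E) by exact: finite_measure_integrable_cst.
split; under eq_fun do rewrite EFinB; first exact: integrableB.
by rewrite integralB// integral_cstT fineK// subee.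
Qed.

Lemma integral_coordZ {d} (a : R) (Y : T -> 'rV[R]_d) i :
  M.-integrable setT (fun t => (Y t 0 i)%:E) ->
  M.-integrable setT (fun t => ((a *: Y t) 0 i)%:E) /\
  (\int[M]_t ((a *: Y t) 0%R i)%:E = a%:E * \int[M]_t (Y t 0%R i)%:E)%E.
Proof.
move=> YI; under eq_fun do rewrite mxE EFinM.
by split; [exact: integrableZl|rewrite integralZl].
Qed.

Lemma integral_lpnorm_sqrZ {d} (p a V : R) (Y : T -> 'rV[R]_d) : p != 0 -> measurable_vec Y ->
  (\int[M]_t (lpnorm p (Y t) ^+ 2)%:E <= V%:E)%E ->
  (\int[M]_t (lpnorm p (a *: Y t) ^+ 2)%:E <= (a ^+ 2 * V)%:E)%E.
Proof.
move=> p0 mY YV.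
under eq_integral do rewrite lpnormZ// exprMn real_normK ?num_real// (EFinM (a ^+ 2)).
rewrite ge0_integralZl//; last 3 first.
- exact: measurable_lpnorm_sqr.
- by move=> t _; rewrite lee_fin sqr_ge0.
- by rewrite lee_fin sqr_ge0.
by rewrite (EFinM (a ^+ 2)) lee_wpmul2l// lee_fin sqr_ge0.
Qed.
Lemma measurable_fine_integral {d'} {T' : measurableType d'} (g : T' * T -> R) :
  measurable_fun setT g -> measurable_fun setT (fun a => fine (\int[M]_t (g (a, t))%:E)).
Proof.
move=> /measurable_EFinP; set G := EFin \o g => mg.
apply: (measurableT_comp (@fine_measurable R setT measurableT)).
rewrite (_ : (fun t => _) = fun a => (\int[M]_t (G^\+)%E (a, t) - \int[M]_t (G^\-)%E (a, t))%E); last first.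
  apply/funext => a; rewrite integralE; congr (_ - _)%E; apply: eq_integral => t _.
    by rewrite !funeposE.
  by rewrite !funenegE.
apply: emeasurable_funB.
- by apply: (measurable_fun_fubini_tonelli_F (G^\+)%E) => //; exact: measurable_funepos.
- by apply: (measurable_fun_fubini_tonelli_F (G^\-)%E) => //; exact: measurable_funeneg.
Qed.

End mean_zero.

Section batch.
Context {R : realType} {d : nat} {dX} {Xi : measurableType dX}
  {dW} {W : measurableType dW} (P : probability W R).
Variables (Pu : probability (borelRV R d) R) (Pxi : probability Xi R) (K n0 n : nat).
Variables (u : nat -> nat -> {RV P >-> borelRV R d})
          (xi : nat -> nat -> {RV P >-> Xi}) (idx : W -> 'I_K).
Hypothesis Hs : sampling Pu Pxi n0 n u xi idx.
Local Notation hist D := (history u xi idx D).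
Local Notation used := (@source_used K n0 n).
Local Notation M := (Pu \x Pxi)%E.
Local Notation du k j := (inl (inl (k, j)) : source).
Local Notation dxi k j := (inl (inr (k, j)) : source).
Local Notation sample k j w := (u k j w : borelRV R d, xi k j w).

(** The draws of a batch are added one at a time. Each is centred given the previous ones, so each
    costs [(p - 1) * B] and cross terms never appear. *)
Lemma expected_batch (p : R) D k N (a : W -> 'rV[R]_d)
    (psi : W -> borelRV R d * Xi -> 'rV[R]_d) (B : W -> R) : 2 <= p ->
  (forall j, (j < N)%N -> used (du k j)) -> D `<=` used ->
  (forall j, ~ D (du k j)) -> (forall j, ~ D (dxi k j)) ->
  measurable_vec (a : hist D -> 'rV[R]_d) ->
  measurable_vec (fun t : (hist D * (borelRV R d * Xi))%type => psi t.1 t.2) ->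
  measurable_fun [set: hist D] B ->
  (forall w i, M.-integrable setT (fun t => (psi w t 0 i)%:E)) ->
  (forall w i, \int[M]_t (psi w t 0%R i)%:E = 0)%E ->
  (forall w, \int[M]_t (lpnorm p (psi w t) ^+ 2)%:E <= (B w)%:E)%E ->
  (\int[P]_w (lpnorm p (a w + \sum_(j < N) psi w (sample k j w)) ^+ 2)%:E <=
   \int[P]_w (lpnorm p (a w) ^+ 2 + N%:R * (p - 1) * B w)%:E)%E.
Proof.
move=> p2 ukj Du Dk1 Dk2 ma mpsi mB psiI psi0 psiB.
have B0 w : 0 <= B w.
  rewrite -lee_fin; apply: le_trans (psiB w); apply: integral_ge0 => t _.
  by rewrite lee_fin sqr_ge0.
(* The history after [r] draws of the batch; [psi] and [B] remain functions of the original [D]. *)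
pose Dr r := D `|` [set s | exists2 j, (j < r)%N & s = du k j \/ s = dxi k j].
have DDr r : D `<=` Dr r by move=> s Ds; left.
have mar r : measurable_vec (fun w : hist (Dr r) => a w + \sum_(j < r) psi w (sample k j w)).
  apply: measurable_vecD; first by move=> i; exact: history_weaken (DDr r) (ma i).
  apply: measurable_vec_sum => j i.
  apply: (@measurableT_comp _ _ _ _ _ _ (fun t : (hist D * (borelRV R d * Xi))%type => psi t.1 t.2 0 i)
    _ (fun w : hist (Dr r) => (w : hist D, (sample k j w)))); first exact: mpsi.
  apply: measurable_fun_pair.
    by apply: (history_weaken (DDr r)); exact: measurable_id.
  by apply: measurable_fun_pair; [apply: history_u|apply: history_xi]; right; exists j => //; [left|right].
have mBE : measurable_fun setT (fun w => (B w)%:E).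
  by apply/measurable_EFinP; exact: (history_fun Hs mB).
suff H r : (r <= N)%N ->
  (\int[P]_w (lpnorm p (a w + \sum_(j < r) psi w (sample k j w)) ^+ 2)%:E <=
   \int[P]_w (lpnorm p (a w) ^+ 2)%:E + (r%:R * (p - 1))%:E * \int[P]_w (B w)%:E)%E.
  apply: le_trans (H N _) _ => //; rewrite -ge0_integralZl//; last 2 first.
  - by move=> w _; rewrite lee_fin.
  - by rewrite lee_fin mulr_ge0//; lra.
  rewrite -ge0_integralD//.
  - by move=> w _; rewrite lee_fin sqr_ge0.
  - by apply: measurable_lpnorm_sqr => i; exact: (history_fun Hs (ma i)).
  - by move=> w _; rewrite -EFinM lee_fin mulr_ge0// mulr_ge0//; lra.
  - exact: measurable_funeM.
elim: r => [_|r IH rN].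
  rewrite mul0r mul0e adde0 le_eqVlt; apply/orP; left; apply/eqP.
  by apply: eq_integral => w _; rewrite big_ord0 addr0.
have K1 : (\int[P]_w (lpnorm p (a w + \sum_(j < r.+1) psi w (sample k j w)) ^+ 2)%:E <=
  \int[P]_w (lpnorm p (a w + \sum_(j < r) psi w (sample k j w)) ^+ 2 + (p - 1) * B w)%:E)%E.
  under eq_integral do rewrite big_ord_recr/= addrA.
  apply: (@expected_increment _ _ _ _ _ _ P Pu Pxi K n0 n u xi idx Hs p (Dr r) k r _ psi B p2) => //.
  - exact: ukj.
  - move=> s [/Du//|[j jr [->|->]]]; first by apply: ukj; exact: ltn_trans rN.
    by apply: (ukj j); exact: ltn_trans rN.
  - case=> [/Dk1//|[j jr [[E]|//]]]; by rewrite E ltnn in jr.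
  - case=> [/Dk2//|[j jr [//|[E]]]]; by rewrite E ltnn in jr.
  - move=> i; apply: (@measurableT_comp _ _ _ _ _ _ (fun t : (hist D * (borelRV R d * Xi))%type => psi t.1 t.2 0 i)
      _ (fun t : (hist (Dr r) * (borelRV R d * Xi))%type => (t.1 : hist D, t.2))); first exact: mpsi.
    apply: measurable_fun_pair => //.
    apply: (@measurableT_comp _ _ _ _ _ _ (id : hist (Dr r) -> hist D) _ fst) => //.
    by apply: (history_weaken (DDr r)); exact: measurable_id.
apply: (le_trans K1).
under eq_integral do rewrite EFinD (EFinM (p - 1)).
have mr : measurable_fun setT (fun w => (lpnorm p (a w + \sum_(j < r) psi w (sample k j w)) ^+ 2)%:E).
  by apply: measurable_lpnorm_sqr => i; exact: (history_fun Hs (mar r i)).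
have p10 : 0 <= p - 1 by lra.
rewrite ge0_integralD//; last 3 first.
- by move=> w _; rewrite lee_fin sqr_ge0.
- by move=> w _; rewrite -EFinM lee_fin mulr_ge0.
- exact: measurable_funeM.
rewrite ge0_integralZl//; last by move=> w _; rewrite lee_fin.
have -> : (r.+1%:R * (p - 1))%:E = ((r%:R * (p - 1))%:E + (p - 1)%:E)%E.
  by rewrite -EFinD; congr EFin; rewrite -natr1; ring.
rewrite ge0_muleDl; last 2 first.
- by rewrite lee_fin mulr_ge0.
- by rewrite lee_fin.
rewrite addeA.
by apply: leeD2r; apply: IH; exact: ltnW.
Qed.

Lemma expected_minibatch (p : R) D k N (a : W -> 'rV[R]_d)
    (psi : W -> borelRV R d * Xi -> 'rV[R]_d) (B : W -> R) : 2 <= p -> (0 < N)%N ->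
  (forall j, (j < N)%N -> used (du k j)) -> D `<=` used ->
  (forall j, ~ D (du k j)) -> (forall j, ~ D (dxi k j)) ->
  measurable_vec (a : hist D -> 'rV[R]_d) ->
  measurable_vec (fun t : (hist D * (borelRV R d * Xi))%type => psi t.1 t.2) ->
  measurable_fun [set: hist D] B ->
  (forall w i, M.-integrable setT (fun t => (psi w t 0 i)%:E)) ->
  (forall w i, \int[M]_t (psi w t 0%R i)%:E = 0)%E ->
  (forall w, \int[M]_t (lpnorm p (psi w t) ^+ 2)%:E <= (B w)%:E)%E ->
  (\int[P]_w (lpnorm p (a w + N%:R^-1 *: \sum_(j < N) psi w (sample k j w)) ^+ 2)%:E <=
   \int[P]_w (lpnorm p (a w) ^+ 2 + (p - 1) / N%:R * B w)%:E)%E.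
Proof.
move=> p2 N0 ukj Du Dk1 Dk2 ma mpsi mB psiI psi0 psiB.
have n00 : (N%:R : R) != 0 by rewrite pnatr_eq0 -lt0n.
under eq_integral do rewrite scaler_sumr.
apply: le_trans (@expected_batch p D k N a (fun w t => N%:R^-1 *: psi w t)
  (fun w => N%:R^-1 ^+ 2 * B w) p2 ukj Du Dk1 Dk2 ma _ _ _ _ _) _.
- by apply: measurable_vecZ => //; exact: measurable_cst.
- by apply: measurable_funM => //; exact: measurable_cst.
- by move=> w i; have [] := integral_coordZ N%:R^-1 (psiI w i).
- by move=> w i; have [_ ->] := integral_coordZ N%:R^-1 (psiI w i); rewrite psi0 mule0.
- move=> w; apply: integral_lpnorm_sqrZ => //; first by rewrite gt_eqF//; lra.
  by move=> i; apply/measurable_EFinP; exact: measurable_int (psiI w i).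
under [leRHS]eq_integral => w _.
  rewrite (_ : (p - 1) / N%:R * B w = N%:R * (p - 1) * (N%:R^-1 ^+ 2 * B w)); last by field.
  over.
by [].
Qed.

End batch.
Lemma scaler_mean {R : realType} {d} (N : nat) (a : 'rV[R]_d) : (N%:R : R) != 0 ->
  N%:R^-1 *: (a *+ N) = a.
Proof. by move=> N0; rewrite -[a *+ N]scaler_nat scalerA mulVf// scale1r. Qed.

(** The output index never belongs to the past, which keeps it independent of all iterates. *)
Definition past (K n0 n k : nat) : set source := [set s | @source_used K n0 n s /\
  match s with inl (inl (i, _)) | inl (inr (i, _)) => (i < k)%N | inr _ => false end].

(** * The run as an adapted process *)

Section run_theory.
Context {R : realType} {d m : nat} {dX} {Xi : measurableType dX}
  {dW} {W : measurableType dW} (P : probability W R).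
Variables (Pu : probability (borelRV R d) R) (Pxi : probability Xi R) (K n0 n : nat).
Variables (u : nat -> nat -> {RV P >-> borelRV R d})
          (xi : nat -> nat -> {RV P >-> Xi}) (idx : W -> 'I_K).
Hypothesis Hs : sampling Pu Pxi n0 n u xi idx.
Variables (X : set 'rV[R]_d) (F : 'rV[R]_d -> Xi -> R)
  (h : 'rV[R]_d -> \bar R) (c : 'rV[R]_d -> 'rV[R]_m) (v : 'rV[R]_d -> R).
Variables (p mu eta nu alpha : R) (rho_ : nat -> R) (x0 : 'rV[R]_d).
Variables (x s : nat -> W -> 'rV[R]_d) (lam : nat -> W -> 'rV[R]_m).
Hypothesis run : mdlalm_run K n0 n X F h c v mu eta nu alpha rho_ u xi x0 x s lam.
Hypothesis X_x0 : X x0.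
Hypothesis step_in : forall g y, X (mirror_step X h v eta g y).
Hypothesis step_meas : forall dT (T : measurableType dT) (g y : T -> 'rV[R]_d),
  measurable_vec g -> measurable_vec y ->
  measurable_vec (fun t => mirror_step X h v eta (g t) (y t)).
Hypothesis c_diff : forall i y, differentiable (fun y => c y 0 i) y.
Hypothesis est_meas : forall dT (T : measurableType dT) (y w : T -> 'rV[R]_d) (z : T -> Xi),
  measurable_vec y -> measurable_vec w -> measurable_fun setT z ->
  measurable_vec (fun t => zo_estimator F nu (y t) (w t) (z t)).
Local Notation M := (Pu \x Pxi)%E.
Local Notation gm := (zo_mean Pxi Pu F nu).
Hypothesis est_int : forall y i, X y ->
  M.-integrable setT (fun t => (zo_estimator F nu y t.1 t.2 0 i)%:E).
Hypothesis p2 : 2 <= p.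
Hypotheses (n_gt0 : (0 < n)%N) (n0_gt0 : (0 < n0)%N).
Let pn0 : p != 0. Proof. by rewrite gt_eqF// (lt_le_trans _ p2). Qed.
Local Notation hist D := (history u xi idx D).
Local Notation past := (past K n0 n).

Lemma past_used k : past k `<=` @source_used K n0 n.
Proof. by move=> ? []. Qed.

Lemma past_mono k l : (k <= l)%N -> past k `<=` past l.
Proof.
move=> kl [[[i j]|[i j]]|[]] [H1 H2]; split => //; exact: leq_trans kl.
Qed.

Lemma run_in k w : (k <= K)%N -> X (x k w).
Proof. by case: k => [|k] kK; [rewrite (run_x0 run)|rewrite (run_x run)]. Qed.

Lemma measurable_c_comp dT (T : measurableType dT) (y : T -> 'rV[R]_d) :
  measurable_vec y -> measurable_vec (fun t => c (y t)).
Proof.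
move=> my i; apply: (measurable_continuous_comp (f := fun y => c y 0 i)) => // z.
exact: differentiable_continuous (c_diff i z).
Qed.

Lemma measurable_jacT dT (T : measurableType dT) (y : T -> 'rV[R]_d) (l : T -> 'rV[R]_m) :
  measurable_vec y -> measurable_vec l -> measurable_vec (fun t => jacT c (y t) (l t)).
Proof.
move=> my ml; apply: measurable_vec_sum => i; apply: measurable_vecZ; first exact: ml.
exact: measurable_gradient_comp.
Qed.

Lemma measurable_zo_mean dT (T : measurableType dT) (y : T -> 'rV[R]_d) :
  measurable_vec y -> measurable_vec (fun t => gm (y t)).
Proof.
move=> my i; pose g (t : T * (borelRV R d * Xi)) := zo_estimator F nu (y t.1) t.2.1 t.2.2 0 i.
rewrite (_ : (fun t => gm (y t) 0 i) = fun a => fine (\int[M]_t (g (a, t))%:E)%E); last first.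
  by apply/funext => a; rewrite mxE.
apply: (@measurable_fine_integral _ _ _ M _ _ g); apply: est_meas.
- by move=> j; apply: (@measurableT_comp _ _ _ _ _ _ (fun t => y t 0 j) _ fst).
- move=> j; apply: (@measurableT_comp _ _ _ _ _ _ (fun w : borelRV R d => w 0 j) _ (fun t => t.2.1)).
    exact: measurable_coord.
  by apply: measurableT_comp.
- by apply: measurableT_comp.
Qed.

(** The iterate and multiplier of index [k] use draws of earlier iterations only, whereas [s k] uses
    those of iteration [k]; hence the strict inequality for [s]. *)
Lemma run_adapted k : (k <= K)%N -> forall k', (k' <= k)%N ->
  [/\ measurable_vec (x k' : hist (past k) -> _), measurable_vec (lam k' : hist (past k) -> _)
    & (k' < k)%N -> measurable_vec (s k' : hist (past k) -> _)].
Proof.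
elim: k => [_ [|//] _|k IH kK k'].
  split => //.
    by rewrite (_ : x 0%N = fun=> x0); [exact: measurable_vec_cst|apply/funext => w; rewrite (run_x0 run)].
  by rewrite (_ : lam 0%N = fun=> 0); [exact: measurable_vec_cst|apply/funext => w; rewrite (run_lam0 run)].
have W12 := past_mono (leqnSn k).
have IH' l : (l <= k)%N -> [/\ measurable_vec (x l : hist (past k.+1) -> _),
    measurable_vec (lam l : hist (past k.+1) -> _)
    & (l < k)%N -> measurable_vec (s l : hist (past k.+1) -> _)].
  move=> lk; have [h1 h2 h3] := IH (ltnW kK) l lk; split.
  - by move=> i; exact: history_weaken W12 (h1 i).
  - by move=> i; exact: history_weaken W12 (h2 i).
  - by move=> lk' i; exact: history_weaken W12 (h3 lk' i).
have mu_ j : (j < batch_size n0 n k)%N -> measurable_vec (u k j : hist (past k.+1) -> 'rV[R]_d).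
  move=> jk i; apply: measurable_rVP; apply: history_u; split => //=; by rewrite kK.
have mxi j : (j < batch_size n0 n k)%N -> measurable_fun [set: hist (past k.+1)] (xi k j).
  move=> jk; apply: history_xi; split => //=; by rewrite kK.
have [mxk mlk _] := IH' k (leqnn k).
have ms : measurable_vec (s k : hist (past k.+1) -> 'rV[R]_d).
  case: k {IH W12} kK IH' mu_ mxi mxk mlk => [|k] kK IH' mu_ mxi mxk mlk.
    rewrite (_ : s 0%N = fun w => n0%:R^-1 *: \sum_(j < n0) zo_estimator F nu (x 0%N w) (u 0%N j w) (xi 0%N j w)); last first.
      by apply/funext => w; exact: (run_s0 run).
    apply: measurable_vecZ; first exact: measurable_cst.
    by apply: measurable_vec_sum => j; apply: est_meas => //; [apply: mu_|apply: mxi].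
  have [mxk' _ /(_ (ltnSn _)) msk] := IH' k (leqnSn k).
  rewrite (_ : s k.+1 = fun w => n%:R^-1 *: \sum_(j < n)
      (zo_estimator F nu (x k.+1 w) (u k.+1 j w) (xi k.+1 j w)
       + (1 - alpha) *:
         (s k w - zo_estimator F nu (x k w) (u k.+1 j w) (xi k.+1 j w)))); last first.
    by apply/funext => w; exact: (run_s run).
  apply: measurable_vecZ; first exact: measurable_cst.
  apply: measurable_vec_sum => j; apply: measurable_vecD.
    by apply: est_meas => //; [apply: mu_|apply: mxi].
  apply: measurable_vecZ; first exact: measurable_cst.
  apply: measurable_vecB => //.
  by apply: est_meas => //; [apply: mu_|apply: mxi].
rewrite leq_eqVlt => /predU1P[->|]; last first.
  rewrite ltnS => k'k; have [h1 h2 h3] := IH' k' k'k; split => //.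
  by rewrite leq_eqVlt => /predU1P[->|/h3].
split => //; last by rewrite ltnn.
- rewrite (_ : x k.+1 = fun w => mirror_step X h v eta
      (s k w + jacT c (x k w) (lam k w + mu *: c (x k w))) (x k w)); last first.
    by apply/funext => w; exact: (run_x run).
  apply: step_meas => //; apply: measurable_vecD => //; apply: measurable_jacT => //.
  apply: measurable_vecD => //; apply: measurable_vecZ; first exact: measurable_cst.
  exact: measurable_c_comp.
- rewrite (_ : lam k.+1 = fun w => lam k w + rho_ k *: c (x k w)); last first.
    by apply/funext => w; exact: (run_lam run).
  apply: measurable_vecD => //; apply: measurable_vecZ; first exact: measurable_cst.
  exact: measurable_c_comp.
Qed.

Lemma measurable_x k : (k <= K)%N -> measurable_vec (x k : hist (past K) -> _).
Proof. by move=> kK; have [] := run_adapted (leqnn K) kK. Qed.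

Lemma measurable_lam k : (k <= K)%N -> measurable_vec (lam k : hist (past K) -> _).
Proof. by move=> kK; have [] := run_adapted (leqnn K) kK. Qed.

Lemma measurable_s k : (k < K)%N -> measurable_vec (s k : hist (past K) -> _).
Proof. by move=> kK; have [_ _] := run_adapted (leqnn K) (ltnW kK); apply. Qed.

Let zc y (t : borelRV R d * Xi) := zo_estimator F nu y t.1 t.2 - gm y.

Let zcE y i t : zc y t 0 i = zo_estimator F nu y t.1 t.2 0 i -
  fine (\int[M]_t (zo_estimator F nu y t.1 t.2 0%R i)%:E).
Proof. by rewrite [LHS]mxE [X in _ + X = _]mxE [X in _ - X = _]mxE. Qed.

Let zc_int y i : X y -> M.-integrable setT (fun t => (zc y t 0 i)%:E).
Proof.
by move=> Xy; under eq_fun do rewrite zcE; have [] := integral_centered (est_int i Xy).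
Qed.

Let zc_mean y i : X y -> (\int[M]_t (zc y t 0%R i)%:E = 0)%E.
Proof.
by move=> Xy; under eq_integral do rewrite zcE; have [] := integral_centered (est_int i Xy).
Qed.

Let measurable_zc D (y : W -> 'rV[R]_d) : measurable_vec (y : hist D -> _) ->
  measurable_vec (fun t : (hist D * (borelRV R d * Xi))%type => zc (y t.1) t.2).
Proof.
move=> my; have my1 : measurable_vec (fun t : (hist D * (borelRV R d * Xi))%type => y t.1).
  by move=> j; apply: (@measurableT_comp _ _ _ _ _ _ (fun t : hist D => y t 0 j) _ fst).
apply: measurable_vecB; last exact: measurable_zo_mean.
apply: est_meas => //.
- move=> j; apply: (@measurableT_comp _ _ _ _ _ _ (fun w : borelRV R d => w 0 j) _ (fun t => t.2.1)).
    exact: measurable_coord.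
  by apply: measurableT_comp.
- by apply: measurableT_comp.
Qed.

Definition est_error k w := s k w - gm (x k w).

Lemma est_error0 (V : R) : (0 < K)%N ->
  (\int[M]_t (lpnorm p (zc x0 t) ^+ 2)%:E <= V%:E)%E ->
  (\int[P]_w (lpnorm p (est_error 0 w) ^+ 2)%:E <= ((p - 1) / n0%:R * V)%:E)%E.
Proof.
move=> K0 HV; have n00 : (n0%:R : R) != 0 by rewrite pnatr_eq0 -lt0n.
have E w : est_error 0 w = 0 + n0%:R^-1 *: \sum_(j < n0) zc x0 (u 0%N j w : borelRV R d, xi 0%N j w).
  rewrite add0r /zc /= sumrB sumr_const card_ord scalerBr.
  rewrite (scaler_mean _ n00).
  by rewrite /est_error (run_s0 run) (run_x0 run).
under eq_integral do rewrite E.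
apply: le_trans (@expected_minibatch _ _ _ _ _ _ P Pu Pxi K n0 n u xi idx Hs p (past 0) 0 n0 (fun=> 0)
  (fun _ => zc x0) (fun=> V) p2 n0_gt0 _ (@past_used _) _ _ _ _ _ _ _ _) _.
- by move=> j jn /=; rewrite K0.
- by move=> j [].
- by move=> j [].
- exact: measurable_vec_cst.
- exact: (measurable_zc (D := past 0) (y := fun=> x0) (measurable_vec_cst _)).
- exact: measurable_cst.
- by move=> w i; exact: zc_int.
- by move=> w i; exact: zc_mean.
- by [].
by rewrite integral_cstT lpnorm0// expr0n add0r.
Qed.

Lemma est_errorS k (V1 V2 : R) : (k.+1 < K)%N ->
  (forall y z, X y -> X z ->
    \int[M]_t (lpnorm p (zc y t - (1 - alpha) *: zc z t) ^+ 2)%:E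
      <= (V1 + V2 * lpnorm 2 (y - z) ^+ 2)%:E)%E ->
  (\int[P]_w (lpnorm p (est_error k.+1 w) ^+ 2)%:E <=
   \int[P]_w ((1 - alpha) ^+ 2 * lpnorm p (est_error k w) ^+ 2
     + (p - 1) / n%:R * (V1 + V2 * lpnorm 2 (x k.+1 w - x k w) ^+ 2))%:E)%E.
Proof.
move=> kK HV; have n00 : (n%:R : R) != 0 by rewrite pnatr_eq0 -lt0n.
pose psi w t := zc (x k.+1 w) t - (1 - alpha) *: zc (x k w) t.
(* Centring both estimators at their means cancels the deterministic part, which leaves a
   contraction of the old error plus an average of centred terms. *)
have E w : est_error k.+1 w = (1 - alpha) *: est_error k w +
   n%:R^-1 *: \sum_(j < n) psi w (u k.+1 j w : borelRV R d, xi k.+1 j w).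
  rewrite /est_error (run_s run)//.
  have -> : \sum_(j < n) (zo_estimator F nu (x k.+1 w) (u k.+1 j w) (xi k.+1 j w) +
      (1 - alpha) *: (s k w - zo_estimator F nu (x k w) (u k.+1 j w) (xi k.+1 j w))) =
    \sum_(j < n) (psi w (u k.+1 j w : borelRV R d, xi k.+1 j w) +
       (gm (x k.+1 w) + (1 - alpha) *: (s k w - gm (x k w)))).
    by apply: eq_bigr => j _; rewrite /psi /zc /=; apply/rowP => i; rewrite !(mxE, fineK); ring.
  rewrite big_split/= sumr_const card_ord scalerDr (scaler_mean _ n00).
  by rewrite (addrCA _ (gm _)) (addrC (gm _)) addrK addrC.
under eq_integral do rewrite E.
have [mk1 _ _] := run_adapted (ltnW kK) (leqnn k.+1).
have [mk _ /(_ (ltnSn k)) msk] := run_adapted (ltnW kK) (leqnSn k).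
have Xk w : X (x k w) by apply: run_in; rewrite ltnW// ltnW.
have Xk1 w : X (x k.+1 w) by apply: run_in; exact: ltnW.
apply: le_trans (@expected_minibatch _ _ _ _ _ _ P Pu Pxi K n0 n u xi idx Hs p (past k.+1) k.+1 n
  (fun w => (1 - alpha) *: est_error k w) psi
  (fun w => V1 + V2 * lpnorm 2 (x k.+1 w - x k w) ^+ 2) p2 n_gt0 _ (@past_used _) _ _ _ _ _ _ _ _) _.
- by move=> j jn /=; rewrite kK.
- by move=> j [_]; rewrite ltnn.
- by move=> j [_]; rewrite ltnn.
- apply: measurable_vecZ; first exact: measurable_cst.
  by apply: measurable_vecB => //; exact: measurable_zo_mean.
- apply: measurable_vecB; first exact: measurable_zc.
  by apply: measurable_vecZ; [exact: measurable_cst|exact: measurable_zc].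
- apply: measurable_funD; first exact: measurable_cst.
  apply: measurable_funM; first exact: measurable_cst.
  by apply: measurable_funX; apply: measurable_lpnorm; exact: measurable_vecB.
- move=> w i; rewrite /psi; under eq_fun do rewrite mxE EFinD -scaleNr.
  apply: integrableD => //; first exact: zc_int.
  by have [] := integral_coordZ (- (1 - alpha)) (zc_int i (Xk w)).
- move=> w i; rewrite /psi; under eq_integral do rewrite mxE EFinD -scaleNr.
  have [I1 E1] := integral_coordZ (- (1 - alpha)) (zc_int i (Xk w)).
  rewrite integralD//; last exact: zc_int.
  by rewrite E1 !zc_mean// mule0 add0e.
- by move=> w; exact: HV.
rewrite le_eqVlt; apply/orP; left; apply/eqP; apply: eq_integral => w _.
by rewrite lpnormZ// exprMn real_normK ?num_real.
Qed.

End run_theory.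

(** * Averaging over the iterations *)

Section ceilings.
Context {R : realType}.
Implicit Type a : R.

Lemma ceil_nat_ge (N : nat) a : N%:Z = Num.ceil a -> a <= N%:R.
Proof. by move=> H; have := ceil_ge a; rewrite -H. Qed.

Lemma ceil_nat_lt (N : nat) a : N%:Z = Num.ceil a -> N%:R < a + 1.
Proof.
move=> H; have /andP[+ _] := ceil_itv a.
by rewrite -H -ltrBlDr intrB.
Qed.
End ceilings.

Section mean_values.
Context {R : realType} {dT} {T : measurableType dT} (P : probability T R).
Implicit Types f g : T -> R.
Local Notation intg f := (P.-integrable setT (EFin \o (f : T -> R))).

(** Turns an extended-real bound into integrability and an inequality between reals, where linear
    arithmetic is available. *)
Lemma ge0_integrable_le f b : measurable_fun setT f -> (forall t, 0 <= f t) ->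
  (\int[P]_t (f t)%:E <= b%:E)%E -> intg f /\ \int[P]_t f t <= b.
Proof.
move=> mf f0 fb; have f0' : (0 <= \int[P]_t (f t)%:E)%E.
  by apply: integral_ge0 => t _; rewrite lee_fin.
have ff : (\int[P]_t (f t)%:E)%E \is a fin_num.
  by rewrite ge0_fin_numE//; exact: le_lt_trans fb (ltry _).
split; first exact: integrable_of_fin.
by rewrite -lee_fin /Rintegral fineK.
Qed.

Lemma ge0_integrable_bound f b : measurable_fun setT f -> (forall t, 0 <= f t <= b) -> intg f.
Proof.
move=> mf fb; have f0 t : 0 <= f t by case/andP: (fb t).
have [] // := @ge0_integrable_le f b mf f0.
rewrite -(integral_cstT P b); apply: ge0_le_integral => //.
- by move=> t _; rewrite lee_fin.
- exact/measurable_EFinP.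
- by move=> t _; rewrite lee_fin; case/andP: (fb t).
Qed.

Lemma integral_RintegralE f : intg f -> (\int[P]_t (f t)%:E = (\int[P]_t f t)%:E)%E.
Proof. by move=> If; rewrite /Rintegral fineK//; exact: integrable_fin_num. Qed.

Lemma intgD f g : intg f -> intg g -> intg (fun t => f t + g t).
Proof. by move=> If Ig; rewrite (_ : _ \o _ = (EFin \o f) \+ (EFin \o g))%E//; exact: integrableD. Qed.

Lemma intgZ a f : intg f -> intg (fun t => a * f t).
Proof.
move=> If; rewrite (_ : _ \o _ = fun t => (a%:E * (EFin \o f) t)%E); first exact: integrableZl.
by apply/funext => t /=; rewrite EFinM.
Qed.

Lemma intg_cst a : intg (fun=> a).
Proof. exact: finite_measure_integrable_cst. Qed.

Lemma intg_sum N (f : nat -> T -> R) : (forall k, (k < N)%N -> intg (f k)) ->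
  intg (fun t => \sum_(k < N) f k t) /\
  \int[P]_t (\sum_(k < N) f k t) = \sum_(k < N) \int[P]_t f k t.
Proof.
elim: N => [_|N IH If].
  under eq_fun do rewrite big_ord0; split; first exact: intg_cst.
  by rewrite big_ord0 /Rintegral integral0.
have [I1 E1] := IH (fun k kN => If k (ltnW kN)).
have E : (fun t => \sum_(k < N.+1) f k t) = (fun t => \sum_(k < N) f k t + f N t).
  by apply/funext => t; rewrite big_ord_recr.
rewrite E; split; first by apply: intgD => //; exact: If.
by rewrite RintegralD// ?E1 ?big_ord_recr//; exact: If.
Qed.

Lemma Rintegral_cstT a : \int[P]_t (fun=> a) t = a.
Proof. by rewrite /Rintegral integral_cstT. Qed.

End mean_values.

Section averaged_recursion.
Context {R : realType}.

(** Here [eps] stands for the squared accuracy. Summation gives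
    [sum E <= K eps / 60 + V K + (sum D) / 6]; inserted into the descent bound it leaves
    [(1/2 - 5/24) sum D] on the left. The initial error is harmless because [a * K >= 96]: 8/5
    divided by 96 is 1/60. *)
Lemma averaged_recursion (K : nat) (E D e : nat -> R) (a eps V r2 : R) :
  (0 < K)%N -> 0 < a <= 1 -> 0 <= eps -> 96 <= a * K%:R ->
  (forall k, (k < K)%N -> 0 <= E k) -> (forall k, (k < K)%N -> 0 <= D k) ->
  E 0%N <= 8 / 5 * eps ->
  (forall k, (k.+1 < K)%N -> E k.+1 <= (1 - a) ^+ 2 * E k + (a * V + a / 6 * D k)) ->
  (forall k, (k < K)%N -> e k <= 5 / 4 * E k + 5 * r2) ->
  0 <= V -> V <= (1 / 60 + 1 / 36) * eps -> r2 <= eps / 1152 ->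
  (\sum_(k < K) D k) / 2 <= K%:R * eps / 108 + \sum_(k < K) e k ->
  \sum_(k < K) D k <= 31 / 100 * (K%:R * eps) /\ \sum_(k < K) e k <= 146 / 1000 * (K%:R * eps).
Proof.
move=> K0 /andP[a0 a1] eps0 aK E0 D0 E1 ES eE V0 Ve r2e DE.
have K0' : (0 : R) < K%:R by rewrite ltr0n.
have S1 N : (N < K)%N -> a * \sum_(k < N) E k + E N <= E 0%N + \sum_(k < N) (a * V + a / 6 * D k).
  elim: N => [_|N IH NK]; first by rewrite !big_ord0 mulr0 add0r addr0.
  have := IH (ltnW NK); have := ES _ NK; rewrite !big_ord_recr/= mulrDr.
  have EN := E0 N (ltnW NK).
  have : (1 - a) ^+ 2 * E N <= (1 - a) * E N.
    by apply: ler_wpM2r => //; rewrite expr2; apply: ler_piMl; lra.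
  by move: (\sum_(i < N) E i) (\sum_(i < N) _) => A B; rewrite mulrBl mul1r; lra.
have S2 : a * \sum_(k < K) E k <= E 0%N + (a * V * K%:R + a / 6 * \sum_(k < K) D k).
  (* The recursion stops at [K - 1], so the last error enters without the factor [a] and is bounded
     below by [a * E N]. *)
  have [N KN] : exists N, K = N.+1 by exists K.-1; rewrite prednK.
  have NK : (N < K)%N by rewrite KN.
  have := S1 N NK; have EN := E0 N NK; have DN := D0 N NK.
  rewrite big_split/= sumr_const card_ord -mulr_sumr KN !big_ord_recr/= -[_ *+ N]mulr_natr -[N.+1%:R]natr1 => H.
  have h1 : a * E N <= E N by rewrite ler_piMl.
  have h2 : 0 <= a / 6 * D N by rewrite mulr_ge0// divr_ge0// ltW.
  have h3 : 0 <= a * V by rewrite mulr_ge0// ltW.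
  move: H h1 h2 h3; move: (\sum_(i < N) E i) (\sum_(i < N) _) (a * V) (N%:R) => A B w r; rewrite !mulrDr mulr1; lra.
have S3 : \sum_(k < K) e k <= 5 / 4 * \sum_(k < K) E k + 5 * (r2 * K%:R).
  apply: (@le_trans _ _ (\sum_(k < K) (5 / 4 * E k + 5 * r2))).
    by apply: ler_sum => k _; exact: eE.
  by rewrite big_split/= sumr_const card_ord -mulr_sumr -[_ *+ K]mulr_natr mulrA.
have S4 : \sum_(k < K) E k <= K%:R * eps / 60 + V * K%:R + (\sum_(k < K) D k) / 6.
  rewrite -(ler_pM2l a0); apply: le_trans S2 _.
  have : E 0%N <= a * (K%:R * eps / 60).
    apply: le_trans E1 _; rewrite (_ : a * _ = (a * K%:R) * eps / 60); last by ring.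
    by have := ler_wpM2r eps0 aK; lra.
  by rewrite !mulrDr; lra.
have S5 : V * K%:R <= (1 / 60 + 1 / 36) * (K%:R * eps) by rewrite (mulrC V) mulrCA ler_pM2l.
have S6 : r2 * K%:R <= K%:R * eps / 1152 by rewrite (mulrC r2) -mulrA ler_pM2l.
have Ke0 : 0 <= K%:R * eps by rewrite mulr_ge0.
move: S3 S4 S5 S6 DE Ke0.
by move: (\sum_(k < K) E k) (\sum_(k < K) D k) (\sum_(k < K) e k) (K%:R * eps) (V * K%:R) (r2 * K%:R) => *; split; lra.
Qed.
End averaged_recursion.

Lemma convex_setP {R : realType} {d} (X : set 'rV[R]_d) : convex_set X ->
  forall y z (t : R), X y -> X z -> 0 <= t <= 1 -> X (t *: y + (1 - t) *: z).
Proof.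
move=> cX y z t Xy Xz /andP[t0 t1].
have := cX y z (Itv01 t0 t1); rewrite !inE => /(_ Xy Xz); exact.
Qed.

Lemma enlarged_set_sub {R : realType} {d} (X : set 'rV[R]_d) (Pu : probability (borelRV R d) R)
  (nu : R) : X `<=` enlarged_set X Pu nu.
Proof.
move=> x Xx; have [N [mN N0] NP] := msupport_full Pu.
have [u Su] : exists u, msupport Pu u.
  apply: contrapT => H; have NT : N = setT.
    by apply/seteqP; split => // u _; apply: contrapT => /NP Su; apply: H; exists u.
  by move: N0; rewrite NT probability_setT => /eqP; rewrite onee_eq0.
by exists x, 0, u; rewrite lexx ler01; split => //; rewrite mul0r scale0r addr0.
Qed.

Lemma conjugate_exponent {R : realType} (p q : R) : 2 <= p -> p^-1 + q^-1 = 1 -> 1 < q /\ q <= 2.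
Proof.
move=> p2 pq; have p0 : 0 < p by exact: lt_le_trans p2.
have pi0 : 0 < p^-1 by rewrite invr_gt0.
have pi2 : p^-1 <= 1 / 2 by rewrite div1r lef_pV2// posrE.
have qi0 : 0 < q^-1 by lra.
have q0 : 0 < q by rewrite -invr_gt0.
have qq : q * q^-1 = 1 by rewrite mulfV// gt_eqF.
split; first by rewrite -(@ltr_pM2r _ q^-1)// qq mul1r; lra.
by rewrite -(@ler_pM2r _ q^-1)// qq; lra.
Qed.

(** * Consequences of the parameter choices *)

Section parameters.
Context {R : realType}.
Variables (C L_f sigbar eps S_p eta nu U6 L_mu : R).
Hypotheses (C0 : 0 < C) (L_f0 : 0 < L_f) (sigbar0 : 0 < sigbar ^+ 2) (eps0 : 0 < eps) (S0 : 0 < S_p)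
  (eta0 : 0 < eta) (L_mu0 : 0 < L_mu) (U60 : 0 <= U6).
Hypothesis heta : eta ^+ 2 =
    Num.min (1 / (4 * L_mu ^+ 2))
      (Num.min (1 / (96 * L_f ^+ 2))
        (S_p * eps ^+ 2 / (C * L_f ^+ 2 * sigbar ^+ 2))).
Let e20 : 0 < eps ^+ 2. Proof. by rewrite exprn_gt0. Qed.
Let eta20 : 0 < eta ^+ 2. Proof. by rewrite exprn_gt0. Qed.
Let Lf20 : 0 < L_f ^+ 2. Proof. by rewrite exprn_gt0. Qed.

Lemma stepsize_smoothness : L_mu * eta <= 1 / 2.
Proof.
have : eta ^+ 2 <= 1 / (4 * L_mu ^+ 2) by rewrite heta ge_min lexx.
rewrite ler_pdivlMr ?mulr_gt0// => H.
have h0 : 0 <= L_mu * eta by rewrite mulr_ge0// ltW.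
have h1 : (0 : R) <= 1 / 2 by rewrite divr_ge0.
rewrite -ler_sqr ?nnegrE// exprMn.
move: H; move: (L_mu ^+ 2) (eta ^+ 2) => a b; rewrite expr_div_n expr1n => H.
lra.
Qed.

Lemma momentum_range : 0 < 96 * L_f ^+ 2 * eta ^+ 2 <= 1.
Proof.
apply/andP; split; first by apply: mulr_gt0 => //; apply: mulr_gt0.
have : eta ^+ 2 <= 1 / (96 * L_f ^+ 2) by rewrite heta !ge_min lexx orbT.
by rewrite ler_pdivlMr ?mulr_gt0// mulrC.
Qed.

Lemma stepsize_variance : eta ^+ 2 * (C * L_f ^+ 2 * sigbar ^+ 2) <= S_p * eps ^+ 2.
Proof.
have h : 0 < C * L_f ^+ 2 * sigbar ^+ 2 by apply: mulr_gt0 => //; apply: mulr_gt0.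
have : eta ^+ 2 <= S_p * eps ^+ 2 / (C * L_f ^+ 2 * sigbar ^+ 2).
  by rewrite [leLHS]heta !ge_min lexx !orbT.
by rewrite ler_pdivlMr.
Qed.

(** Only the part [3 * eta ^- 2] of the denominator is kept: it gives
    [12 * nu^2 * U6 <= eta^2 * eps^2]. A vanishing [U6], for which the quotient has denominator
    zero, is settled separately since the bias is then zero. *)
Lemma smoothing_bias (b : R) :
  nu ^+ 2 = Num.min (eps ^+ 2 / (4 * (4 * L_f ^+ 2 + 3 * eta ^- 2) * U6)) b ->
  L_f ^+ 2 * nu ^+ 2 * U6 <= L_f ^+ 2 * eta ^+ 2 * eps ^+ 2 / 12.
Proof.
move=> hnu.
have [U0|Un0] := eqVneq U6 0.
  rewrite U0 mulr0; apply: divr_ge0 => //; apply: mulr_ge0; last exact: ltW.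
  by apply: mulr_ge0; exact: ltW.
have Up : 0 < U6 by rewrite lt_def Un0 U60.
have E0 : 0 < eta ^- 2 by rewrite invr_gt0.
have a0 : 0 < 4 * (4 * L_f ^+ 2 + 3 * eta ^- 2).
  by apply: mulr_gt0 => //; apply: addr_gt0; apply: mulr_gt0.
have : nu ^+ 2 <= eps ^+ 2 / (4 * (4 * L_f ^+ 2 + 3 * eta ^- 2) * U6) by rewrite hnu ge_min lexx.
rewrite ler_pdivlMr; last exact: mulr_gt0.
move=> H; have EE : eta ^- 2 * eta ^+ 2 = 1 by rewrite mulVf// gt_eqF.
have N0 := sqr_ge0 nu.
move: N0 H Up E0 EE e20 eta20 Lf20; move: (nu ^+ 2) (eps ^+ 2) (eta ^+ 2) (L_f ^+ 2).
move=> N e2 E2 L2 N0 H Up Ei0 EE e20' E20 L20.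
have H2 : N * U6 * (12 * E2^-1) <= e2.
  apply: le_trans H; rewrite -subr_ge0.
  have -> : N * (4 * (4 * L2 + 3 * E2^-1) * U6) - N * U6 * (12 * E2^-1) = 16 * (N * L2 * U6) by ring.
  by apply: mulr_ge0 => //; apply: mulr_ge0; [apply: mulr_ge0 => //; exact: ltW|exact: ltW].
have H3 := ler_wpM2r (ltW E20) H2.
have E4 : N * U6 * (12 * E2^-1) * E2 = 12 * (N * U6) by rewrite -[LHS]mulrA -(mulrA 12) EE; ring.
rewrite E4 in H3.
have := ler_wpM2l (ltW L20) H3.
have -> : L2 * (12 * (N * U6)) = 12 * (L2 * N * U6) by ring.
have -> : L2 * (e2 * E2) = L2 * E2 * e2 by ring.
by move: (L2 * N * U6) (L2 * E2 * e2) => *; lra.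
Qed.

End parameters.

Lemma ge0_integrable_dom {R : realType} {dT} {T : measurableType dT} (P : probability T R)
    (f g : T -> R) : measurable_fun setT f -> P.-integrable setT (EFin \o g) ->
  (forall t, 0 <= f t <= g t) ->
  P.-integrable setT (EFin \o f) /\ \int[P]_t f t <= \int[P]_t g t.
Proof.
move=> mf Ig fg; apply: ge0_integrable_le => //; first by move=> t; case/andP: (fg t).
rewrite -integral_RintegralE//; apply: ge0_le_integral => //.
- by move=> t _; rewrite lee_fin; case/andP: (fg t).
- exact/measurable_EFinP.
- exact: measurable_int Ig.
- by move=> t _; rewrite lee_fin; case/andP: (fg t).
Qed.

Section variance_arithmetic.
Context {R : realType}.

Lemma momentum_budget (S al sg e2 r2 : R) : 0 < S -> 0 < al ->
  4 * al * sg <= S * e2 / 60 -> 32 * r2 <= al * e2 / 36 ->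
  4 * al * sg / S + 32 * r2 / al <= (1 / 60 + 1 / 36) * e2.
Proof.
move=> S0 a0 h1 h2; rewrite [leRHS]mulrDl; apply: lerD.
  by rewrite ler_pdivrMr//; lra.
by rewrite ler_pdivrMr//; lra.
Qed.

Lemma initial_variance (p1 N A sg e2 r2 : R) : 0 <= p1 -> 0 < N -> 5 * p1 * sg <= N * (4 * e2) ->
  A + e2 / 8 <= 2 * sg -> r2 <= e2 / 1152 -> 0 <= e2 ->
  p1 / N * (A + 8 * r2) <= 8 / 5 * e2.
Proof.
move=> p10 N0 H1 H2 H3 e20; have H4 : A + 8 * r2 <= 2 * sg by lra.
rewrite mulrAC ler_pdivrMr//; apply: le_trans (ler_wpM2l p10 H4) _; lra.
Qed.

(** [k] is [(p - 1) / n]. The batch size makes it at most [1 / S], which cancels at once the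
    smoothness constant of the norm and the factor [S] in the estimator bounds. *)
Lemma step_variance (k S a2 A sg r2 L2 x2 q2 : R) : 0 <= k -> k <= S^-1 -> 1 <= S ->
  0 <= A -> A <= 4 * sg -> 0 <= x2 -> x2 <= q2 -> 0 <= r2 -> 0 <= L2 -> 0 <= a2 ->
  k * (a2 * A + 32 * r2 + 16 * S * L2 * x2) <= 4 * a2 * sg / S + 32 * r2 + 16 * L2 * q2.
Proof.
move=> k0 kS S1 A0 Asg x20 xq r20 L20 a20.
have S0 : 0 < S by lra.
have Si : S^-1 <= 1 by rewrite invf_le1.
have k1 : k <= 1 by lra.
have H1 : k * (a2 * A) <= 4 * a2 * sg / S.
  rewrite (_ : 4 * a2 * sg / S = S^-1 * (a2 * (4 * sg))); last by ring.
  by apply: ler_pM => //; [exact: mulr_ge0|exact: ler_wpM2l].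
have H2 : k * (32 * r2) <= 32 * r2 by apply: ler_piMl => //; apply: mulr_ge0.
have H3 : k * (16 * S * L2 * x2) <= 16 * L2 * q2.
  have kS1 : k * S <= 1 by rewrite -ler_pdivlMr// mul1r.
  rewrite (_ : k * _ = (k * S) * (16 * L2 * x2)); last by ring.
  apply: (@le_trans _ _ (16 * L2 * x2)).
    by apply: ler_piMl => //; apply: mulr_ge0 => //; apply: mulr_ge0.
  by apply: ler_wpM2l => //; apply: mulr_ge0.
by rewrite !mulrDr; apply: lerD => //; exact: lerD.
Qed.

Lemma momentum_budgetE (S al sg b : R) : al != 0 ->
  4 * al ^+ 2 * sg / S + 32 * b = al * (4 * al * sg / S + 32 * b / al).
Proof. by move=> a0; rewrite mulrDr [al * (32 * b / al)]mulrCA mulfV// mulr1; congr (_ + _); ring. Qed.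

Lemma error_split (t b b' a r : R) : 0 <= t -> 0 <= a -> b' ^+ 2 <= r -> b <= b' -> t <= a + b ->
  0 <= b -> t ^+ 2 <= 5 / 4 * a ^+ 2 + 5 * r.
Proof.
move=> t0 a0 br bb tab b0.
have H1 : t ^+ 2 <= (a + b) ^+ 2 by rewrite ler_sqr ?nnegrE// addr_ge0.
have H2 : b ^+ 2 <= b' ^+ 2 by rewrite ler_sqr ?nnegrE//; exact: le_trans bb.
have := sqr_ge0 (a / 2 - 2 * b); lra.
Qed.

(** [mb] is [mu^2 * beta^2]. The third entry of the maximum defining [mu] turns the bounded part
    into 9/40 of [e2]; the second pays for the coefficients of [a] and [b]. *)
Lemma constraint_arith (mb M L a b e2 y : R) : 0 < mb -> 40 * M <= mb * e2 ->
  8 * (2 * L ^+ 2 + 1) <= 3 * mb -> 0 <= a -> 0 <= b ->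
  mb * y <= 9 * M + 3 / 2 * (2 * a + (4 * L ^+ 2 + 1) * b) ->
  y <= 9 / 40 * e2 + 9 / 8 * (a + b).
Proof.
move=> mb0 H1 H2 a0 b0 H; rewrite -(ler_pM2l mb0); apply: le_trans H _.
have L0 := sqr_ge0 L.
have H3 : 2 * a <= 3 / 4 * mb * a by apply: ler_wpM2r => //; lra.
have H4 : (4 * L ^+ 2 + 1) * b <= 3 / 4 * mb * b by apply: ler_wpM2r => //; lra.
by rewrite !mulrDr; lra.
Qed.

Lemma average_gap (g k t e2 : R) : 0 < t -> 108 * g <= k * (t * e2) -> g / t <= k * e2 / 108.
Proof.
move=> t0 H; rewrite ler_pdivrMr//.
rewrite (_ : k * e2 / 108 * t = k * (t * e2) / 108); last by ring.
by rewrite ler_pdivlMr// mulrC.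
Qed.

Lemma small_bias (b e2 : R) : 32 * b <= e2 / 36 -> b <= e2 / 1152.
Proof. lra. Qed.

Lemma double_variance (a b e2 sg : R) : 0 <= e2 -> 8 * a + 4 * b + e2 / 8 <= 2 * sg ->
  16 * a + 8 * b <= 4 * sg.
Proof. lra. Qed.

End variance_arithmetic.

Lemma measurable_output {R : realType} {d : nat} {dX} {Xi : measurableType dX}
    {dW} {W : measurableType dW} (P : probability W R)
    (Pu : probability (borelRV R d) R) (Pxi : probability Xi R) (K n0 n : nat)
    (u : nat -> nat -> {RV P >-> borelRV R d}) (xi : nat -> nat -> {RV P >-> Xi})
    (idx : W -> 'I_K) (g : nat -> W -> R) :
  sampling Pu Pxi n0 n u xi idx ->
  (forall r, (r < K)%N -> measurable_fun setT (g r)) -> measurable_fun setT (fun w => g (idx w) w).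
Proof.
move=> Hs mg.
have -> : (fun w => g (idx w) w) = (fun w => \sum_(r < K) g r w * \1_(idx @^-1` [set r]) w).
  apply/funext => w; rewrite (bigD1 (idx w))//= indicE mem_set// mulr1 big1 ?addr0// => r rw.
  rewrite indicE memNset ?mulr0// => /= E; by rewrite -E eqxx in rw.
apply: measurable_sum => r; apply: measurable_funM; first exact: mg.
by apply: measurable_indic; exact: sampling_idx_meas Hs r.
Qed.

(** * Mean-square bounds at the output *)

Section convergence.
Context {R : realType} {d m : nat} {dX} {Xi : measurableType dX}
  {dW} {W : measurableType dW} (P : probability W R).
Variables (Pu : probability (borelRV R d) R) (Pxi : probability Xi R) (K n0 n : nat).
Variables (u : nat -> nat -> {RV P >-> borelRV R d})
          (xi : nat -> nat -> {RV P >-> Xi}) (idx : W -> 'I_K).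
Variables (X Onu : set 'rV[R]_d) (F : 'rV[R]_d -> Xi -> R) (f : 'rV[R]_d -> R)
  (h : 'rV[R]_d -> \bar R) (c : 'rV[R]_d -> 'rV[R]_m) (v : 'rV[R]_d -> R).
Variables (L_f M_f M_h M_c B L_c L_v sigma beta rho : R).
Variables (p q eps D_X Phi_inf S_p sigbar mu eta alpha nu : R).
Variables (x0 : 'rV[R]_d) (x s : nat -> W -> 'rV[R]_d) (lam : nat -> W -> 'rV[R]_m).
Hypotheses (L_f0 : 0 < L_f) (M_f0 : 0 < M_f) (M_h0 : 0 < M_h) (M_c0 : 0 < M_c)
  (B0 : 0 < B) (beta0 : 0 < beta) (rho0 : 0 < rho).
Hypotheses (p2 : 2 <= p) (pq : p^-1 + q^-1 = 1) (eps0 : 0 < eps).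
Hypothesis F_meas : forall y, measurable_fun setT (F y).
Hypothesis F_C1 : forall z, continuously_differentiable (F^~ z).
Hypothesis f_C1 : continuously_differentiable f.
Hypothesis c_C1 : forall i, continuously_differentiable (fun y => c y 0 i).
Hypothesis h_gtNy : forall y, (-oo < h y)%E.
Hypothesis h_cvx : convex_efun h.
Hypotheses (Onu_open : open Onu) (X_Onu : enlarged_set X Pu nu `<=` Onu).
Hypothesis hA1 : assumption1 q X Onu f h c D_X L_f M_f M_h B M_c L_c Phi_inf.
Hypothesis hA2 : assumption2 Pxi F Onu f sigma.
Hypothesis hA3 : assumption3 Pxi F Onu L_f.
Hypothesis hA4 : assumption4 p Pu S_p.
Hypothesis hA5 : assumption5 p q X v L_v.
Hypothesis X_x0 : X x0.
Hypotheses (mu0 : 0 < mu) (eta0 : 0 < eta) (nu0 : 0 < nu).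
Let L_mu := L_const m L_f M_c B L_c rho mu.
Let r2 := L_f ^+ 2 * nu ^+ 2 * fine (sixth_moment Pu).
Let Delta0 := Delta0_const f h c B Phi_inf rho mu x0.
Hypothesis eta_small : L_mu * eta <= 1 / 2.
Hypothesis alpha01 : 0 < alpha <= 1.
Hypothesis alphaE : alpha = 96 * (L_f ^+ 2 * eta ^+ 2).
Hypothesis alphaK : 96 <= alpha * K%:R.
Hypotheses (K_gt0 : (0 < K)%N) (n_gt0 : (0 < n)%N) (n0_gt0 : (0 < n0)%N).
Hypothesis n_ge : (p - 1) * S_p <= n%:R.
Hypothesis n0_ge : 5 * (p - 1) * sigbar ^+ 2 <= n0%:R * (4 * eps ^+ 2).
Hypothesis K_Delta0 : 108 * Delta0 <= K%:R * (eta * eps ^+ 2).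
Hypothesis K_c0 : 5 * lpnorm 2 (c x0) ^+ 2 <= K%:R * eps ^+ 2.
Hypothesis sigbarE : 8 * S_p * (sigma ^+ 2 + M_f ^+ 2) + 4 * M_f ^+ 2 + eps ^+ 2 / 8 <= 2 * sigbar ^+ 2.
Hypothesis sigbar_eta : 4 * alpha * sigbar ^+ 2 <= S_p * eps ^+ 2 / 60.
Hypothesis r2_le : 32 * r2 <= alpha * eps ^+ 2 / 36.
Hypothesis mu_data : 40 * (M_f ^+ 2 + M_h ^+ 2 + m%:R ^+ 2 * rho ^+ 2 * B ^+ 2 * M_c ^+ 2)
  <= mu ^+ 2 * beta ^+ 2 * eps ^+ 2.
Hypothesis mu_L_v : 8 * (2 * L_v ^+ 2 + 1) <= 3 * (mu ^+ 2 * beta ^+ 2).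
Hypothesis Hs : sampling Pu Pxi n0 n u xi idx.
Hypothesis run : mdlalm_run K n0 n X F h c v mu eta nu alpha (fun _ => rho / K%:R)
    u xi x0 x s lam.
Hypothesis hA6 : assumption6 P p X c beta K x.

Let p0 : 0 < p. Proof. exact: lt_le_trans p2. Qed.
Let p1 : 1 < p. Proof. by apply: lt_le_trans p2; rewrite ltr1n. Qed.
Let q1 : 1 < q. Proof. by have [] := conjugate_exponent p2 pq. Qed.
Let q2 : q <= 2. Proof. by have [] := conjugate_exponent p2 pq. Qed.
Let q0 : 0 < q. Proof. exact: lt_trans q1. Qed.
Let pm1 : 0 <= p - 1. Proof. by rewrite subr_ge0 ltW. Qed.
Let S1 : 1 <= S_p. Proof. by case: hA4. Qed.
Let S0 : 0 < S_p. Proof. exact: lt_le_trans S1. Qed.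
Let Kr0 : (0 : R) < K%:R. Proof. by rewrite ltr0n. Qed.
Let X_sub y : X y -> Onu y. Proof. by move=> Xy; apply: X_Onu; exact: enlarged_set_sub. Qed.
Let X_nonempty := A1_X_nonempty hA1.
Let X_closed := A1_X_closed hA1.
Let X_convex := convex_setP (A1_X_convex hA1).
Let X_bounded y : X y -> lpnorm q y <= D_X.
Proof. by move=> /(A1_X_bounded hA1); rewrite pnormE. Qed.
Let h_fin := subdiff_fin h_gtNy (A1_h_proper hA1) (A1_h_subdiff_nonempty hA1).
Let h_lip := subdiff_lipschitz h_gtNy (A1_h_proper hA1) (A1_h_subdiff_nonempty hA1)
  (A1_h_subdiff_bounded hA1).
Let h_convex y z (t : R) : X y -> X z -> 0 <= t <= 1 ->
  fine (h (t *: y + (1 - t) *: z)) <= t * fine (h y) + (1 - t) * fine (h z).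
Proof.
move=> Xy Xz t01; apply: (subdiff_convex h_gtNy (A1_h_proper hA1) h_cvx (A1_h_subdiff_nonempty hA1)) => //.
exact: X_convex.
Qed.
Let v_diff := A5_v_diff hA5.
Let v_strong y z : lpnorm q (y - z) ^+ 2 <= dotv (y - z) (gradient v y - gradient v z).
Proof. by have := A5_v_strong hA5 y z; rewrite pnormE. Qed.
Let v_smooth y z : X y -> X z -> lpnorm p (gradient v y - gradient v z) <= L_v * lpnorm q (y - z).
Proof. by move=> Xy Xz; have := A5_v_smooth hA5 Xy Xz; rewrite !pnormE. Qed.
Let f_diff y : differentiable f y. Proof. by case: f_C1. Qed.
Let f_bound y : X y -> lpnorm 2 (gradient f y) <= M_f.
Proof.
move=> Xy; apply: (@lpnorm2_gradient_le _ _ _ Onu) => //; first exact: ltW.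
  exact: X_sub.
by move=> z Oz; have := A1_f_lipschitz hA1 Oz (X_sub Xy); rewrite pnormE.
Qed.
Let f_smooth y z : X y -> X z -> lpnorm 2 (gradient f y - gradient f z) <= L_f * lpnorm 2 (y - z).
Proof. by move=> Xy Xz; have := A1_f_smooth hA1 (X_sub Xy) (X_sub Xz); rewrite !pnormE. Qed.
Let c_diff i y : differentiable (fun y => c y 0 i) y.
Proof. by have [H _] := c_C1 i; exact: H. Qed.
Let c_bound := A1_c_bounded hA1.
Let c_grad i y : X y -> lpnorm 2 (gradient (fun y => c y 0 i) y) <= M_c.
Proof. by move=> Xy; have := A1_grad_c_bounded hA1 i Xy; rewrite pnormE. Qed.
Let c_smooth i y z : X y -> X z ->
  lpnorm 2 (gradient (fun z => c z 0 i) y - gradient (fun z => c z 0 i) z) <= L_c * lpnorm 2 (y - z).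
Proof. by move=> Xy Xz; have := A1_c_smooth hA1 i Xy Xz; rewrite !pnormE. Qed.
Let step_in := mirror_step_in eta X_nonempty X_closed X_bounded h_fin h_lip v_diff q1.
Let step_meas := @measurable_mirror_step _ _ _ _ _ _ _ _ _ _ X_nonempty X_closed X_convex X_bounded h_fin
  h_lip h_convex v_diff v_strong eta0 p0 q1 pq.
Let est_meas := @measurable_zo_estimator _ _ _ _ _ nu F_meas F_C1.
Let est_int y i (Xy : X y) := zo_integrable F_meas F_C1 nu0 X_Onu hA2 hA3 hA4 i Xy.
Let xin k w : (k <= K)%N -> X (x k w). Proof. exact: (run_in run X_x0 step_in w). Qed.
Local Notation hist := (history u xi idx (past K n0 n K)).
Local Notation gm := (zo_mean Pxi Pu F nu).

(** Each of at most [K] updates adds at most [rho / K * B]. *)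
Let lam_bound k w i : (k <= K)%N -> `|lam k w 0 i| <= rho * B.
Proof.
move=> kK; suff : `|lam k w 0 i| <= k%:R * (rho / K%:R * B).
  move=> H; apply: le_trans H _.
  rewrite (_ : _ * _ = (k%:R / K%:R) * (rho * B)); last by ring.
  apply: ler_piMl; first by rewrite mulr_ge0// ltW.
  by rewrite ler_pdivrMr// mul1r ler_nat.
elim: k kK => [_|k IH kK]; first by rewrite (run_lam0 run) mxE normr0 mul0r.
rewrite (run_lam run)// !mxE -natr1 mulrDl mul1r.
apply: le_trans (ler_normD _ _) _; apply: lerD; first by apply: IH; exact: ltnW.
have rK : 0 < rho / K%:R by rewrite divr_gt0.
rewrite normrM (gtr0_norm rK) ler_pM2l//.
by apply: c_bound; apply: xin; exact: ltnW.
Qed.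

Let D k w := lpnorm q (x k.+1 w - x k w) ^+ 2 / eta ^+ 2.
Let e k w := lpnorm p (s k w - gradient f (x k w)) ^+ 2.
Let A l y := f y + (dotv l (c y) + mu / 2 * lpnorm 2 (c y) ^+ 2).
Let hr y := fine (h y).

Let dot_c (l : 'rV[R]_m) y b : X y -> 0 <= b -> (forall i, `|l 0 i| <= b) -> `|dotv l (c y)| <= m%:R * (b * B).
Proof.
move=> Xy b0 lb; apply: le_trans (ler_norm_sum _ _ _) _.
apply: (@le_trans _ _ (\sum_(i < m) (b * B))).
  by apply: ler_sum => i _; rewrite normrM ler_pM//; exact: c_bound.
by rewrite sumr_const card_ord mulr_natl.
Qed.

(** The descent inequality holds at a fixed multiplier; passing to the next one changes the
    Lagrangian by [rho / K] times a product of constraint values, so all updates together cost at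
    most [m * rho * B^2]. *)
Let path_sum w N : (N <= K)%N ->
  A (lam N w) (x N w) + hr (x N w) + eta * ((\sum_(k < N) D k w) / 2)
  <= A 0 x0 + hr x0 + eta * (\sum_(k < N) e k w) + N%:R / K%:R * (m%:R * (rho * B * B)).
Proof.
elim: N => [_|N IH NK].
  by rewrite (run_x0 run) (run_lam0 run) !big_ord0 !mul0r !mulr0 !addr0.
have := IH (ltnW NK).
have lb i := lam_bound w i (ltnW NK); have Xx := xin w (ltnW NK); have Xy := xin w NK.
have := step_descent X_nonempty X_closed X_convex X_bounded h_fin h_lip h_convex v_diff v_strong f_diff
  f_smooth c_diff c_bound c_grad c_smooth p2 q1 q2 pq eta0 mu0 eta_small (s N w) Xx lb.
rewrite -(run_x run w NK) -/(D N w) -/(e N w) -/(A _ _) -/(A _ _) -/(hr _) -/(hr _).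
have -> : A (lam N.+1 w) (x N.+1 w) = A (lam N w) (x N.+1 w) + rho / K%:R * dotv (c (x N w)) (c (x N.+1 w)).
  by rewrite (run_lam run)// /A dotvDl dotvZl; ring.
have : rho / K%:R * dotv (c (x N w)) (c (x N.+1 w)) <= 1 / K%:R * (m%:R * (rho * B * B)).
  have -> : 1 / K%:R * (m%:R * (rho * B * B)) = rho / K%:R * (m%:R * (B * B)) by ring.
  rewrite ler_pM2l ?divr_gt0//; apply: le_trans (ler_norm _) _.
  by apply: dot_c => //; [exact: ltW|move=> i; exact: c_bound].
have -> : N.+1%:R / K%:R * (m%:R * (rho * B * B)) =
    N%:R / K%:R * (m%:R * (rho * B * B)) + 1 / K%:R * (m%:R * (rho * B * B)).
  by rewrite -[N.+1%:R]natr1 !mulrDl.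
rewrite !big_ord_recr/=.
move: (A _ _) (A _ _) (A _ _) (hr _) (hr _) (hr _) (D N w) (e N w) (\sum_(i < N) _) (\sum_(i < N) _).
move: (rho / K%:R * _) (1 / K%:R * _) (N%:R / K%:R * _) => a1 a2 a3 a4 a5 a6 a7 a8 a9 a10 a11 a12 a13.
rewrite !mulrDr; lra.
Qed.

Let path_descent w : (\sum_(k < K) D k w) / 2 <= Delta0 / eta + \sum_(k < K) e k w.
Proof.
have := path_sum w (leqnn K); rewrite mulfV ?gt_eqF// mul1r.
have XK := xin w (leqnn K).
have := A1_lower_bound hA1 XK; rewrite (h_fin XK) -EFinD lee_fin -/(hr _).
have rB : 0 <= rho * B by rewrite mulr_ge0// ltW.
have /ler_normlP[+ _] := dot_c XK rB (fun i => lam_bound w i (leqnn K)).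
have c0 : 0 <= mu / 2 * lpnorm 2 (c (x K w)) ^+ 2 by rewrite mulr_ge0 ?sqr_ge0// divr_ge0// ltW.
(* One of the two copies covers the multiplier updates, the other bounds the final multiplier term
   from below. *)
have DE : Delta0 = A 0 x0 + hr x0 - Phi_inf + 2 * (m%:R * (rho * B * B)).
  rewrite /Delta0 /Delta0_const /aug_lagrangian (h_fin X_x0) pnormE -!EFinD /= /A dotv0l add0r.
  by rewrite -/(hr _); ring.
have -> : A (lam K w) (x K w) = f (x K w) +
  (dotv (lam K w) (c (x K w)) + mu / 2 * lpnorm 2 (c (x K w)) ^+ 2) by [].
have E : eta * (Delta0 / eta + \sum_(k < K) e k w) = Delta0 + eta * \sum_(k < K) e k w.
  by rewrite mulrDr mulrCA mulfV ?mulr1// gt_eqF.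
move=> H1 H2 H3; rewrite -(@ler_pM2l _ eta)// E DE.
move: H1 H2 H3 c0; move: (A 0 x0) (mu / 2 * _) (dotv _ _) (m%:R * _) (eta * _) (eta * _) (hr (x K w)) (hr x0) (f _).
by move=> *; lra.
Qed.

Let E k w := lpnorm p (est_error Pu Pxi F nu x s k w) ^+ 2.

Let mx k : (k <= K)%N -> measurable_vec (x k : hist -> _).
Proof. exact: (measurable_x run step_meas c_diff est_meas). Qed.
Let ms k : (k < K)%N -> measurable_vec (s k : hist -> _).
Proof. exact: (measurable_s run step_meas c_diff est_meas). Qed.
Let mlam k : (k <= K)%N -> measurable_vec (lam k : hist -> _).
Proof. exact: (measurable_lam run step_meas c_diff est_meas). Qed.

Let mD k : (k < K)%N -> measurable_fun [set: hist] (D k).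
Proof.
move=> kK; apply: measurable_funM; last exact: measurable_cst.
by apply: measurable_funX; apply: measurable_lpnorm; apply: measurable_vecB; apply: mx => //; exact: ltnW.
Qed.
Let me k : (k < K)%N -> measurable_fun [set: hist] (e k).
Proof.
move=> kK; apply: measurable_funX; apply: measurable_lpnorm; apply: measurable_vecB; first exact: ms.
by apply: measurable_gradient_comp => //; apply: mx; exact: ltnW.
Qed.
Let mE k : (k < K)%N -> measurable_fun [set: hist] (E k).
Proof.
move=> kK; apply: measurable_funX; apply: measurable_lpnorm; apply: measurable_vecB; first exact: ms.
by apply: measurable_zo_mean => //; apply: mx; exact: ltnW.
Qed.
Let D0 k w : 0 <= D k w. Proof. by rewrite /D divr_ge0// sqr_ge0. Qed.
Let e0 k w : 0 <= e k w. Proof. exact: sqr_ge0. Qed.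
Let E0 k w : 0 <= E k w. Proof. exact: sqr_ge0. Qed.
Local Notation intg f := (P.-integrable setT (EFin \o (f : W -> R))).

(** Two points of [X] are within [2 * D_X] in the q-norm; [D_X] serves integrability here and enters
    no final estimate. *)
Let ID k : (k < K)%N -> intg (D k).
Proof.
move=> kK; apply: (@ge0_integrable_bound _ _ _ _ _ ((D_X + D_X) ^+ 2 / eta ^+ 2)).
  exact: (history_fun Hs (mD kK)).
move=> w; rewrite D0/= ler_pM2r ?invr_gt0 ?exprn_gt0//.
have H : lpnorm q (x k.+1 w - x k w) <= D_X + D_X.
  apply: le_trans (ler_lpnormB _ _ q1) _; apply: lerD; apply: X_bounded; apply: xin => //.
  exact: ltnW.
have H0 := lpnorm_ge0 q (x k.+1 w - x k w).
by rewrite ler_sqr ?nnegrE//; exact: le_trans H.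
Qed.

Let al0 : 0 < alpha. Proof. by case/andP: alpha01. Qed.
Let al1 : alpha <= 1. Proof. by case/andP: alpha01. Qed.
Let r20 : 0 <= r2.
Proof.
rewrite /r2; apply: mulr_ge0; first by apply: mulr_ge0; exact: sqr_ge0.
rewrite fine_ge0// /sixth_moment expectationE; apply: integral_ge0 => w _.
by rewrite lee_fin pnormE exprn_ge0// lpnorm_ge0.
Qed.
(** Noise level per step after division by [alpha]. The variance takes 1/60 of [eps^2], which
    explains 23040 = 4 * 96 * 60, and the smoothing bias takes 1/36. *)
Let V := 4 * alpha * sigbar ^+ 2 / S_p + 32 * r2 / alpha.
Let VE : V <= (1 / 60 + 1 / 36) * eps ^+ 2.
Proof. exact: momentum_budget. Qed.
Let V0 : 0 <= V.
Proof.
rewrite /V; apply: addr_ge0; apply: divr_ge0; try exact: ltW.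
  by apply: mulr_ge0; [apply: mulr_ge0 => //; exact: ltW|exact: sqr_ge0].
exact: mulr_ge0.
Qed.
Let r2_small : r2 <= eps ^+ 2 / 1152.
Proof.
have hh : alpha * eps ^+ 2 / 36 <= eps ^+ 2 / 36.
  by rewrite ler_pM2r ?invr_gt0//; apply: ler_piMl => //; exact: sqr_ge0.
exact: small_bias (le_trans r2_le hh).
Qed.

Let pn : (p - 1) / n%:R <= S_p^-1.
Proof. by rewrite ler_pdivrMr ?ltr0n// mulrC ler_pdivlMr. Qed.

Let E_init : intg (E 0%N) /\ \int[P]_w E 0%N w <= 8 / 5 * eps ^+ 2.
Proof.
have := est_error0 Hs run X_x0 est_meas est_int p2 n0_gt0 K_gt0
  (zo_variance F_meas F_C1 p2 nu0 X_Onu f_bound hA2 hA3 hA4 X_x0).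
rewrite -/r2 => H; apply: ge0_integrable_le => //; first exact: (history_fun Hs (mE K_gt0)).
apply: le_trans H _; rewrite lee_fin.
by apply: (initial_variance _ _ n0_ge sigbarE r2_small) => //; rewrite ?ltr0n// sqr_ge0.
Qed.

(** Integrability travels with the bound from one step to the next, starting from the initial batch.
    The coefficient [alpha / 6] is [16 * L_f^2 * eta^2], by the choice of 96 in [alpha]. *)
Let E_step k : (k.+1 < K)%N -> intg (E k) ->
  intg (E k.+1) /\ \int[P]_w E k.+1 w <=
    (1 - alpha) ^+ 2 * (\int[P]_w E k w) + (alpha * V + alpha / 6 * \int[P]_w D k w).
Proof.
move=> kK IE.
have IG : intg (fun w => (1 - alpha) ^+ 2 * E k w + (alpha * V + alpha / 6 * D k w)).
  apply: intgD; first exact: intgZ.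
  by apply: intgD; [exact: intg_cst|apply: intgZ; apply: ID; exact: ltnW].
have HV y z : X y -> X z -> (\int[(Pu \x Pxi)%E]_t (lpnorm p (zo_estimator F nu y t.1 t.2 - gm y
      - (1 - alpha) *: (zo_estimator F nu z t.1 t.2 - gm z)) ^+ 2)%:E
    <= ((alpha ^+ 2 * (16 * S_p * (sigma ^+ 2 + M_f ^+ 2) + 8 * M_f ^+ 2) + 32 * r2)
        + 16 * S_p * L_f ^+ 2 * lpnorm 2 (y - z) ^+ 2)%:E)%E.
  move=> Xy Xz; have a01 : 0 <= alpha <= 1 by rewrite al1 ltW.
  have := zo_diff_variance F_meas F_C1 p2 nu0 L_f0 X_Onu f_bound f_smooth hA2 hA3 hA4 Xy Xz a01.
  by rewrite -/r2 addrAC.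
have H := est_errorS Hs run X_x0 step_in step_meas c_diff est_meas est_int p2 n_gt0 kK HV.
have kK' : (k < K)%N by exact: ltnW.
have A0 : 0 <= 16 * S_p * (sigma ^+ 2 + M_f ^+ 2) + 8 * M_f ^+ 2.
  apply: addr_ge0; last by apply: mulr_ge0 => //; exact: sqr_ge0.
  by apply: mulr_ge0; [apply: mulr_ge0 => //; exact: ltW|apply: addr_ge0; exact: sqr_ge0].
have A4 : 16 * S_p * (sigma ^+ 2 + M_f ^+ 2) + 8 * M_f ^+ 2 <= 4 * sigbar ^+ 2.
  by rewrite -mulrA; apply: double_variance (sqr_ge0 eps) _; rewrite mulrA.
have := @ge0_integrable_le _ _ _ P (E k.+1)
  (\int[P]_w ((1 - alpha) ^+ 2 * E k w + (alpha * V + alpha / 6 * D k w))).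
case.
- exact: (history_fun Hs (mE kK)).
- exact: E0.
- apply: le_trans H _; rewrite -integral_RintegralE//; apply: ge0_le_integral => //.
  + move=> w _; rewrite lee_fin; apply: addr_ge0; first by apply: mulr_ge0; exact: sqr_ge0.
    apply: mulr_ge0; first by apply: divr_ge0.
    apply: addr_ge0; last by apply: mulr_ge0; [exact: mulr_ge0 (mulr_ge0 _ (ltW S0)) (sqr_ge0 _)|exact: sqr_ge0].
    by apply: addr_ge0; [apply: mulr_ge0 => //; exact: sqr_ge0|exact: mulr_ge0].
  + apply/measurable_EFinP; apply: measurable_funD.
      by apply: measurable_funM; [exact: measurable_cst|exact: (history_fun Hs (mE kK'))].
    apply: measurable_funM; first exact: measurable_cst.
    apply: measurable_funD; first exact: measurable_cst.
    apply: measurable_funM; first exact: measurable_cst.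
    apply: measurable_funX; apply: measurable_lpnorm; apply: measurable_vecB => i.
      exact: (history_fun Hs (mx (ltnW kK) i)).
    exact: (history_fun Hs (mx (ltnW kK') i)).
  + exact: measurable_int IG.
  + move=> w _; rewrite lee_fin lerD2l.
    have xq : lpnorm 2 (x k.+1 w - x k w) ^+ 2 <= lpnorm q (x k.+1 w - x k w) ^+ 2.
      by rewrite ler_sqr ?nnegrE ?lpnorm_ge0//; exact: le_lpnorm.
    apply: le_trans (step_variance (divr_ge0 pm1 (ler0n _ n)) pn S1 A0 A4 (sqr_ge0 _) xq r20
      (sqr_ge0 L_f) (sqr_ge0 alpha)) _.
    rewrite le_eqVlt; apply/orP; left; apply/eqP.
    have etan0 : eta != 0 by rewrite gt_eqF.
    have Sn0 : S_p != 0 by rewrite gt_eqF.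
    have an0 : alpha != 0 by rewrite gt_eqF.
    have -> : alpha / 6 * D k w = 16 * L_f ^+ 2 * lpnorm q (x k.+1 w - x k w) ^+ 2.
      by rewrite /D alphaE; field.
    by congr (_ + _); exact: momentum_budgetE.
move=> I1 H1; split => //; apply: le_trans H1 _.
have ID' : intg (fun w => alpha / 6 * D k w) by apply: intgZ; exact: ID.
rewrite RintegralD; [|exact: measurableT|exact: intgZ|by apply: intgD; [exact: intg_cst|]].
rewrite RintegralZl; [|exact: measurableT|exact: IE].
rewrite RintegralD; [|exact: measurableT|exact: intg_cst|exact: ID'].
by rewrite Rintegral_cstT RintegralZl; [|exact: measurableT|exact: ID].
Qed.

Let IE k : (k < K)%N -> intg (E k).
Proof.
elim: k => [_|k IH kK]; first by case: E_init.
by have [] := E_step kK (IH (ltnW kK)).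
Qed.

Let e_le k w : (k < K)%N -> e k w <= 5 / 4 * E k w + 5 * r2.
Proof.
move=> kK; rewrite /e (_ : s k w - gradient f (x k w) =
  est_error Pu Pxi F nu x s k w + (gm (x k w) - gradient f (x k w))); last by rewrite /est_error addrA subrK.
have b1 := zo_bias F_meas F_C1 nu0 X_Onu hA2 hA3 hA4 (xin w (ltnW kK)); rewrite -/r2 in b1.
have b2 := le_lpnorm (gm (x k w) - gradient f (x k w)) (ltr0Sn R 1) p2.
have b3 := ler_lpnormD (est_error Pu Pxi F nu x s k w) (gm (x k w) - gradient f (x k w)) p1.
rewrite /E; move: b1 b2 b3 (lpnorm_ge0 p (gm (x k w) - gradient f (x k w))).
move: (lpnorm_ge0 p (est_error Pu Pxi F nu x s k w)).
move: (lpnorm_ge0 p (est_error Pu Pxi F nu x s k w + (gm (x k w) - gradient f (x k w)))).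
move: (lpnorm p (_ + _)) (lpnorm p (gm _ - _)) (lpnorm 2 _) (lpnorm p _) r2 => t b b' a r.
exact: error_split.
Qed.

Let Ie k : (k < K)%N -> intg (e k) /\ \int[P]_w e k w <= 5 / 4 * (\int[P]_w E k w) + 5 * r2.
Proof.
move=> kK; have I1 : intg (fun w => 5 / 4 * E k w + 5 * r2).
  by apply: intgD; [apply: intgZ; exact: IE|exact: intg_cst].
have [] := ge0_integrable_dom (history_fun Hs (me kK)) I1.
  by move=> w; rewrite e0 e_le.
move=> I2 H; split => //; apply: le_trans H _.
rewrite RintegralD; [|exact: measurableT|by apply: intgZ; exact: IE|exact: intg_cst].
by rewrite Rintegral_cstT RintegralZl; [|exact: measurableT|exact: IE].
Qed.

Let sums : \sum_(k < K) \int[P]_w D k w <= 31 / 100 * (K%:R * eps ^+ 2) /\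
  \sum_(k < K) \int[P]_w e k w <= 146 / 1000 * (K%:R * eps ^+ 2).
Proof.
apply: (@averaged_recursion _ K (fun k => \int[P]_w E k w)
  (fun k => \int[P]_w D k w) (fun k => \int[P]_w e k w) alpha (eps ^+ 2) V r2) => //.
- exact: sqr_ge0.
- by move=> k _; apply: Rintegral_ge0.
- by move=> k _; apply: Rintegral_ge0.
- by case: E_init.
- by move=> k kK; have [] := E_step kK (IE (ltnW kK)).
- by move=> k kK; have [] := Ie kK.
have [ID1 <-] := intg_sum ID.
have [Ie1 <-] := intg_sum (fun k kK => proj1 (Ie kK)).
have IR : intg (fun w => Delta0 / eta + \sum_(k < K) e k w) by apply: intgD => //; exact: intg_cst.
have IL : intg (fun w => 2^-1 * \sum_(k < K) D k w) by exact: intgZ.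
have := le_Rintegral measurableT IL IR (fun w _ => _).
move=> /(_ _) H; have {}H : \int[P]_w (2^-1 * \sum_(k < K) D k w) <= \int[P]_w (Delta0 / eta + \sum_(k < K) e k w).
  by apply: H => w; rewrite mulrC; exact: path_descent.
move: H; rewrite RintegralZl//.
rewrite RintegralD; [|exact: measurableT|exact: intg_cst|exact: Ie1].
rewrite Rintegral_cstT mulrC => H; apply: le_trans H _; rewrite lerD2r.
exact: average_gap.
Qed.

Lemma expected_gradient_mapping :
  (\int[P]_w (lpnorm q (gradient_mapping X h v eta
     (gradient f (x (idx w) w) + jacT c (x (idx w) w) (lam (idx w) w + mu *: c (x (idx w) w)))
     (x (idx w) w)) ^+ 2)%:E <= (eps ^+ 2)%:E)%E.
Proof.
pose g k w := 2 * D k w + 2 * e k w.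
have g0 k w : 0 <= g k w by rewrite /g; apply: addr_ge0; apply: mulr_ge0.
apply: (@le_trans _ _ (\int[P]_w (g (idx w) w)%:E)%E).
  (* Pointwise domination by [g], whose terms are measurable with respect to the history; then the
     output index can be averaged out. *)
  apply: (@ge0_le_integral_off _ _ _ P set0) => //.
  - by move=> w; rewrite lee_fin sqr_ge0.
  - by move=> w; rewrite lee_fin.
  move=> w _; rewrite lee_fin /g /D /e.
  have kK := ltn_ord (idx w); rewrite (run_x run)//.
  exact: (step_gradient_mapping f c mu X_nonempty X_closed X_convex X_bounded h_fin h_lip h_convex
    v_diff v_strong p2 q1 pq eta0).
rewrite (@expected_output _ _ _ _ _ _ P Pu Pxi K n0 n u xi idx Hs (past K n0 n K) g)//; last 3 first.
- exact: past_used.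
- by case.
- move=> k kK; apply: measurable_funD; (apply: measurable_funM; [exact: measurable_cst|]).
    exact: mD.
  exact: me.
have IgE k : (k < K)%N -> (\int[P]_w (g k w)%:E = (2 * (\int[P]_w D k w) + 2 * (\int[P]_w e k w))%:E)%E.
  move=> kK; have [I1 _] := Ie kK; have I2 := ID kK.
  rewrite integral_RintegralE; last by apply: intgD; exact: intgZ.
  rewrite RintegralD; [|exact: measurableT|exact: intgZ|exact: intgZ].
  by rewrite !RintegralZl.
under eq_bigr => k _ do rewrite IgE//.
rewrite sumEFin -EFinM lee_fin big_split/= -!mulr_sumr ler_pdivrMl//.
(* Numerically 2 (0.31 + 0.146) = 0.912, below 1. *)
have [s1 s2] := sums; move: s1 s2 (mulr_ge0 (ltW Kr0) (sqr_ge0 eps)).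
move: (\sum_(i < K) _) (\sum_(i < K) _) (K%:R * _) => *; lra.
Qed.

Let Ic k : (k <= K)%N -> intg (fun w => lpnorm p (c (x k w)) ^+ 2).
Proof.
move=> kK; apply: (@ge0_integrable_bound _ _ _ _ _ (m%:R * (B * B))).
  apply: measurable_funX; apply: measurable_lpnorm => i.
  exact: (history_fun Hs (measurable_c_comp c_diff (mx kK) i)).
move=> w; rewrite sqr_ge0/=; apply: (@le_trans _ _ (lpnorm 2 (c (x k w)) ^+ 2)).
  by rewrite ler_sqr ?nnegrE ?lpnorm_ge0//; exact: le_lpnorm.
rewrite lpnorm2_sqr; apply: le_trans (ler_norm _) _.
by apply: dot_c; [exact: xin|exact: ltW|move=> i; apply: c_bound; exact: xin].
Qed.

Lemma expected_constraint :
  (\int[P]_w (lpnorm p (c (x (idx w) w)) ^+ 2)%:E <= (eps ^+ 2)%:E)%E.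
Proof.
have [N [mN N0 NS]] := hA6.
(* Step [k] controls the constraint at [x^(k+1)], so the indices shift by one: the initial point
   contributes [c x0] itself, and the bound from the last step is kept only because it is
   nonnegative. *)
pose G w := lpnorm 2 (c x0) ^+ 2 + \sum_(k < K) (9 / 40 * eps ^+ 2 + 9 / 8 * (e k w + D k w)).
have T0 k w : 0 <= 9 / 40 * eps ^+ 2 + 9 / 8 * (e k w + D k w).
  by apply: addr_ge0; apply: mulr_ge0; rewrite ?divr_ge0 ?sqr_ge0 ?addr_ge0.
have cG w : ~ N w -> \sum_(k < K) lpnorm p (c (x k w)) ^+ 2 <= G w.
  move=> Nw; have A6 k : (k <= K)%N -> beta * lpnorm p (c (x k w)) <=
      distp p (jacT c (x k w) (c (x k w))) [set - g | g in normal_cone X (x k w)].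
    move=> kK; rewrite -pnormE; apply: contrapT => H; apply: Nw; apply: NS => /= /(_ k kK); exact: H.
  have cS k : (k < K)%N -> lpnorm p (c (x k.+1 w)) ^+ 2 <= 9 / 40 * eps ^+ 2 + 9 / 8 * (e k w + D k w).
    move=> kK; have := A6 k.+1 kK; rewrite (run_x run)// => H.
    have := step_constraint X_nonempty X_closed X_convex X_bounded h_fin h_lip h_convex v_diff v_smooth
      f_bound f_smooth c_diff c_bound c_grad c_smooth p2 q1 q2 eta0 mu0 beta0 rho0 (ltW M_h0) (ltW M_c0)
      (ltW B0) eta_small (xin w (ltnW kK)) (fun i => lam_bound w i (ltnW kK)) H.
    rewrite -(run_x run w kK) -/(D k w) -/(e k w).
    by apply: constraint_arith mu_data mu_L_v _ _ => //; apply: mulr_gt0; exact: exprn_gt0.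
  have [N' KN] : exists N', K = N'.+1 by exists K.-1; rewrite prednK.
  have cS' k : (k < N'.+1)%N -> lpnorm p (c (x k.+1 w)) ^+ 2 <= 9 / 40 * eps ^+ 2 + 9 / 8 * (e k w + D k w).
    by rewrite -KN; exact: cS.
  rewrite /G KN big_ord_recl [X in _ <= _ + X]big_ord_recr/= (run_x0 run); apply: lerD.
    by rewrite ler_sqr ?nnegrE ?lpnorm_ge0//; exact: le_lpnorm.
  rewrite -[leLHS]addr0; apply: lerD => //; apply: ler_sum => k _.
  by apply: cS'; rewrite ltnS ltnW.
have It k : (k < K)%N -> intg (fun w => 9 / 40 * eps ^+ 2 + 9 / 8 * (e k w + D k w)).
  move=> kK; have [I1 _] := Ie kK; have I2 := ID kK.
  by apply: intgD; [exact: intg_cst|apply: intgZ; exact: intgD].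
have [IS ES] := intg_sum It.
have IG : intg G by apply: intgD => //; exact: intg_cst.
have RG : \int[P]_w G w <= K%:R * eps ^+ 2.
  rewrite RintegralD; [|exact: measurableT|exact: intg_cst|exact: IS].
  rewrite Rintegral_cstT ES.
  have Ek (k : 'I_K) : \int[P]_w (9 / 40 * eps ^+ 2 + 9 / 8 * (e k w + D k w)) =
     9 / 40 * eps ^+ 2 + 9 / 8 * (\int[P]_w e k w + \int[P]_w D k w).
    have [I1 _] := Ie (ltn_ord k); have I2 := ID (ltn_ord k).
    rewrite RintegralD; [|exact: measurableT|exact: intg_cst|by apply: intgZ; exact: intgD].
    rewrite Rintegral_cstT RintegralZl; [|exact: measurableT|exact: intgD].
    by rewrite RintegralD.
  under eq_bigr => k _ do rewrite Ek.
  rewrite big_split/= sumr_const card_ord -mulr_sumr big_split/= -[_ *+ K]mulr_natr.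
  (* The initial constraint takes 1/5 by the choice of [K], and 1/5 + 9/40 + 9/8 (0.31 + 0.146) =
     0.938, below 1. *)
  have [s1 s2] := sums; move: s1 s2 K_c0 (mulr_ge0 (ltW Kr0) (sqr_ge0 eps)).
  rewrite -[9 / 40 * _ * _]mulrA (mulrC (eps ^+ 2)).
  move: (\sum_(i < K) _) (\sum_(i < K) _) (K%:R * _) (lpnorm 2 _ ^+ 2) => *; lra.
rewrite (@expected_output _ _ _ _ _ _ P Pu Pxi K n0 n u xi idx Hs (past K n0 n K)
  (fun k w => lpnorm p (c (x k w)) ^+ 2))//; last 4 first.
- exact: past_used.
- by case.
- move=> k kK; apply: measurable_funX; apply: measurable_lpnorm; apply: measurable_c_comp => //.
  by apply: mx; exact: ltnW.
- by move=> k w; exact: sqr_ge0.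
have [Ic1 Ec1] := intg_sum (fun k kK => Ic (ltnW (m := k) (n := K) kK)).
have -> : (\sum_(k < K) \int[P]_w (lpnorm p (c (x k w)) ^+ 2)%:E =
    \sum_(k < K) (\int[P]_w lpnorm p (c (x k w)) ^+ 2)%:E)%E.
  by apply: eq_bigr => k _; rewrite integral_RintegralE//; exact: Ic (ltnW (ltn_ord k)).
rewrite sumEFin -Ec1 -EFinM lee_fin ler_pdivrMl//; apply: le_trans RG.
rewrite -lee_fin -!integral_RintegralE//; apply: (ge0_le_integral_off mN N0).
- by move=> w; rewrite lee_fin sumr_ge0// => k _; exact: sqr_ge0.
- by move=> w; rewrite lee_fin addr_ge0 ?sqr_ge0// sumr_ge0.
- by move=> w Nw; rewrite lee_fin; exact: cG.
Qed.

(** The multiplier in the definition of an epsilon-KKT point has to be a random variable. *)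
Lemma measurable_multiplier i :
  measurable_fun setT (fun w => (lam (idx w) w + mu *: c (x (idx w) w)) 0 i).
Proof.
apply: (measurable_output Hs (g := fun r w => (lam r w + mu *: c (x r w)) 0 i)) => r rK.
apply: (@history_fun _ _ _ _ _ _ _ _ _ _ _ _ _ _ _ Hs _ _ (past K n0 n K)).
move: i; apply: measurable_vecD; first by apply: mlam; exact: ltnW.
apply: measurable_vecZ; first exact: measurable_cst.
by apply: measurable_c_comp => //; apply: mx; exact: ltnW.
Qed.

Lemma output_in w : X (x (idx w) w).
Proof. by apply: xin; exact: ltnW. Qed.

End convergence.

Lemma eq_expectation_off {R : realType} {dT} {T : measurableType dT} (P : probability T R)
    (N : set T) (f g : T -> R) : measurable N -> P N = 0%E ->
  (forall t, ~ N t -> f t = g t) -> ('E_P[f] = 'E_P[g])%E.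
Proof.
by move=> mN N0 fg; rewrite !expectationE; apply: (eq_integral_off mN N0) => t /fg ->.
Qed.

(** * Samples on which F is not continuously differentiable *)

Section modification.
Context {R : realType} {d m : nat} {dX} {Xi : measurableType dX}.
Variables (Pxi : probability Xi R) (F : 'rV[R]_d -> Xi -> R) (N : set Xi).
Hypotheses (mN : measurable N) (N0 : Pxi N = 0%E).
Hypothesis F_meas : forall y, measurable_fun setT (F y).
Hypothesis F_C1 : forall z, ~ N z -> continuously_differentiable (F^~ z).

(** Zero on the exceptional samples, hence smooth for every sample, with the same expectations
    because [N] is null. *)
Definition modification (y : 'rV[R]_d) (z : Xi) : R := F y z * \1_(~` N) z.

Lemma modificationE y z : ~ N z -> modification y z = F y z.
Proof. by move=> Nz; rewrite /modification indicE mem_set// mulr1. Qed.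

Lemma modification_meas y : measurable_fun setT (modification y).
Proof. by apply: measurable_funM => //; apply: measurable_indic; exact: measurableC. Qed.

Lemma modification_C1 z : continuously_differentiable (modification^~ z).
Proof.
have [Nz|Nz] := pselect (N z).
  rewrite (_ : modification^~ z = cst 0); last first.
    by apply/funext => y; rewrite /modification indicE memNset ?mulr0//; exact.
  split; first by move=> y; exact: differentiable_cst.
  rewrite (_ : gradient _ = cst 0); first exact: cst_continuous.
  by apply/funext => y; apply/rowP => i; rewrite !mxE derive_cst.
rewrite (_ : modification^~ z = F^~ z); first exact: F_C1.
by apply/funext => y; exact: modificationE.
Qed.

Lemma modification_gradient y z : ~ N z ->
  stochastic_gradient modification y z = stochastic_gradient F y z.
Proof.
move=> Nz; rewrite /stochastic_gradient; congr (gradient _ _).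
by apply/funext => y'; exact: modificationE.
Qed.

Lemma modification_assumption2 Onu f sigma :
  assumption2 Pxi F Onu f sigma -> assumption2 Pxi modification Onu f sigma.
Proof.
move=> [H1 H2]; split => [y i Oy|y Oy].
  rewrite -(H1 y i Oy) !expectationE; apply: (eq_integral_off mN N0) => z Nz.
  by rewrite modification_gradient.
rewrite (_ : expectation _ _ =
  'E_Pxi[fun z => (pnorm 2 (stochastic_gradient F y z - gradient f y) ^+ 2)%R])%E; first exact: H2.
by apply: (eq_expectation_off mN N0) => z Nz; rewrite modification_gradient.
Qed.

Lemma modification_assumption3 Onu L : assumption3 Pxi F Onu L -> assumption3 Pxi modification Onu L.
Proof.
move=> H y z Oy Oz; rewrite (_ : expectation _ _ = 'E_Pxi[fun t =>
  (pnorm 2 (stochastic_gradient F y t - stochastic_gradient F z t) ^+ 2)%R])%E; first exact: H.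
by apply: (eq_expectation_off mN N0) => t Nt; rewrite !modification_gradient.
Qed.

End modification.

Section runs.
Context {R : realType} {d m : nat} {dX} {Xi : measurableType dX} {dW} {W : measurableType dW}.
Variables (K n0 n : nat) (X : set 'rV[R]_d)
  (h : 'rV[R]_d -> \bar R) (c : 'rV[R]_d -> 'rV[R]_m) (v : 'rV[R]_d -> R).
Variables (mu eta nu alpha : R) (rho_ : nat -> R).
Variables (u : nat -> nat -> W -> 'rV[R]_d) (xi : nat -> nat -> W -> Xi) (x0 : 'rV[R]_d).
Local Notation is_run F := (mdlalm_run K n0 n X F h c v mu eta nu alpha rho_ u xi x0).

(** The given iterates follow [F]; a run for the modified [F] has to be constructed. The components
    are the iterate, the estimator and the multiplier. *)
Fixpoint run_state (F : 'rV[R]_d -> Xi -> R) k w : 'rV[R]_d * 'rV[R]_d * 'rV[R]_m :=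
  match k with
  | 0 => (x0, n0%:R^-1 *: \sum_(j < n0) zo_estimator F nu x0 (u 0 j w) (xi 0 j w), 0)
  | k'.+1 => let: (x, s, l) := run_state F k' w in
      let x' := mirror_step X h v eta (s + jacT c x (l + mu *: c x)) x in
      (x', n%:R^-1 *: \sum_(j < n)
        (zo_estimator F nu x' (u k j w) (xi k j w)
         + (1 - alpha) *: (s - zo_estimator F nu x (u k j w) (xi k j w))),
       l + rho_ k' *: c x)
  end.

Lemma run_exists F : is_run F (fun k w => (run_state F k w).1.1) (fun k w => (run_state F k w).1.2)
  (fun k w => (run_state F k w).2).
Proof.
by split => [w|w|w|k w _|k w _|k w _] //=; case: (run_state F k w) => [[y z] l].
Qed.

(** A run evaluates its function at the drawn samples only, so agreement there determines the same
    path. *)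
Lemma run_agree F F' x s lam x' s' lam' w : is_run F x s lam -> is_run F' x' s' lam' ->
  (forall k j y, (k < K)%N -> (j < batch_size n0 n k)%N -> F y (xi k j w) = F' y (xi k j w)) ->
  forall k, (k <= K)%N -> x k w = x' k w /\ lam k w = lam' k w.
Proof.
move=> r r' FF.
have zE k j y : (k < K)%N -> (j < batch_size n0 n k)%N ->
    zo_estimator F nu y (u k j w) (xi k j w) = zo_estimator F' nu y (u k j w) (xi k j w).
  by move=> kK jk; rewrite /zo_estimator !FF.
have H k : [/\ (k <= K)%N -> x k w = x' k w, (k <= K)%N -> lam k w = lam' k w
    & (k < K)%N -> s k w = s' k w].
  elim: k => [|k [IHx IHl IHs]].
    split => [_|_|K0]; first by rewrite (run_x0 r) (run_x0 r').
      by rewrite (run_lam0 r) (run_lam0 r').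
    rewrite (run_s0 r) (run_s0 r') (run_x0 r) (run_x0 r'); congr (_ *: _).
    by apply: eq_bigr => j _; rewrite zE.
  have Ex : (k.+1 <= K)%N -> x k.+1 w = x' k.+1 w.
    by move=> kK; rewrite (run_x r)// (run_x r')// IHx ?IHl ?IHs// ltnW.
  split => // [kK|kK].
    by rewrite (run_lam r)// (run_lam r')// IHl ?IHx// ltnW.
  rewrite (run_s r)// (run_s r')// Ex; last exact: ltnW.
  rewrite IHs; last exact: ltnW.
  rewrite IHx; last by rewrite ltnW// ltnW.
  by congr (_ *: _); apply: eq_bigr => j _; rewrite !zE.
by move=> k kK; have [Hx Hl _] := H k; split; [exact: Hx|exact: Hl].
Qed.

End runs.

Lemma size_flatten_const (T1 : eqType) (T2 : Type) (f : T1 -> seq T2) (s : seq T1) (a : nat) :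
  (forall i, i \in s -> size (f i) = a) -> size (flatten [seq f i | i <- s]) = (size s * a)%N.
Proof.
elim: s => //= i s IH fa; rewrite size_cat IH ?fa ?mem_head ?mulSn// => j js.
by rewrite fa// in_cons js orbT.
Qed.

Lemma oracle_complexityE {R : realType} {d : nat} {dX} {Xi : measurableType dX} {dW} {W : measurableType dW}
    (K n0 n : nat) (nu : R) (u : nat -> nat -> W -> 'rV[R]_d) (xi : nat -> nat -> W -> Xi)
    (x : nat -> W -> 'rV[R]_d) w : (0 < K)%N ->
  oracle_complexity K n0 n nu u xi x w = (2 * n0 + 4 * n * K.-1)%N.
Proof.
case: K => // K _; rewrite /oracle_complexity /= size_cat.
rewrite (@size_flatten_const _ _ (fun j => zo_queries nu (x 0%N w) (u 0%N j w) (xi 0%N j w)) _ 2)// size_iota.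
rewrite (@size_flatten_const _ _ _ _ (n * 4)%N) ?size_iota; last first.
  move=> k; rewrite mem_iota; case: k => // k _ /=.
  by rewrite (@size_flatten_const _ _ _ _ 4) ?size_iota// => j _; rewrite size_cat.
by congr (_ + _)%N; rewrite mulnC// (mulnC n).
Qed.

(** * Oracle complexity *)

Section complexity.
Context {R : realType}.

Lemma inv_min_le (a b : R) : 0 < a -> 0 < b -> (Num.min a b)^-1 <= a^-1 + b^-1.
Proof.
move=> a0 b0; rewrite minEle; case: ifP => _; first by rewrite lerDl invr_ge0 ltW.
by rewrite lerDr invr_ge0 ltW.
Qed.

Lemma max_le_add (a b : R) : 0 <= a -> 0 <= b -> Num.max a b <= a + b.
Proof. by move=> a0 b0; rewrite ge_max lerDl lerDr a0 b0. Qed.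

(** The parameters are given through their squares; [1 + b] bounds the square root of [b] and keeps
    the final constant polynomial. *)
Lemma le_of_sqr_le (a b i : R) : 0 <= b -> 0 <= i -> a ^+ 2 <= b * i ^+ 2 -> a <= (1 + b) * i.
Proof.
move=> b0 i0 H; have [a0|a0] := ltP a 0; first by apply: le_trans (ltW a0) _; rewrite mulr_ge0// addr_ge0.
rewrite -ler_sqr ?nnegrE ?mulr_ge0 ?addr_ge0//; apply: le_trans H _.
rewrite exprMn; apply: ler_wpM2r; first exact: sqr_ge0.
by have := sqr_ge0 b; lra.
Qed.

Variables (m : nat) (C L_f M_f M_h M_c B L_c L_v sigma beta rho gap : R).

(* For [eps <= 1]: [mu <= (1 + penalty_factor) / eps], [sigbar ^+ 2 <= S * noise_factor],
   [L_mu <= smoothness_factor / eps], [eta ^- 2 <= stepsize_factor / eps ^+ 2] and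
   [K%:R <= iteration_factor / eps ^+ 3], where the number of iterations is [K + 1]. *)
Definition penalty_factor := 10 * (8 * L_v ^+ 2 + 3) / (27 * beta ^+ 2)
  + 8 * (2 * L_v ^+ 2 + 1) / (3 * beta ^+ 2)
  + 40 * (M_f ^+ 2 + M_h ^+ 2 + m%:R ^+ 2 * rho ^+ 2 * B ^+ 2 * M_c ^+ 2) / beta ^+ 2.
Definition noise_factor := 1 / 16 + 4 * (sigma ^+ 2 + M_f ^+ 2) + 2 * M_f ^+ 2.
Definition smoothness_factor :=
  L_f + m%:R * ((1 + penalty_factor) * (M_c ^+ 2 + B * L_c) + rho * B * L_c).
Definition stepsize_factor :=
  4 * smoothness_factor ^+ 2 + 96 * L_f ^+ 2 + C * L_f ^+ 2 * noise_factor.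
Definition iteration_factor := 108 * (`|gap| + 1 / 2 + 2 * m%:R * rho * B ^+ 2) * (1 + stepsize_factor)
  + 5 * (m%:R * B ^+ 2) + stepsize_factor / L_f ^+ 2.
Definition complexity_factor := 2 * (5 / 4 * noise_factor + 1) + 4 * iteration_factor.

Hypotheses (C0 : 0 < C) (L_f0 : 0 < L_f) (B0 : 0 < B) (L_c0 : 0 < L_c) (rho0 : 0 < rho).
Variables (p eps S sigbar mu eta D c2 L_mu : R) (K n0 n : nat).
Hypotheses (p2 : 2 <= p) (eps0 : 0 < eps) (eps1 : eps <= 1) (S1 : 1 <= S).
Hypotheses (eta0 : 0 < eta) (L_mu0 : 0 < L_mu).
Hypothesis L_muE : L_mu = L_const m L_f M_c B L_c rho mu.
Hypothesis hsigbar : sigbar ^+ 2 =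
    eps ^+ 2 / 16 + 4 * S * (sigma ^+ 2 + M_f ^+ 2) + 2 * M_f ^+ 2.
Hypothesis hmu : mu ^+ 2 =
    Num.max (10 * (8 * L_v ^+ 2 + 3) / (27 * beta ^+ 2))
      (Num.max (8 * (2 * L_v ^+ 2 + 1) / (3 * beta ^+ 2))
        (40 * (M_f ^+ 2 + M_h ^+ 2
               + m%:R ^+ 2 * rho ^+ 2 * B ^+ 2 * M_c ^+ 2)
         / (beta ^+ 2 * eps ^+ 2))).
Hypothesis heta : eta ^+ 2 =
    Num.min (1 / (4 * L_mu ^+ 2))
      (Num.min (1 / (96 * L_f ^+ 2))
        (S * eps ^+ 2 / (C * L_f ^+ 2 * sigbar ^+ 2))).
Hypothesis hn0 : n0%:R <= 5 * (p - 1) * sigbar ^+ 2 / (4 * eps ^+ 2) + 1.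
Hypothesis hn : n%:R <= (p - 1) * S + 1.
Hypothesis hK : K%:R <=
    Num.max (108 * D / (eta * eps ^+ 2))
      (Num.max (5 * c2 / eps ^+ 2) (1 / (L_f ^+ 2 * eta ^+ 2))).
Hypotheses (c20 : 0 <= c2) (c2B : c2 <= m%:R * B ^+ 2).
Hypothesis hD : D <= `|gap| + 1 / 2 + 2 * m%:R * rho * B ^+ 2.

Let i := eps^-1.
Let i0 : 0 < i. Proof. by rewrite invr_gt0. Qed.
Let i1 : 1 <= i. Proof. by rewrite invf_ge1. Qed.
Let i2 : 1 <= i ^+ 2. Proof. exact: exprn_ege1. Qed.
Let i3 : 1 <= i ^+ 3. Proof. exact: exprn_ege1. Qed.
Let i23 : i ^+ 2 <= i ^+ 3. Proof. by rewrite exprS ler_peMl// sqr_ge0. Qed.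
Let S0 : 0 < S. Proof. exact: lt_le_trans S1. Qed.
Let L20 : 0 < L_f ^+ 2. Proof. exact: exprn_gt0. Qed.
Let e20 : 0 < eps ^+ 2. Proof. exact: exprn_gt0. Qed.

Let A1 : 0 <= 10 * (8 * L_v ^+ 2 + 3) / (27 * beta ^+ 2).
Proof. by apply: divr_ge0; nneg. Qed.
Let A2 : 0 <= 8 * (2 * L_v ^+ 2 + 1) / (3 * beta ^+ 2).
Proof. by apply: divr_ge0; nneg. Qed.
Let A3 : 0 <= 40 * (M_f ^+ 2 + M_h ^+ 2 + m%:R ^+ 2 * rho ^+ 2 * B ^+ 2 * M_c ^+ 2) / beta ^+ 2.
Proof. by apply: divr_ge0; nneg. Qed.
Let pf0 : 0 <= penalty_factor.
Proof. by rewrite /penalty_factor; apply: addr_ge0 => //; exact: addr_ge0. Qed.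
Let nf0 : 0 <= noise_factor. Proof. by rewrite /noise_factor; nneg. Qed.
Let sf0 : 0 <= smoothness_factor.
Proof.
rewrite /smoothness_factor; apply: addr_ge0; first exact: ltW.
apply: mulr_ge0 => //; apply: addr_ge0; last by do ![apply: mulr_ge0 => //]; exact: ltW.
apply: mulr_ge0; first exact: addr_ge0.
by apply: addr_ge0; [exact: sqr_ge0|apply: mulr_ge0; exact: ltW].
Qed.

Let mu_le : mu <= (1 + penalty_factor) * i.
Proof.
apply: le_of_sqr_le => //; first exact: ltW.
rewrite hmu; apply: le_trans (max_le_add A1 _) _.
  by rewrite le_max A2.
have A3' : 0 <= 40 * (M_f ^+ 2 + M_h ^+ 2 + m%:R ^+ 2 * rho ^+ 2 * B ^+ 2 * M_c ^+ 2)
    / (beta ^+ 2 * eps ^+ 2).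
  by rewrite invfM mulrA; apply: mulr_ge0 => //; rewrite invr_ge0 ltW.
apply: le_trans (lerD (lexx _) (max_le_add A2 A3')) _.
have -> : 40 * (M_f ^+ 2 + M_h ^+ 2 + m%:R ^+ 2 * rho ^+ 2 * B ^+ 2 * M_c ^+ 2)
    / (beta ^+ 2 * eps ^+ 2) = 40 * (M_f ^+ 2 + M_h ^+ 2 + m%:R ^+ 2 * rho ^+ 2 * B ^+ 2 * M_c ^+ 2)
    / beta ^+ 2 * i ^+ 2 by rewrite /i exprVn invfM mulrA.
rewrite /penalty_factor.
move: A1 A2 A3; move: (10 * _ / _) (8 * _ / _) (40 * _ / _) => a b c a0 b0 c0.
have := ler_wpM2l a0 i2; have := ler_wpM2l b0 i2; rewrite !mulrDl !mulr1; lra.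
Qed.

Let L_mu_le : L_mu <= smoothness_factor * i.
Proof.
rewrite L_muE /L_const /smoothness_factor [leRHS]mulrDl; apply: lerD; first by rewrite ler_peMr// ltW.
rewrite -[leRHS]mulrA; apply: ler_wpM2l => //; rewrite [leRHS]mulrDl; apply: lerD.
  rewrite -(mulrA mu B) -mulrDr mulrAC; apply: ler_wpM2r => //.
  by apply: addr_ge0; [exact: sqr_ge0|apply: mulr_ge0; exact: ltW].
by apply: ler_peMr => //; do ![apply: mulr_ge0 => //]; exact: ltW.
Qed.

Let sig_le : sigbar ^+ 2 <= S * noise_factor.
Proof.
rewrite hsigbar /noise_factor.
have e1 : eps ^+ 2 <= 1 by apply: exprn_ile1 => //; exact: ltW.
have M0 := sqr_ge0 M_f; have s0 := sqr_ge0 sigma.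
have h1 := ler_wpM2r M0 S1; rewrite mul1r in h1.
rewrite !mulrDr; move: h1; move: (S * M_f ^+ 2) (M_f ^+ 2) (sigma ^+ 2) (eps ^+ 2) e1 => a b s e e1 h1.
by have := S1; lra.
Qed.

Let sig0 : 0 < sigbar ^+ 2.
Proof.
rewrite hsigbar; apply: ltr_pwDl; last by nneg.
apply: ltr_pwDl; first by rewrite divr_gt0.
by apply: mulr_ge0; [apply: mulr_ge0 => //; exact: ltW|nneg].
Qed.

(** In the third entry of the minimum the factor [S] cancels against
    [sigbar ^+ 2 <= S * noise_factor], so the order of [eta] does not depend on [p] or [S]. *)
Let eta_le : eta ^- 2 <= stepsize_factor * i ^+ 2.
Proof.
rewrite heta /stepsize_factor.
have a1 : 0 < 1 / (4 * L_mu ^+ 2) by rewrite divr_gt0// mulr_gt0// exprn_gt0.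
have a2 : 0 < 1 / (96 * L_f ^+ 2) by rewrite divr_gt0// mulr_gt0.
have a3 : 0 < S * eps ^+ 2 / (C * L_f ^+ 2 * sigbar ^+ 2).
  by apply: divr_gt0; [exact: mulr_gt0|apply: mulr_gt0 => //; exact: mulr_gt0].
have a23 : 0 < Num.min (1 / (96 * L_f ^+ 2)) (S * eps ^+ 2 / (C * L_f ^+ 2 * sigbar ^+ 2)).
  by rewrite lt_min a2 a3.
apply: le_trans (inv_min_le a1 a23) _.
apply: le_trans (lerD (lexx _) (inv_min_le a2 a3)) _.
rewrite !div1r !invrK addrA !(mulrDl _ _ (i ^+ 2)); apply: lerD; first apply: lerD.
- rewrite -[leRHS]mulrA -exprMn ler_pM2l// ler_sqr ?nnegrE//; first exact: ltW.
  by apply: mulr_ge0 => //; exact: ltW.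
- by rewrite ler_peMr// ltW// mulr_gt0.
rewrite invf_div ler_pdivrMr ?mulr_gt0//.
have -> : C * L_f ^+ 2 * noise_factor * i ^+ 2 * (S * eps ^+ 2) =
    C * L_f ^+ 2 * (S * noise_factor) * (i ^+ 2 * eps ^+ 2) by ring.
have -> : i ^+ 2 * eps ^+ 2 = 1 by rewrite -exprMn mulVf ?expr1n// gt_eqF.
by rewrite mulr1 ler_pM2l// mulr_gt0.
Qed.

Let st0 : 0 <= stepsize_factor.
Proof.
rewrite /stepsize_factor; apply: addr_ge0; first by nneg.
by apply: mulr_ge0 => //; apply: mulr_ge0; exact: ltW.
Qed.

Let etai_le : eta^-1 <= (1 + stepsize_factor) * i.
Proof. apply: le_of_sqr_le => //; first exact: ltW.
by rewrite exprVn. Qed.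

Let D'0 : 0 <= `|gap| + 1 / 2 + 2 * m%:R * rho * B ^+ 2.
Proof.
apply: addr_ge0; first by rewrite addr_ge0// divr_ge0.
by apply: mulr_ge0; [apply: mulr_ge0; [exact: mulr_ge0|exact: ltW]|exact: sqr_ge0].
Qed.

Let K_le : K%:R <= iteration_factor * i ^+ 3.
Proof.
apply: le_trans hK _; rewrite /iteration_factor.
have hD' := hD; have D0' := D'0; move: hD' D0'.
set D' := `|gap| + 1 / 2 + 2 * m%:R * rho * B ^+ 2 => hD' D0'.
have t1 : 108 * D / (eta * eps ^+ 2) <= 108 * D' * (1 + stepsize_factor) * i ^+ 3.
  rewrite invfM -exprVn -/i.
  have E : 108 * D' * (1 + stepsize_factor) * i ^+ 3 = (108 * D') * (((1 + stepsize_factor) * i) * i ^+ 2) by ring.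
  rewrite E; have h0 : 0 <= eta^-1 * i ^+ 2 by rewrite mulr_ge0 ?sqr_ge0// invr_ge0 ltW.
  apply: (@le_trans _ _ (108 * D' * (eta^-1 * i ^+ 2))).
    by apply: ler_wpM2r => //; rewrite ler_pM2l.
  by apply: ler_wpM2l; [exact: mulr_ge0|apply: ler_wpM2r => //; exact: sqr_ge0].
have t2 : 5 * c2 / eps ^+ 2 <= 5 * (m%:R * B ^+ 2) * i ^+ 3.
  rewrite -exprVn -/i; apply: ler_pM => //; first exact: mulr_ge0.
    exact: sqr_ge0.
  by rewrite ler_pM2l.
have t3 : 1 / (L_f ^+ 2 * eta ^+ 2) <= stepsize_factor / L_f ^+ 2 * i ^+ 3.
  rewrite div1r invfM mulrC mulrAC ler_pM2r ?invr_gt0//.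
  by apply: le_trans eta_le _; exact: ler_wpM2l.
have q1 : 0 <= 108 * D' * (1 + stepsize_factor) * i ^+ 3.
  apply: mulr_ge0; last exact: ltW (lt_le_trans ltr01 i3).
  by apply: mulr_ge0; [exact: mulr_ge0|exact: addr_ge0].
have q2 : 0 <= 5 * (m%:R * B ^+ 2) * i ^+ 3.
  by apply: le_trans t2; apply: divr_ge0; [exact: mulr_ge0|exact: sqr_ge0].
have q3 : 0 <= stepsize_factor / L_f ^+ 2 * i ^+ 3.
  by apply: le_trans t3; rewrite divr_ge0// mulr_ge0// sqr_ge0.
rewrite !(mulrDl _ _ (i ^+ 3)) !ge_max; apply/and3P; split.
- by apply: le_trans t1 _; rewrite -addrA lerDl addr_ge0.
- by apply: le_trans t2 _; rewrite addrAC lerDr addr_ge0.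
- by apply: le_trans t3 _; rewrite lerDr addr_ge0.
Qed.

(** The batches contribute [n <= (p - 1) S + 1 <= p S] and the iterations [eps ^- 3]; the initial
    batch is only of order [p S eps ^- 2]. *)
Lemma complexity_bound : (2 * n0 + 4 * n * K)%:R <= complexity_factor * (p * S * eps ^- 3).
Proof.
rewrite -exprVn -/i natrD !natrM.
have p0 : 0 < p by apply: lt_le_trans p2.
have nle : n%:R <= p * S by apply: le_trans hn _; have := S1; lra.
have if0 : 0 <= iteration_factor.
  have : 0 <= iteration_factor * i ^+ 3 by apply: le_trans K_le.
  by rewrite pmulr_lge0//; exact: lt_le_trans ltr01 i3.
have h1 : 4 * n%:R * K%:R <= 4 * iteration_factor * (p * S * i ^+ 3).
  have -> : 4 * iteration_factor * (p * S * i ^+ 3) = 4 * (p * S) * (iteration_factor * i ^+ 3) by ring.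
  apply: ler_pM; [exact: mulr_ge0|exact: ler0n| |exact: K_le].
  by rewrite ler_pM2l.
have pS1 : 1 <= p * S.
  by apply: mulr_ege1 => //; apply: le_trans p2; rewrite ler1n.
have h2 : n0%:R <= (5 / 4 * noise_factor + 1) * (p * S * i ^+ 3).
  apply: le_trans hn0 _; rewrite [leRHS]mulrDl mul1r; apply: lerD; last first.
    by rewrite -[leLHS]mulr1; apply: ler_pM.
  have -> : 5 * (p - 1) * sigbar ^+ 2 / (4 * eps ^+ 2) = 5 / 4 * ((p - 1) * sigbar ^+ 2 * i ^+ 2).
    by rewrite /i exprVn; field; rewrite gt_eqF.
  have -> : 5 / 4 * noise_factor * (p * S * i ^+ 3) = 5 / 4 * (p * (S * noise_factor) * i ^+ 3) by ring.
  apply: ler_wpM2l; first by rewrite divr_ge0.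
  have pm : 0 <= p - 1 by rewrite subr_ge0; apply: le_trans p2; rewrite ler1n.
  apply: ler_pM => //; [by apply: mulr_ge0 => //; exact: ltW|exact: sqr_ge0|].
  by apply: ler_pM => //; [exact: ltW|rewrite lerBlDr lerDl].
rewrite /complexity_factor [leRHS]mulrDl; apply: lerD => //.
by rewrite -mulrA ler_pM2l.
Qed.

End complexity.

Lemma sampled_off_null {R : realType} {d : nat} {dX} {Xi : measurableType dX}
    {dW} {W : measurableType dW} (P : probability W R)
    (Pu : probability (borelRV R d) R) (Pxi : probability Xi R) (K n0 n : nat)
    (u : nat -> nat -> {RV P >-> borelRV R d}) (xi : nat -> nat -> {RV P >-> Xi})
    (idx : W -> 'I_K) (N : set Xi) :
  sampling Pu Pxi n0 n u xi idx -> measurable N -> Pxi N = 0%E ->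
  exists M : set W, [/\ measurable M, P M = 0%E & forall w, ~ M w ->
    forall k j, (k < K)%N -> (j < batch_size n0 n k)%N -> ~ N (xi k j w)].
Proof.
move=> Hs mN N0.
pose A k j := if (k < K)%N && (j < batch_size n0 n k)%N then xi k j @^-1` N else set0.
have mA k j : measurable (A k j).
  by rewrite /A; case: ifP => // _; exact: measurable_funPTI.
have A0 k j : P (A k j) = 0%E.
  rewrite /A; case: ifP => [kj|_]; last exact: measure0.
  by have := sampling_xi Hs (k := k) (j := j) kj mN; rewrite N0.
have mM : measurable (\bigcup_k \bigcup_j A k j).
  by apply: bigcupT_measurable => k; exact: bigcupT_measurable.
exists (\bigcup_k \bigcup_j A k j); split => //.
  apply: measure_negligible => //; apply: negligible_bigcup => k; apply: negligible_bigcup => j.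
  by exists (A k j); split => //; exact: A0.
move=> w Mw k j kK jn Nw; apply: Mw; exists k => //; exists j => //.
by rewrite /A kK jn.
Qed.

(** Near-feasibility of the starting point makes the penalty [mu / 2 * |c x0|^2] at most 1/2, so
    that the growth of [mu] like [1 / eps] does not reach [Delta_0]. *)
Lemma Delta0_const_le {R : realType} {d m : nat} (f : 'rV[R]_d -> R) (h : 'rV[R]_d -> \bar R)
    (c : 'rV[R]_d -> 'rV[R]_m) (B Phi_inf rho mu gap : R) (x0 : 'rV[R]_d) :
  h x0 = (fine (h x0))%:E -> 0 < mu -> lpnorm 2 (c x0) ^+ 2 <= 1 / mu ->
  fine ((f x0)%:E + h x0)%E - Phi_inf = gap ->
  Delta0_const f h c B Phi_inf rho mu x0 <= `|gap| + 1 / 2 + 2 * m%:R * rho * B ^+ 2.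
Proof.
move=> hx mu0 cmu hgap; rewrite /Delta0_const lerD2r /aug_lagrangian dotv0l add0r pnormE.
rewrite ler_pdivlMr// in cmu.
have := ler_norm gap; rewrite -hgap hx/=; move: cmu.
move: (lpnorm 2 (c x0) ^+ 2) (fine (h x0)) (f x0) `|_ - _| => a b b' g cmu hg; lra.
Qed.

Lemma lpnorm2_sqr_le {R : realType} {m : nat} (y : 'rV[R]_m) (B : R) :
  (forall i, `|y 0 i| <= B) -> lpnorm 2 y ^+ 2 <= m%:R * B ^+ 2.
Proof.
move=> yB; rewrite lpnorm2_sqr /dotv mulr_natl -[X in _ *+ X]card_ord -sumr_const.
apply: ler_sum => i _; rewrite -expr2 -real_normK ?num_real//.
by rewrite ler_sqr ?nnegrE//; exact: le_trans (yB i).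
Qed.

Lemma scaled_bias {R : realType} (a b : R) : a <= b / 12 -> 32 * a <= 96 * b / 36.
Proof. by move=> ab; lra. Qed.

Theorem theorem5p3 (R : realType) (m : nat)
  (L_f M_f M_h M_c Mbar_c L_c L_v sigma beta rho gap : R)
  (hm : (1 <= m)%N)
  (hL_f : 0 < L_f) (hM_f : 0 < M_f) (hM_h : 0 < M_h) (hM_c : 0 < M_c)
  (hMbar_c : 0 < Mbar_c) (hL_c : 0 < L_c) (hsigma : 0 < sigma)
  (hbeta : 0 < beta) (hrho : 0 < rho) :
  exists C : R,
  forall (d : nat) (p q eps : R)
    (dX : measure_display) (Xi : measurableType dX) (Pxi : probability Xi R)
    (Pu : probability (borelRV R d) R)
    (X Onu : set 'rV[R]_d) (F : 'rV[R]_d -> Xi -> R) (f : 'rV[R]_d -> R)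
    (h : 'rV[R]_d -> \bar R) (c : 'rV[R]_d -> 'rV[R]_m) (v : 'rV[R]_d -> R)
    (D_X Phi_inf S_p sigbar mu eta alpha nu : R) (K n0 n : nat)
    (x0 : 'rV[R]_d)
    (dW : measure_display) (W : measurableType dW) (P : probability W R)
    (u : nat -> nat -> {RV P >-> borelRV R d})
    (xi : nat -> nat -> {RV P >-> Xi}) (idx : W -> 'I_K)
    (x s : nat -> W -> 'rV[R]_d) (lam : nat -> W -> 'rV[R]_m),
  let L_mu := L_const m L_f M_c Mbar_c L_c rho mu in
  let Delta_0 := Delta0_const f h c Mbar_c Phi_inf rho mu x0 in
  let U6 := fine (sixth_moment Pu) in
  (3 <= d)%N ->
  2 <= p <= 2 * ln d%:R ->
  p^-1 + q^-1 = 1 ->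
  0 < eps ->
  standing_assumptions Pxi F f h c ->
  open Onu -> enlarged_set X Pu nu `<=` Onu ->
  0 < D_X ->
  assumption1 q X Onu f h c D_X L_f M_f M_h Mbar_c M_c L_c Phi_inf ->
  assumption2 Pxi F Onu f sigma ->
  assumption3 Pxi F Onu L_f ->
  assumption4 p Pu S_p ->
  assumption5 p q X v L_v ->
  X x0 ->
  fine ((f x0)%:E + h x0)%E - Phi_inf = gap ->
  0 < mu -> 0 < eta -> 0 < nu ->
  sigbar ^+ 2 =
    eps ^+ 2 / 16 + 4 * S_p * (sigma ^+ 2 + M_f ^+ 2) + 2 * M_f ^+ 2 ->
  mu ^+ 2 =
    Num.max (10 * (8 * L_v ^+ 2 + 3) / (27 * beta ^+ 2))
      (Num.max (8 * (2 * L_v ^+ 2 + 1) / (3 * beta ^+ 2))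
        (40 * (M_f ^+ 2 + M_h ^+ 2
               + m%:R ^+ 2 * rho ^+ 2 * Mbar_c ^+ 2 * M_c ^+ 2)
         / (beta ^+ 2 * eps ^+ 2))) ->
  eta ^+ 2 =
    Num.min (1 / (4 * L_mu ^+ 2))
      (Num.min (1 / (96 * L_f ^+ 2))
        (S_p * eps ^+ 2 / (23040 * L_f ^+ 2 * sigbar ^+ 2))) ->
  alpha = 96 * L_f ^+ 2 * eta ^+ 2 ->
  n0%:Z = Num.ceil (5 * (p - 1) * sigbar ^+ 2 / (4 * eps ^+ 2)) ->
  n%:Z = Num.ceil ((p - 1) * S_p) ->
  nu ^+ 2 =
    Num.min (eps ^+ 2 / (4 * (4 * L_f ^+ 2 + 3 * eta ^- 2) * U6))
      (beta ^+ 2 * mu ^+ 2 * eta ^+ 2 * eps ^+ 2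
       / (20 * (2 * L_v ^+ 2 + 1) * U6)) ->
  K%:Z = Num.ceil
    (Num.max (108 * Delta_0 / (eta * eps ^+ 2))
      (Num.max (5 * pnorm 2 (c x0) ^+ 2 / eps ^+ 2)
        (1 / (L_f ^+ 2 * eta ^+ 2)))) ->
  rho / K%:R < mu ->
  sampling Pu Pxi n0 n u xi idx ->
  mdlalm_run K n0 n X F h c v mu eta nu alpha (fun _ => rho / K%:R)
    u xi x0 x s lam ->
  assumption6 P p X c beta K x ->
  pnorm 2 (c x0) ^+ 2 <= 1 / mu ->
  eps_KKT P X f h c v p q eta eps (fun w => x (idx w) w) /\
  (eps <= 1 ->
   forall w, (oracle_complexity K n0 n nu u xi x w)%:R
               <= C * (p * S_p * eps ^- 3)).
Proof.
exists (complexity_factor m 23040 L_f M_f M_h M_c Mbar_c L_c L_v sigma beta rho gap).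
move=> d p q eps dX Xi Pxi Pu X Onu F f h c v D_X Phi_inf S_p sigbar mu eta alpha nu K n0 n x0.
move=> dW W P u xi idx x s lam L_mu Delta_0 U6 _ /andP[p2 _] pq eps0.
move=> [F_meas _ [N [mN N0 NF]] f_C1 c_C1 h_gtNy h_cvx] Onu_open X_Onu _ hA1 hA2 hA3 hA4 hA5.
move=> X_x0 hgap mu0 eta0 nu0 hsigbar hmu heta halpha hn0 hn hnu hK _ Hs run hA6.
rewrite pnormE => cmu; rewrite pnormE in hK.
have S1 : 1 <= S_p by case: hA4.
have S0 : 0 < S_p by exact: lt_le_trans S1.
have C0 : (0 : R) < 23040 by rewrite ltr0n.
have e20 : 0 < eps ^+ 2 by exact: exprn_gt0.
have L20 : 0 < L_f ^+ 2 by exact: exprn_gt0.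
have E20 : 0 < eta ^+ 2 by exact: exprn_gt0.
have b20 : 0 < beta ^+ 2 by exact: exprn_gt0.
have pm1 : 0 < p - 1 by rewrite subr_gt0; apply: lt_le_trans p2; rewrite ltr1n.
have sig0 : 0 < sigbar ^+ 2.
  rewrite hsigbar; have M0 := exprn_gt0 2 hM_f.
  apply: addr_gt0; last exact: mulr_gt0.
  apply: addr_gt0; first exact: divr_gt0.
  by apply: mulr_gt0; [exact: mulr_gt0|apply: addr_gt0 => //; exact: exprn_gt0].
have L_mu0 : 0 < L_mu.
  apply: ltr_pwDl => //; apply: mulr_ge0 => //.
  by do ![apply: addr_ge0 | apply: mulr_ge0 => //; try exact: ltW | exact: sqr_ge0].
have U60 : 0 <= U6.
  by apply: fine_ge0; rewrite /sixth_moment expectationE; apply: integral_ge0 => u' _;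
    rewrite lee_fin exprn_even_ge0.
have eta_small := stepsize_smoothness eta0 L_mu0 heta.
have alpha01 : 0 < alpha <= 1 by rewrite halpha; exact: momentum_range heta.
have alphaE : alpha = 96 * (L_f ^+ 2 * eta ^+ 2) by rewrite halpha mulrA.
have LE0 : 0 < L_f ^+ 2 * eta ^+ 2 by exact: mulr_gt0.
have K1 : 1 / (L_f ^+ 2 * eta ^+ 2) <= K%:R.
  by apply: le_trans (ceil_nat_ge hK); rewrite !le_max lexx !orbT.
have K_gt0 : (0 < K)%N by rewrite -(ltr0n R); apply: lt_le_trans K1; exact: divr_gt0.
have alphaK : 96 <= alpha * K%:R.
  rewrite alphaE -mulrA -[leLHS]mulr1 ler_pM2l//.
  by rewrite ler_pdivrMr// in K1; rewrite mulrC.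
have n_ge := ceil_nat_ge hn.
have n_gt0 : (0 < n)%N by rewrite -(ltr0n R); apply: lt_le_trans n_ge; exact: mulr_gt0.
have e40 : 0 < 4 * eps ^+ 2 by exact: mulr_gt0.
have n0_gt0 : (0 < n0)%N.
  rewrite -(ltr0n R); apply: lt_le_trans (ceil_nat_ge hn0); apply: divr_gt0 => //.
  by apply: mulr_gt0 => //; exact: mulr_gt0.
have n0_ge : 5 * (p - 1) * sigbar ^+ 2 <= n0%:R * (4 * eps ^+ 2).
  by rewrite -ler_pdivrMr//; exact: ceil_nat_ge.
have K_Delta0 : 108 * Delta_0 <= K%:R * (eta * eps ^+ 2).
  rewrite -ler_pdivrMr; last exact: mulr_gt0.
  by apply: le_trans (ceil_nat_ge hK); rewrite le_max lexx.
have K_c0 : 5 * lpnorm 2 (c x0) ^+ 2 <= K%:R * eps ^+ 2.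
  rewrite -ler_pdivrMr//.
  by apply: le_trans (ceil_nat_ge hK); rewrite !le_max lexx orbT.
have sigbarE : 8 * S_p * (sigma ^+ 2 + M_f ^+ 2) + 4 * M_f ^+ 2 + eps ^+ 2 / 8 <= 2 * sigbar ^+ 2.
  by rewrite hsigbar le_eqVlt; apply/orP; left; apply/eqP; field.
have sigbar_eta : 4 * alpha * sigbar ^+ 2 <= S_p * eps ^+ 2 / 60.
  have := stepsize_variance C0 hL_f sig0 heta.
  rewrite ler_pdivlMr// alphaE (_ : 23040 = 384 * 60); last by rewrite -natrM.
  by apply: le_trans; rewrite le_eqVlt; apply/orP; left; apply/eqP; ring.
have r2_le : 32 * (L_f ^+ 2 * nu ^+ 2 * U6) <= alpha * eps ^+ 2 / 36.
  have := smoothing_bias hL_f eps0 eta0 U60 hnu; rewrite alphaE.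
  rewrite (_ : 96 * _ * _ = 96 * (L_f ^+ 2 * eta ^+ 2 * eps ^+ 2)); last by rewrite !mulrA.
  exact: scaled_bias.
have mu_data : 40 * (M_f ^+ 2 + M_h ^+ 2 + m%:R ^+ 2 * rho ^+ 2 * Mbar_c ^+ 2 * M_c ^+ 2)
    <= mu ^+ 2 * beta ^+ 2 * eps ^+ 2.
  rewrite -[leRHS]mulrA -ler_pdivrMr; last exact: mulr_gt0.
  by rewrite hmu !le_max lexx !orbT.
have mu_L_v : 8 * (2 * L_v ^+ 2 + 1) <= 3 * (mu ^+ 2 * beta ^+ 2).
  rewrite [leRHS]mulrCA -ler_pdivrMr; last exact: mulr_gt0.
  by rewrite hmu !le_max lexx !orbT.
have F_C1 z : ~ N z -> continuously_differentiable (F^~ z).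
  by move=> Nz; apply: contrapT => H; apply: Nz; exact: NF.
(* From here on the estimates concern [F'] and its own run; outside the null set [M] of paths that
   draw a bad sample it is the given run. *)
pose F' := modification F N.
have F'_meas y : measurable_fun setT (F' y) by exact: modification_meas.
have F'_C1 z : continuously_differentiable (F'^~ z) by exact: modification_C1.
have hA2' : assumption2 Pxi F' Onu f sigma by exact: modification_assumption2.
have hA3' : assumption3 Pxi F' Onu L_f by exact: modification_assumption3.
have [M [mM M0 MN]] := sampled_off_null Hs mN N0.
have := run_exists K n0 n X h c v mu eta nu alpha (fun=> rho / K%:R) (fun k j => u k j)
  (fun k j => xi k j) x0 F'.
set x' := (X in mdlalm_run _ _ _ _ _ _ _ _ _ _ _ _ _ _ _ _ X _ _).
set s' := (X in mdlalm_run _ _ _ _ _ _ _ _ _ _ _ _ _ _ _ _ _ X _).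
set lam' := (X in mdlalm_run _ _ _ _ _ _ _ _ _ _ _ _ _ _ _ _ _ _ X).
move=> run'.
have agree w : ~ M w -> forall k, (k <= K)%N -> x k w = x' k w /\ lam k w = lam' k w.
  move=> Mw; apply: (run_agree run run') => k j y kK jn.
  by rewrite /F' modificationE//; exact: MN.
have hA6' : assumption6 P p X c beta K x'.
  have [M' [mM' M'0 M'A]] := hA6; exists (M `|` M'); split.
  - exact: measurableU.
  - by rewrite measureU0.
  move=> w /= Hw; apply: contrapT => /not_orP[Mw M'w]; apply: Hw => k kK.
  have [<- _] := agree w Mw k kK; apply: contrapT => H; apply: M'w; apply: M'A => /= /(_ k kK); exact: H.
have bound := expected_gradient_mapping hL_f hM_f hMbar_c hrho p2 pq F'_meas F'_C1 f_C1 c_C1 h_gtNy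
  h_cvx Onu_open X_Onu hA1 hA2' hA3' hA4 hA5 X_x0 mu0 eta0 nu0 eta_small alpha01 alphaE alphaK K_gt0
  n_gt0 n0_gt0 n_ge n0_ge K_Delta0 sigbarE sigbar_eta r2_le Hs run'.
have bound_c := expected_constraint hL_f hM_f hM_h hM_c hMbar_c hbeta hrho p2 pq F'_meas F'_C1 f_C1
  c_C1 h_gtNy h_cvx Onu_open X_Onu hA1 hA2' hA3' hA4 hA5 X_x0 mu0 eta0 nu0 eta_small alpha01 alphaE
  alphaK K_gt0 n_gt0 n0_gt0 n_ge n0_ge K_Delta0 K_c0 sigbarE sigbar_eta r2_le mu_data mu_L_v Hs run'
  hA6'.
split.
  (* Membership in [X] is required on every path, so it is taken from the original run; the
     multiplier comes from the modified one, where measurability is known. *)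
  split; first by move=> w; exact: (output_in idx p2 pq h_gtNy hA1 hA5 X_x0 run w).
  have mult : measurable_fun setT
      ((fun w => lam' (idx w) w + mu *: c (x' (idx w) w)) : W -> borelRV R m).
    apply: measurable_rV => i.
    exact: (measurable_multiplier p2 pq F'_meas F'_C1 c_C1 h_gtNy h_cvx hA1 hA5 eta0 Hs run').
  exists (mfun_Sub (mem_set mult)).
  have idxK w : (idx w <= K)%N by exact: ltnW.
  split.
    rewrite expectationE; apply: le_trans bound.
    rewrite le_eqVlt; apply/orP; left; apply/eqP; apply: (eq_integral_off mM M0) => w Mw.
    by have [-> _] := agree w Mw _ (idxK w); rewrite pnormE.
  rewrite expectationE; apply: le_trans bound_c.
  rewrite le_eqVlt; apply/orP; left; apply/eqP; apply: (eq_integral_off mM M0) => w Mw.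
  by have [-> _] := agree w Mw _ (idxK w); rewrite pnormE.
move=> eps1 w; rewrite oracle_complexityE//.
have h_fin := subdiff_fin h_gtNy (A1_h_proper hA1) (A1_h_subdiff_nonempty hA1) X_x0.
have c0_le : lpnorm 2 (c x0) ^+ 2 <= m%:R * Mbar_c ^+ 2.
  by apply: lpnorm2_sqr_le => i; exact: (A1_c_bounded hA1 i X_x0).
have D_le : Delta_0 <= `|gap| + 1 / 2 + 2 * m%:R * rho * Mbar_c ^+ 2.
  exact: Delta0_const_le h_fin mu0 cmu hgap.
(* The first iteration is counted separately with [n0], so [K - 1] enters, and this is at most the
   argument of the ceiling itself. *)
have K_le := ltW (ceil_nat_lt hK).
rewrite -[K in K%:R <= _](prednK K_gt0) -natr1 lerD2r in K_le.
exact: (complexity_bound C0 hL_f hMbar_c hL_c hrho p2 eps0 eps1 S1 eta0 L_mu0 erefl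
  hsigbar hmu heta (ltW (ceil_nat_lt hn0)) (ltW (ceil_nat_lt hn)) K_le (sqr_ge0 _) c0_le D_le).
Qed.
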